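(* Let $V$ be the seven-dimensional complex vector space of harmonic homogeneous cubic polynomials in $x=(x_1,x_2,x_3)$. A generic point $[f]\in\mathbf{P}(V)$ defines a cubic which contains precisely two icosahedral sets (nondegenerate or degenerate). For $[f]\in\mathbf{P}(V)$, the cubic $f=0$ contains exactly one or infinitely many icosahedral sets if and only if $[f]$ lies on the hypersurface $J_6=0$, where $$J_6=\frac{A^3}{221184}+\frac{5AB}{13824}-\frac{C}{576}$$ is the degree $6$ invariant of the binary sextic associated to $f$.
   Context: **Harmonic cubics.** $(x,y)=x_1y_1+x_2y_2+x_3y_3$ is the standard complex bilinear form on $\mathbf{C}^3$. $V$ is the space of homogeneous cubic polynomials $f(x_1,x_2,x_3)$ over $\mathbf{C}$ with $\sum\partial^2f/\partial x_i^2=0$; it is an irreducible representation of $SO(3,\mathbf{C})$. The space of all homogeneous cubics carries the $SO(3,\mathbf{C})$-invariant symmetric bilinear form normalized by $(f,(x,a)^3)=f(a)$ for all $a\in\mathbf{C}^3$; it restricts to an inner product on $V$. For $a\in\mathbf{C}^3$ put $f_a(x)=(x,a)^3-\frac35(a,a)(x,a)(x,x)\in V$; then $(f,f_a)=f(a)$ for $f\in V$. ''Generic'' means: for all points of a nonempty Zariski open subset. **Icosahedral sets and their subspaces.** The following three kinds of icosahedral sets each determine a three-dimensional subspace $U\subset V$ (these are exactly the three-dimensional subspaces isotropic for all skew forms $\omega_u(f,g)=(u\cdot f,g)$, $u\in\mathfrak{so}(3)$): - Nondegenerate: a set of six points $\{[a_1],\dots,[a_6]\}\subset\mathbf{P}^2=\mathbf{P}(\mathbf{C}^3)$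 that is the image under an element of $SO(3,\mathbf{C})$ of the six axes (lines through opposite vertices) of a regular icosahedron in $\mathbf{R}^3$ centred at $0$, e.g. the one with vertices the cyclic permutations of $(0,\pm1,\pm\varphi)$, $\varphi=(1+\sqrt5)/2$. Here $U$ is the span of $f_{a_1},\dots,f_{a_6}$, which has dimension $3$. - Degenerate of type 1: a pair $([a],[b])$ of points of $\mathbf{P}^2$ with $(a,a)=0$, $(a,b)=0$, $(b,b)\neq0$. Here $U$ is the span of $(b,x)^3-\frac35(b,x)(b,b)(x,x)$, $(a,x)^2(b,x)$, $(a,x)^3$. - Degenerate of type 2: a point $[a]$ with $(a,a)=0$. Here $U$ is the span of $(a,x)\left((b,x)^2-\frac15(b,b)(x,x)\right)$, $(a,x)^2(b,x)$, $(a,x)^3$, where $b$ is any vector with $(a,b)=0$, $(b,b)\ne0$ ($U$ depends only on $[a]$). The cubic $f=0$ ($f\in V\setminus 0$) *contains* an icosahedral set if $f$ is orthogonal to the corresponding $U$. (In the nondegenerate case this means $f(a_i)=0$ for $i=1,\dots,6$.) **The associated binary sextic and its invariants.** $V$ is identified, $SO(3,\mathbf{C})\cong SL(2,\mathbf{C})/\pm1$-equivariantly and uniquely up to scale, with the space $S^6$ of homogeneous sextics in $(z_1,z_2)$, by restricting $f$ to the conic $(x,x)=0$: $f\mapsto f(z_1^2-z_2^2,\ i(z_1^2+z_2^2),\ 2z_1z_2)$. Write the sextic in inhomogeneous form as $u_0x^6+u_1x^5+\dots+u_6$ with roots $x_1,\dots,x_6$, and write $(ij)=x_i-x_j$. Then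 $$A=u_0^2\sum_{\text{fifteen}}(12)^2(34)^2(56)^2,$$ $$B=u_0^4\sum_{\text{ten}}(12)^2(23)^2(31)^2(45)^2(56)^2(64)^2,$$ $$C=u_0^6\sum_{\text{sixty}}(12)^2(23)^2(31)^2(45)^2(56)^2(64)^2(14)^2(25)^2(36)^2,$$ where the sums run over the distinct expressions obtained by permuting the six roots: the 15 partitions of $\{1,\dots,6\}$ into three pairs for $A$; the 10 partitions into two triples for $B$; the 60 choices of a partition into two triples together with a bijection between the two triples for $C$. $A,B,C$ are polynomials in $u_0,\dots,u_6$ (hence defined also when $u_0=0$), homogeneous of degrees $2,4,6$ and invariant under $SL(2,\mathbf{C})$. *)

(* Defs.v *)
From HB Require Import structures.
From mathcomp Require Import all_boot all_order all_algebra all_fingroup.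
From mathcomp Require Import finmap.
From mathcomp Require Import boolp classical_sets functions cardinality reals.
From mathcomp Require Import complex.
From mathcomp Require Import mpoly.
From mathcomp Require Import zify ring.

Set Implicit Arguments.
Unset Strict Implicit.
Unset Printing Implicit Defensive.

Import Order.TTheory GRing.Theory Num.Theory.
Local Open Scope ring_scope.

Section Zariski.
Variables (K : fieldType) (vT : vectType K).

(* Points of a projective space P(V) are one-dimensional subspaces <[v]>.
   A homogeneous polynomial in \dim V variables is evaluated at v \in V through
   the coordinates of v in the basis vbasis V. *)
Definition coords (V : {vspace vT}) (v : vT) : 'I_(\dim V) -> K :=
  fun i => coord (vbasis V) i v.

Definition zariski_open (V : {vspace vT}) (W : set {vspace vT}) : Prop :=
  exists S : set {mpoly K[\dim V]},
    (forall F, S F -> exists d, F \is d.-homog) /\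
    W = [set p | exists v, [/\ v \in V, v != 0, p = <[v]>%VS &
                 exists2 F, S F & F.@[@coords V v] != 0]]%classic.

Definition for_generic_point (V : {vspace vT}) (P : vT -> Prop) : Prop :=
  exists W : set {vspace vT},
    [/\ zariski_open V W, (W !=set0)%classic &
        forall v, v \in V -> v != 0 -> W <[v]>%VS -> P v].

End Zariski.

Arguments coords {K vT} V v.

Section HarmonicCubics.
Variable C : numClosedFieldType.

Definition cubic : Type := dhomog 3 C 3.
HB.instance Definition _ := Vector.on cubic.

Definition dot (a b : 'rV[C]_3) : C := \sum_i a 0 i * b 0 i.
(* the linear form (x, a) *)
Definition lin (a : 'rV[C]_3) : {mpoly C[3]} := \sum_i a 0 i *: 'X_i.
(* (x, x) *)
Definition norm2 : {mpoly C[3]} := \sum_i 'X_i ^+ 2.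

Lemma lin_homog a : lin a \is 1.-homog.
Proof. by rewrite rpred_sum // => i _; rewrite rpredZ // dhomogX /= mdeg1. Qed.

Lemma norm2_homog : norm2 \is 2.-homog.
Proof.
by rewrite rpred_sum // => i _; apply: (@dhomogMn _ _ _ 1); rewrite dhomogX /= mdeg1.
Qed.

Lemma lin3_homog a b c : lin a * lin b * lin c \is 3.-homog.
Proof. by rewrite (@dhomogM _ _ _ 2) ?(@dhomogM _ _ _ 1) ?lin_homog. Qed.

Lemma linn_homog a : lin a * norm2 \is 3.-homog.
Proof. by rewrite (@dhomogM _ _ _ 1) ?lin_homog ?norm2_homog. Qed.

Definition lin3 a b c : cubic := DHomog (lin3_homog a b c).
Definition linn a : cubic := DHomog (linn_homog a).

Definition laplacian (f : {mpoly C[3]}) : {mpoly C[3]} :=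
  \sum_i (f^`M(i))^`M(i).

Lemma laplacian_homog (f : cubic) : laplacian f \is 1.-homog.
Proof.
rewrite rpred_sum // => i _; apply/dhomogP => m.
rewrite mcoeff_msupp !mcoeff_mderiv => h.
have : f@_(m + U_(i) + U_(i)) != 0.
  by apply: contra_neq h => ->; rewrite !mul0rn.
rewrite -mcoeff_msupp => /(dhomogP _ _ _ (valP f)).
by rewrite /= !mdegD !mdeg1; lia.
Qed.

Definition lap (f : cubic) : dhomog 3 C 1 := DHomog (laplacian_homog f).

Lemma lap_is_linear : linear lap.
Proof.
move=> c f g; apply/val_inj => /=; rewrite /laplacian scaler_sumr -big_split /=.
by apply: eq_bigr => i _; rewrite !(mderivD, mderivZ).
Qed.
HB.instance Definition _ := GRing.isLinear.Build C cubic (dhomog 3 C 1) _ lap lap_is_linear.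

Definition harmonic : {vspace cubic} := lker (linfun lap).

Lemma mem_harmonic f : (f \in harmonic) = (laplacian f == 0).
Proof. by rewrite memv_ker lfunE /= -val_eqE. Qed.

(* The coefficientwise formula for the invariant form: pairing_lin3 is its defining
   normalization (f, (x, a)^3) = f(a). *)
Definition pairing (f g : cubic) : C :=
  \sum_(m : 'X_{1..3 < 4}) (\prod_i (m i)`!)%N%:R / 6 * (val f)@_m * (val g)@_m.

Lemma eq_mnm3 (m n : 'X_{1..3}) :
  (m == n) = [&& m 0 == n 0, m 1 == n 1 & m 2 == n 2].
Proof.
apply/eqP/and3P => [->//|[/eqP h0 /eqP h1 /eqP h2]]; apply/mnmP.
by case=> [[|[|[|k]]] lk] //; [move: h0|move: h1|move: h2];
  congr (m _ = n _); apply/val_inj.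
Qed.

Lemma mderivXU n (i j : 'I_n) : ('X_j : {mpoly C[n]})^`M(i) = (j == i)%:R.
Proof.
rewrite mderivX mnm1E; have [<-|_] := eqVneq; last by rewrite scale0r.
suff -> : (U_(j) - U_(j) = 0)%MM by rewrite mpolyX0 scale1r.
by apply/mnmP => k; rewrite mnmBE mnm0E subnn.
Qed.

Lemma mderiv_nat n (i : 'I_n) k : (k%:R : {mpoly C[n]})^`M(i) = 0.
Proof. by rewrite -mpolyC_nat mderivC. Qed.

Lemma dim_harmonic : \dim harmonic = 7.
Proof.
have img : (linfun lap @: fullv)%VS = fullv.
  apply/eqP; rewrite eqEsubv subvf /=; apply/subvP => p _.
  pose a : 'rV[C]_3 := \row_i (val p)@_(U_(i)).
  have lapE : lap (linn a) = 10%:R *: p.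
    apply/val_inj => /=; rewrite /laplacian.
    have -> : val p = lin a.
      apply/mpolyP => m; rewrite /lin raddf_sum /=.
      under eq_bigr => i _ do rewrite mcoeffZ mcoeffX mxE.
      have [m1|m1] := eqVneq (mdeg m) 1%N; last first.
        rewrite (dhomog_nemf_coeff (valP p) m1) big1 // => i _.
        by case: eqP => [h|_]; rewrite ?mulr0 // -h mdeg1 in m1 *.
      have /existsP[j /eqP ->] : [exists j, m == U_(j)%MM] by rewrite -mdeg_eq1 m1.
      rewrite (bigD1 j) //= eqxx mulr1 big1 ?addr0 // => i /negPf ij.
      case: eqP => [/(congr1 (fun n : 'X_{1..3} => n j))|_]; last by rewrite mulr0.
      by rewrite !mnm1E eqxx ij.
    rewrite /linn /= /lin /norm2 !big_ord_recl !big_ord0 /= !expr2.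
    rewrite !(mderivD,mderivM,mderivZ,mderivXU,mderiv_nat,mderiv0) /=.
    rewrite -!mul_mpolyC.
    by ring.
  apply/memv_imgP; exists (10%:R^-1 *: linn a); first exact: memvf.
  by rewrite linearZ /= lfunE /= lapE scalerA mulVf ?scale1r // pnatr_eq0.
have := limg_ker_dim (linfun lap) fullv.
rewrite capfv img !dimvf /=.
move=> h; have {h} : (\dim harmonic + 3 = 10)%N by exact: h.
by lia.
Qed.

Lemma pairing_lin3 (f : cubic) a : pairing f (lin3 a a a) = (val f).@[a 0].
Proof.
have szf : (msize (val f) <= 4)%N.
  rewrite msizeE; apply/bigmax_leqP_seq => m m_f _.
  by rewrite (dhomogP _ _ _ (valP f) m m_f).
rewrite [in RHS](mpolywE szf) raddf_sum; apply: eq_bigr => m _ /=.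
have [fm0|fm0] := eqVneq (val f)@_m 0.
  by rewrite fm0 mevalZ mulr0 !mul0r.
have m3 : mdeg m = 3%N.
  by apply/(dhomogP _ _ _ (valP f)); rewrite mcoeff_msupp.
rewrite mevalZ mevalX mulrAC [RHS]mulrC; congr (_ * _) => /=.
have -> : (lin a * lin a * lin a)@_m = \sum_i \sum_j \sum_k
    a 0 i * a 0 j * a 0 k * ((U_(i) + U_(j) + U_(k))%MM == m)%:R.
  rewrite {1 2}/lin big_distrlr mulr_suml raddf_sum /=; apply: eq_bigr => i _.
  rewrite mulr_suml raddf_sum /=; apply: eq_bigr => j _.
  rewrite mulr_sumr raddf_sum /=; apply: eq_bigr => k _.
  rewrite -!(scalerAl, scalerAr) -!mpolyXD !mcoeffZ mcoeffX !mulrA; congr (_ * _).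
  by ring.
have l1 : lift ord0 ord0 = 1 :> 'I_3 by apply/val_inj.
have l2 : lift ord0 (lift ord0 ord0) = 2 :> 'I_3 by apply/val_inj.
move: m3; rewrite mdegE !big_ord_recl !big_ord0 /= !eq_mnm3 !mnmDE !mnm1E /= !l1 !l2.
rewrite -[ord0]/(0 : 'I_3).
move: (m 0) (m 1) (m 2) => [|[|[|[|?]]]] [|[|[|[|?]]]] [|[|[|[|?]]]] //= _;
  rewrite ?(erefl : 3`! = 6)%N ?(erefl : 2`! = 2)%N ?(erefl : 1`! = 1)%N ?fact0;
  rewrite ?muln1 ?mul1n ?mulr0n ?mulr1n ?mulr0 ?addr0 ?add0r ?mulr1.
all: by field; rewrite ?pnatr_eq0.
Qed.

Definition fcub (a : 'rV[C]_3) : cubic :=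
  lin3 a a a - (3 / 5 * dot a a) *: linn a.

Definition SO3 (g : 'M[C]_3) : Prop := g *m g^T = 1%:M /\ \det g = 1.

Definition golden : C := (1 + sqrtC 5) / 2.
Definition vec3 (a b c : C) : 'rV[C]_3 := \row_(i < 3) nth 0 [:: a; b; c] i.

(* one vertex from each of the six opposite pairs of the regular icosahedron
   whose vertices are the cyclic permutations of (0, +-1, +-golden); any other
   regular icosahedron centred at 0 has the axes of a rotated copy of it *)
Definition axes : seq 'rV[C]_3 :=
  [:: vec3 0 1 golden; vec3 golden 0 1; vec3 1 golden 0;
      vec3 0 1 (- golden); vec3 (- golden) 0 1; vec3 1 (- golden) 0].

(* Candidates for icosahedral sets; the points of P^2 are the lines <[a]>. *)
Inductive icosahedral_data : Type :=
| Nondegenerate of {fset {vspace 'rV[C]_3}}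
| Degenerate1 of {vspace 'rV[C]_3} & {vspace 'rV[C]_3}
| Degenerate2 of {vspace 'rV[C]_3}.

(* X is an icosahedral set and U is the subspace it determines. *)
Inductive icosahedral : icosahedral_data -> {vspace cubic} -> Prop :=
| IcoNondegenerate g of SO3 g :
    icosahedral (Nondegenerate [fset <[a *m g]>%VS | a in axes]%fset)
                <<[seq fcub (a *m g) | a <- axes]>>%VS
| IcoDegenerate1 a b of a != 0 & dot a a = 0 & dot a b = 0 & dot b b != 0 :
    icosahedral (Degenerate1 <[a]>%VS <[b]>%VS)
                <<[:: fcub b; lin3 a a b; lin3 a a a]>>%VS
| IcoDegenerate2 a b of a != 0 & dot a a = 0 & dot a b = 0 & dot b b != 0 :
    icosahedral (Degenerate2 <[a]>%VS)
                <<[:: lin3 a b b - (5^-1 * dot b b) *: linn a;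
                      lin3 a a b; lin3 a a a]>>%VS.

Definition contains (f : cubic) (X : icosahedral_data) : Prop :=
  exists2 U, icosahedral X U & {in U, forall h, pairing f h = 0}.

Definition icosahedral_sets_in (f : cubic) : set icosahedral_data :=
  [set X | contains f X]%classic.

(* z_1 is 'X_0 and z_2 is 'X_1 *)
Definition conic : 3.-tuple {mpoly C[2]} :=
  [tuple 'X_0 ^+ 2 - 'X_1 ^+ 2; 'i *: ('X_0 ^+ 2 + 'X_1 ^+ 2); 2 *: ('X_0 * 'X_1)].

(* u_k is the coefficient of z_1^(6 - k) z_2^k *)
Definition sextic (f : cubic) : 'I_7 -> C :=
  fun k => (val f \mPo conic)@_(U_(0) *+ (6 - k) + U_(1) *+ k).

End HarmonicCubics.

Section RootExpressions.
Variable S : comNzRingType.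

Definition sqdiff (x : 'I_6 -> S) (i j : nat) : S :=
  (x (inord i) - x (inord j)) ^+ 2.

Definition exprA (x : 'I_6 -> S) : S :=
  sqdiff x 0 1 * sqdiff x 2 3 * sqdiff x 4 5.

Definition exprB (x : 'I_6 -> S) : S :=
  sqdiff x 0 1 * sqdiff x 1 2 * sqdiff x 2 0 *
  sqdiff x 3 4 * sqdiff x 4 5 * sqdiff x 5 3.

Definition exprC (x : 'I_6 -> S) : S :=
  exprB x * sqdiff x 0 3 * sqdiff x 1 4 * sqdiff x 2 5.

End RootExpressions.

Lemma rmorph_expr (S T : comNzRingType) (g : {rmorphism S -> T}) (x : 'I_6 -> S) :
  [/\ g (exprA x) = exprA (g \o x), g (exprB x) = exprB (g \o x) &
      g (exprC x) = exprC (g \o x)].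
Proof.
have gE i j : g (sqdiff x i j) = sqdiff (g \o x) i j.
  by rewrite rmorphXn rmorphB.
rewrite /exprA /exprC /exprB; move: (sqdiff x) (sqdiff (g \o x)) gE => d d' gE.
by split; rewrite !rmorphM !gE.
Qed.

Section BinarySextics.
Variable C : numClosedFieldType.

(* u_0 x^6 + u_1 x^5 + ... + u_6 |-> (u_0, ..., u_6) *)
Definition sextic_coefs (p : {poly C}) : 'I_7 -> C := fun k => p`_(6 - k).
Definition sextic_of_roots (u0 : C) (x : 'I_6 -> C) : {poly C} :=
  u0 *: \prod_i ('X - (x i)%:P).

Definition vdeg (l : 'I_6) (d : nat) (s : {mpoly C[6]}) :=
  forall m, m \in msupp s -> (m l <= d)%N.

Lemma vdegW l d e s : (d <= e)%N -> vdeg l d s -> vdeg l e s.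
Proof. by move=> de h m /h hm; apply: leq_trans hm de. Qed.

Lemma vdegD l d s t : vdeg l d s -> vdeg l d t -> vdeg l d (s + t).
Proof. by move=> hs ht m /msuppD_le; rewrite mem_cat => /orP[/hs|/ht]. Qed.

Lemma vdegZ l d c s : vdeg l d s -> vdeg l d (c *: s).
Proof. by move=> hs m /msuppZ_le/hs. Qed.

Lemma vdeg_sum l d (I : Type) (r : seq I) (P : pred I) (F : I -> {mpoly C[6]}) :
  (forall i, P i -> vdeg l d (F i)) -> vdeg l d (\sum_(i <- r | P i) F i).
Proof.
move=> h; apply: (big_ind (vdeg l d)) => //; first by move=> m; rewrite msupp0.
exact: vdegD.
Qed.

Lemma vdegM l d e s t : vdeg l d s -> vdeg l e t -> vdeg l (d + e)%N (s * t).
Proof.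
move=> hs ht m /msuppM_le/allpairsP[[m1 m2] /= [/hs h1 /ht h2 ->]].
by rewrite mnmDE leq_add.
Qed.

Lemma vdeg1 l : vdeg l 0 1.
Proof. by move=> m; rewrite msupp1 inE => /eqP->; rewrite mnm0E. Qed.

Lemma vdegX l d s k : vdeg l d s -> vdeg l (d * k)%N (s ^+ k).
Proof.
move=> h; elim: k => [|k ih]; first by rewrite muln0; exact: vdeg1.
by rewrite exprS mulnS; apply: vdegM.
Qed.

Lemma vdeg_prod l (I : Type) (r : seq I) (d : I -> nat) (F : I -> {mpoly C[6]}) :
  (forall i, vdeg l (d i) (F i)) ->
  vdeg l (\sum_(i <- r) d i)%N (\prod_(i <- r) F i).
Proof.
move=> h; elim: r => [|i r ih]; first by rewrite !big_nil; exact: vdeg1.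
by rewrite !big_cons; apply: vdegM.
Qed.

Lemma vdeg_mesym l k : vdeg l 1 (mesym 6 C k).
Proof. by move=> m; rewrite mem_msupp_mesym => /andP[_ /forallP]. Qed.

Lemma vdeg_sqdiff l (s : 'S_6) i j :
  vdeg l (((s (inord i) == l) + (s (inord j) == l)) * 2)%N
    (sqdiff (fun i => 'X_(s i)) i j).
Proof.
apply: vdegX; rewrite -scaleN1r; apply: vdegD; last apply: vdegZ;
  by move=> m; rewrite msuppX inE => /eqP ->; rewrite mnm1E; do 2![case: (_ == _)].
Qed.

Lemma coef_sextic_of_roots u0 x (k : 'I_7) :
  sextic_coefs (sextic_of_roots u0 x) k = u0 * ((-1) ^+ k * (mesym 6 C k).@[x]).
Proof.
rewrite /sextic_coefs coefZ; congr (_ * _).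
have := mroots_coeff [tuple x i | i < 6] k.
rewrite big_tuple (eq_bigr (fun i => 'X - (x i)%:P)) => [|i _]; last first.
  by rewrite tnth_mktuple.
by move=> ->; congr (_ * _); apply: meval_eq => i; rewrite tnth_mktuple.
Qed.

Lemma root_invariant (d : nat) (s : {mpoly C[6]}) :
  s \is symmetric -> (forall l, vdeg l d s) ->
  {P : {mpoly C[7]} | P \is d.-homog &
    forall u0 x, P.@[sextic_coefs (sextic_of_roots u0 x)] = u0 ^+ d * s.@[x]}.
Proof.
elim/mleadrect: s => s ih sym_s deg_s.
have [->|nz_s] := eqVneq s 0.
  by exists 0 => [|u0 x]; rewrite ?dhomog0 // !meval0 mulr0.
have /and3P[lt_s sym_s' /eqP sE] := symf1P sym_s.
pose c := nth 0%N (mlead s).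
pose F := [multinom (c i - c i.+1)%N | i < 6].
have s1E : (symf1 s).1 = s@_(mlead s) *: 'X_[F] by rewrite /symf1 (negPf nz_s).
pose t := \prod_(i < 6) (mesym 6 C i.+1) ^+ F i.
have tE : (symf1 s).1 \mPo [tuple mesym 6 C i.+1 | i < 6] = s@_(mlead s) *: t.
  rewrite s1E comp_mpolyZ comp_mpolyX; congr (_ *: _).
  by apply: eq_bigr => i _; rewrite tnth_mktuple.
have deg_F : (\sum_i F i <= d)%N.
  have cE (i : 'I_6) : c i = mlead s i by rewrite /c -mnm_nth.
  have c_lt k : (k < 5)%N -> (c k.+1 <= c k)%N.
    move=> lt_k5.
    have lt1 : (k.+1 < 6)%N by [].
    have lt0 : (k < 6)%N by apply: ltnW.
    have := mlead_msym_sorted sym_s (i := Ordinal lt0) (j := Ordinal lt1).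
    by rewrite -!cE /=; apply.
  have c6 : c 6%N = 0%N by rewrite /c nth_default // size_tuple.
  have : (c 0%N <= d)%N.
    have := deg_s ord0 _ (mlead_supp nz_s); rewrite -cE; exact.
  move: (c_lt 0%N isT) (c_lt 1%N isT) (c_lt 2%N isT) (c_lt 3%N isT) (c_lt 4%N isT).
  rewrite !big_ord_recl big_ord0 !mnmE /= /bump /= !addn0 ?add1n c6.
  by lia.
have deg_t l : vdeg l d t.
  apply: vdegW deg_F _; rewrite /t; apply: vdeg_prod => i.
  by rewrite -[X in vdeg _ X]mul1n; apply/vdegX/vdeg_mesym.
pose Q : {mpoly C[7]} := s@_(mlead s) *: ('X_ord0 ^+ (d - \sum_i F i) *
  \prod_(i < 6) ((-1) ^+ i.+1 *: 'X_(lift ord0 i)) ^+ F i).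
have homQ : Q \is d.-homog.
  rewrite /Q rpredZ //.
  have homX k (p : {mpoly C[7]}) : p \is 1.-homog -> p ^+ k \is k.-homog.
    by move=> /(dhomogMn k); rewrite mul1n.
  have := subnK deg_F; set N := (_ - _)%N => <-; apply: dhomogM.
    by apply: homX; rewrite dhomogX /= mdeg1.
  elim/big_rec2: _ => [|i e q _ hq]; first exact: dhomog1.
  by apply: dhomogM => //; apply: homX; rewrite rpredZ // dhomogX /= mdeg1.
have evalQ u0 x : Q.@[sextic_coefs (sextic_of_roots u0 x)]
    = u0 ^+ d * (s@_(mlead s) *: t).@[x].
  rewrite !mevalZ mevalM rmorphXn /= mevalXU coef_sextic_of_roots mesym0E meval1.
  rewrite !mulr1 [RHS]mulrCA; congr (_ * _).
  rewrite -{2}(subnK deg_F) exprD -mulrA; congr (_ * _).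
  rewrite /t !rmorph_prod /= -prodrXr -big_split /=; apply: eq_bigr => i _.
  rewrite !rmorphXn /= mevalZ mevalXU coef_sextic_of_roots /= mulrCA signrMK.
  by rewrite exprMn.
have [s'0|nz_s'] := eqVneq (symf1 s).2 0.
  exists Q => // u0 x; rewrite evalQ; congr (_ * _.@[_]).
  by rewrite [RHS]sE s'0 addr0 tE.
rewrite (negPf nz_s') /= in lt_s.
have deg_s' l : vdeg l d (symf1 s).2.
  have -> : (symf1 s).2 = s + (- s@_(mlead s)) *: t.
    by rewrite {2}sE tE scaleNr addrC addKr.
  by apply: vdegD => //; apply: vdegZ.
have [P homP evalP] := ih _ lt_s sym_s' deg_s'.
exists (P + Q) => [|u0 x]; first by rewrite rpredD.
by rewrite mevalD evalP evalQ -mulrDr -mevalD addrC -tE -sE.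
Qed.

(* The sum of the distinct expressions obtained from E by permuting the roots,
   each of them being the image of E under exactly k permutations: k = 48, 72
   and 12, as there are 15, 10 and 60 distinct expressions. *)
Definition orbit_sum (E : ('I_6 -> {mpoly C[6]}) -> {mpoly C[6]}) (k : nat) :
    {mpoly C[6]} :=
  k%:R^-1 *: \sum_(s : 'S_6) E (fun i => 'X_(s i)).

Definition sumA : {mpoly C[6]} := orbit_sum (@exprA _) 48.
Definition sumB : {mpoly C[6]} := orbit_sum (@exprB _) 72.
Definition sumC : {mpoly C[6]} := orbit_sum (@exprC _) 12.

Lemma orbit_sum_sym E k :
  (forall (s : 'S_6) x, msym s (E x) = E (msym s \o x)) ->
  (forall x y, x =1 y -> E x = E y) -> orbit_sum E k \is symmetric.
Proof.
move=> hE eE; apply/issymP => t; rewrite msymZ; congr (_ *: _).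
rewrite (raddf_sum (msym t)) [RHS](reindex_inj (mulIg t)) /=.
apply: eq_bigr => s _; rewrite hE; apply: eE => i /=.
by rewrite /msym mmapX mmap1U permM.
Qed.

Lemma orbit_sum_vdeg E k l d :
  (forall s : 'S_6, vdeg l d (E (fun i => 'X_(s i)))) -> vdeg l d (orbit_sum E k).
Proof. by move=> h; apply/vdegZ/vdeg_sum => s _. Qed.

Lemma sum_sym : [/\ sumA \is symmetric, sumB \is symmetric & sumC \is symmetric].
Proof.
split; apply: orbit_sum_sym => [s x|x y xy].
- by case: (rmorph_expr (msym s) x).
- by rewrite /exprA /sqdiff !xy.
- by case: (rmorph_expr (msym s) x).
- by rewrite /exprB /sqdiff !xy.
- by case: (rmorph_expr (msym s) x).
- by rewrite /exprC /exprB /sqdiff !xy.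
Qed.

Lemma sum_inord_le1 (s : 'S_6) (l : 'I_6) :
  ((s (inord 0) == l) + (s (inord 1) == l) + (s (inord 2) == l) +
   (s (inord 3) == l) + (s (inord 4) == l) + (s (inord 5) == l) <= 1)%N.
Proof.
have -> : l = s ((s^-1)%g l) by rewrite permKV.
rewrite !(inj_eq perm_inj) -!val_eqE /= !inordK //.
by case: (val _) => [|[|[|[|[|[|]]]]]].
Qed.

Lemma sum_vdeg l : [/\ vdeg l 2 sumA, vdeg l 4 sumB & vdeg l 6 sumC].
Proof.
pose b (s : 'S_6) k := nat_of_bool (s (inord k) == l).
have b_le1 (s : 'S_6) : (b s 0%N + b s 1%N + b s 2 + b s 3 + b s 4 + b s 5 <= 1)%N.
  exact: sum_inord_le1.
have h (s : 'S_6) i j :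
    vdeg l ((b s i + b s j) * 2)%N (sqdiff (fun i => 'X_(s i)) i j).
  exact: vdeg_sqdiff.
split; apply: orbit_sum_vdeg => s; have := b_le1 s; have {h} := h s;
  move: (b s) => {b_le1}b h b_le1.
- by apply: vdegW (vdegM (vdegM (h 0%N 1%N) (h 2%N 3%N)) (h 4%N 5%N)); lia.
- by apply: vdegW (vdegM (vdegM (vdegM (vdegM (vdegM
    (h 0%N 1%N) (h 1%N 2%N)) (h 2%N 0%N)) (h 3%N 4%N)) (h 4%N 5%N)) (h 5%N 3%N)); lia.
- by apply: vdegW (vdegM (vdegM (vdegM (vdegM (vdegM (vdegM (vdegM (vdegM
    (h 0%N 1%N) (h 1%N 2%N)) (h 2%N 0%N)) (h 3%N 4%N)) (h 4%N 5%N)) (h 5%N 3%N))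
    (h 0%N 3%N)) (h 1%N 4%N)) (h 2%N 5%N)); lia.
Qed.

Lemma invA_subproof : {P : {mpoly C[7]} | P \is 2.-homog &
  forall u0 x, P.@[sextic_coefs (sextic_of_roots u0 x)] = u0 ^+ 2 * sumA.@[x]}.
Proof. by apply: root_invariant => [|l]; [case: sum_sym|case: (sum_vdeg l)]. Qed.

Lemma invB_subproof : {P : {mpoly C[7]} | P \is 4.-homog &
  forall u0 x, P.@[sextic_coefs (sextic_of_roots u0 x)] = u0 ^+ 4 * sumB.@[x]}.
Proof. by apply: root_invariant => [|l]; [case: sum_sym|case: (sum_vdeg l)]. Qed.

Lemma invC_subproof : {P : {mpoly C[7]} | P \is 6.-homog &
  forall u0 x, P.@[sextic_coefs (sextic_of_roots u0 x)] = u0 ^+ 6 * sumC.@[x]}.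
Proof. by apply: root_invariant => [|l]; [case: sum_sym|case: (sum_vdeg l)]. Qed.

(* invA_roots determines invA, since the sextics with u_0 != 0 are Zariski
   dense; likewise for invB and invC. *)
Definition invA : {mpoly C[7]} := s2val invA_subproof.
Definition invB : {mpoly C[7]} := s2val invB_subproof.
Definition invC : {mpoly C[7]} := s2val invC_subproof.

Lemma invA_roots u0 x : invA.@[sextic_coefs (sextic_of_roots u0 x)] =
  u0 ^+ 2 * (48^-1 * \sum_(s : 'S_6) exprA (x \o s)).
Proof.
rewrite (s2valP' invA_subproof) mevalZ raddf_sum; congr (_ * (_ * _)).
apply: eq_bigr => s _.
have [eA _ _] := rmorph_expr (meval x) (fun i => 'X_(s i)).
by rewrite [LHS]eA /exprA /sqdiff /= !mevalXU.
Qed.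

Lemma invB_roots u0 x : invB.@[sextic_coefs (sextic_of_roots u0 x)] =
  u0 ^+ 4 * (72^-1 * \sum_(s : 'S_6) exprB (x \o s)).
Proof.
rewrite (s2valP' invB_subproof) mevalZ raddf_sum; congr (_ * (_ * _)).
apply: eq_bigr => s _.
have [_ eB _] := rmorph_expr (meval x) (fun i => 'X_(s i)).
by rewrite [LHS]eB /exprB /sqdiff /= !mevalXU.
Qed.

Lemma invC_roots u0 x : invC.@[sextic_coefs (sextic_of_roots u0 x)] =
  u0 ^+ 6 * (12^-1 * \sum_(s : 'S_6) exprC (x \o s)).
Proof.
rewrite (s2valP' invC_subproof) mevalZ raddf_sum; congr (_ * (_ * _)).
apply: eq_bigr => s _.
have [_ _ eC] := rmorph_expr (meval x) (fun i => 'X_(s i)).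
by rewrite [LHS]eC /exprC /exprB /sqdiff /= !mevalXU.
Qed.

Lemma inv_homog : [/\ invA \is 2.-homog, invB \is 4.-homog & invC \is 6.-homog].
Proof.
by split; [exact: s2valP invA_subproof | exact: s2valP invB_subproof
          | exact: s2valP invC_subproof].
Qed.

(* 221184 = 2 * 48^3, 13824 = 24^3 and 576 = 24^2 *)
Definition J6 : {mpoly C[7]} :=
  (2 * 48 ^+ 3)^-1 *: invA ^+ 3 + (5 / 24 ^+ 3) *: (invA * invB)
    - (24 ^+ 2)^-1 *: invC.

End BinarySextics.

(* Main.v *)
(** Restriction to the conic turns harmonic cubics into binary sextics, given by their seven
    coefficients; the invariant pairing becomes a multiple of the apolar form, and the spaces U
    of the icosahedral sets become exactly the three-dimensional spaces of sextics isotropic for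
    the three forms omega_u: such a space contains a form with a triple root (a root of its
    Wronskian, which has degree 12), and moving this root to z_2 = 0 leaves two degenerate spaces
    and a one-parameter family on which the torus acts. An icosahedral set is recovered from U
    through the vectors a such that the cube of (x, a) restricts to an element of U.

    It remains to count the isotropic spaces apolar to a nonzero sextic f. If f has a simple
    root, move it and another root to infinity and 0; the spaces then correspond to the
    points common to a conic and a line of P^2, and the discriminant of this intersection is
    16 J_6. Otherwise f has a root of multiplicity at least four (J_6 = 0, infinitely many
    spaces), or three double roots (the same), or two triple roots (J_6 <> 0, two spaces). *)

From HB Require Import structures.
Require Import Defs.
From mathcomp Require Import all_boot all_order all_algebra all_fingroup.
From mathcomp Require Import finmap.
From mathcomp Require Import boolp classical_sets functions cardinality reals.
From mathcomp Require Import complex.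
From mathcomp Require Import mpoly.
From mathcomp Require Import zify ring.
Set Implicit Arguments.
Unset Strict Implicit.
Unset Printing Implicit Defensive.
Import Order.TTheory GRing.Theory Num.Theory.
Local Open Scope ring_scope.

(** * The invariants as sums of products of brackets *)

(** The subspaces U, rather than the point configurations, carry the argument: isotropy and
    apolarity are explicit polynomial conditions on seven coefficients, and the group enters only
    through translations, the inversion and the torus. Two obstacles shape the proof. A, B and C are
    accessible only through the roots of sextics with u_0 != 0, so every statement on J_6 goes
    through linear factors, and roots at infinity are reached by perturbing the factors; the sums
    over 720 permutations are cut down by computation to 15, 10 and 60 products, small enough for
    polynomial identities. And no rotation carrying the standard icosahedron into a given isotropic
    space is ever written down: an icosahedron has no null axis, so the classification places its
    space in the one family left, whose members with nonzero parameter form a single orbit. The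
    equivalence of the theorem comes from two implications, J_6 != 0 giving two sets and J_6 = 0
    giving one or infinitely many. As these outcomes exclude each other, both are established for
    every nonzero f, and genericity only concerns the open set J_6 != 0. *)

Definition perms6 := permutations (iota 0 6).
Arguments perms6 : simpl never.

Definition perm_seq (s : 'S_6) : seq nat := [seq val (s i) | i <- enum 'I_6].

(** The value lists of permutations are distinct arrangements of 0, ..., 5, and there are 6! of
    either kind. Sums over ['S_6] thereby become sums over an explicit list. *)
Lemma perm_seq_perms :
  perm_eq [seq perm_seq s | s <- index_enum 'S_6] (perms6).
Proof.
have inj : injective perm_seq.
  move=> s t /eq_in_map st; apply/permP => i; apply/val_inj/st.
  by rewrite mem_enum.
have u1 : uniq [seq perm_seq s | s <- index_enum 'S_6].
  by rewrite map_inj_uniq // index_enum_uniq.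
have sub : {subset [seq perm_seq s | s <- index_enum 'S_6] <= perms6}.
  move=> _ /mapP[s _ ->]; rewrite /perms6 mem_permutations.
  apply: uniq_perm.
  - by rewrite map_inj_uniq ?enum_uniq // => i j /val_inj/perm_inj.
  - exact: iota_uniq.
  - move=> k; rewrite mem_iota add0n leq0n /=; apply/mapP/idP => [[i _ ->]|k6].
      exact: ltn_ord.
    by exists ((s^-1)%g (Ordinal k6)); rewrite ?mem_enum ?permKV.
have sz : (size (perms6) <= size [seq perm_seq s | s <- index_enum 'S_6])%N.
  rewrite /perms6 size_permutations ?iota_uniq // size_iota size_map.
  by have := card_Sn 6; rewrite cardE enumT => ->.
have [_ e] := uniq_min_size u1 sub sz.
exact: uniq_perm u1 (permutations_uniq _) e.
Qed.

Lemma nth_perm_seq (s : 'S_6) k : (k < 6)%N -> nth 0%N (perm_seq s) k = s (inord k).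
Proof.
move=> k6; rewrite (nth_map (inord k)) ?size_enum_ord //; congr (val (s _)).
by apply/val_inj; rewrite /= nth_enum_ord // inordK.
Qed.

Section Terms.
Variable R : comNzRingType.
Implicit Type d : nat -> nat -> R.

Definition prod_pairs d (P : seq (nat * nat)) (l : seq nat) : R :=
  \prod_(p <- P) d (nth 0%N l p.1) (nth 0%N l p.2).

(* The unordered pair {i, j} is coded as 6 i + j with i <= j, and an expression by the sorted
   list of the codes of its factors: equality of expressions becomes decidable by computation. *)
Definition code (P : seq (nat * nat)) (l : seq nat) : seq nat :=
  sort leq [seq (minn (nth 0 l p.1) (nth 0 l p.2) * 6 + maxn (nth 0 l p.1) (nth 0 l p.2))%N | p <- P].

(** A certificate checked by computation: the codes of [reps] are distinct, exhaust the codes of all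
    arrangements, and each is taken exactly [m] times. *)
Definition representatives P (reps : seq (seq nat)) (m : nat) : bool :=
  let cs := [seq code P l | l <- perms6] in
  let cr := [seq code P l | l <- reps] in
  [&& (0 < m)%N, all (all (fun k => (k < 6)%N)) reps, uniq cr,
      all (fun c => c \in cr) cs & all (fun c => count_mem c cs == m) cr].

Definition eval_code d (c : seq nat) : R := \prod_(k <- c) d (k %/ 6)%N (k %% 6)%N.

Lemma prod_pairs_code d P l : (forall i j, d i j = d j i) ->
  all (fun k => (k < 6)%N) l ->
  prod_pairs d P l = eval_code d (code P l).
Proof.
move=> dC l6; rewrite /eval_code /code.
rewrite (perm_big _ (permEl (perm_sort _ _))) big_map; apply: eq_bigr => p _.
have h k : (nth 0%N l k < 6)%N.
  case: (ltnP k (size l)) => kl; last by rewrite nth_default.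
  exact: (allP l6) (mem_nth _ kl).
move: (h p.1) (h p.2); move: (nth _ _ _) (nth _ _ _) => i j i6 j6.
rewrite divnMDl // modnMDl; case: (leqP i j) => ij.
  by rewrite ?(maxn_idPr ij) ?(minn_idPl ij) divn_small // modn_small ?addn0.
by rewrite dC divn_small // modn_small ?addn0.
Qed.

(** For symmetric [d] a product depends only on its code, so the 720 terms fall into classes of [m]
    equal terms, one for each representative. *)
Lemma sum_perms d P (reps : seq (seq nat)) m : (forall i j, d i j = d j i) ->
  representatives P reps m ->
  \sum_(s : 'S_6) prod_pairs d P (perm_seq s) = (\sum_(l <- reps) prod_pairs d P l) *+ m.
Proof.
move=> dC /and5P[m0 r6 ur /allP sub /allP cnt].
transitivity (\sum_(l <- perms6) prod_pairs d P l).
  by rewrite -(perm_big _ perm_seq_perms) /= big_map.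
rewrite (eq_big_seq (eval_code d \o code P)) => [|l]; last first.
  rewrite /perms6 mem_permutations => pl; apply: prod_pairs_code => //.
  by apply/allP => k; rewrite (perm_mem pl) mem_iota.
rewrite -(big_map (code P) xpredT (eval_code d)) /=.
rewrite -[LHS]big_undup_iterop_count.
rewrite (eq_big_seq (fun c => eval_code d c *+ m)); last first.
  move=> c; rewrite mem_undup => /sub/cnt /eqP cm.
  by rewrite cm.
rewrite sumrMnl; congr (_ *+ _).
transitivity (\sum_(c <- [seq code P l | l <- reps]) eval_code d c).
  apply: perm_big; apply: uniq_perm => //; first exact: undup_uniq.
  move=> c; rewrite mem_undup; apply/idP/idP => [/sub //|/cnt /eqP cm].
  by rewrite -has_pred1 has_count cm.
rewrite big_map; apply: eq_big_seq => l lr; rewrite -prod_pairs_code //.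
exact: (allP r6).
Qed.
End Terms.

Definition pairsA := [:: (0, 1); (2, 3); (4, 5)]%N.
Definition pairsB := [:: (0, 1); (1, 2); (2, 0); (3, 4); (4, 5); (5, 3)]%N.
Definition pairsC := (pairsB ++ [:: (0, 3); (1, 4); (2, 5)])%N.

Definition matchings : seq (seq nat) := [::
  [:: 0; 1; 2; 3; 4; 5]; [:: 0; 1; 2; 4; 3; 5]; [:: 0; 1; 2; 5; 3; 4];
  [:: 0; 2; 1; 3; 4; 5]; [:: 0; 2; 1; 4; 3; 5]; [:: 0; 2; 1; 5; 3; 4];
  [:: 0; 3; 1; 2; 4; 5]; [:: 0; 3; 1; 4; 2; 5]; [:: 0; 3; 1; 5; 2; 4];
  [:: 0; 4; 1; 2; 3; 5]; [:: 0; 4; 1; 3; 2; 5]; [:: 0; 4; 1; 5; 2; 3];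
  [:: 0; 5; 1; 2; 3; 4]; [:: 0; 5; 1; 3; 2; 4]; [:: 0; 5; 1; 4; 2; 3]].

Definition splits : seq (seq nat) := [::
  [:: 0; 1; 2; 3; 4; 5]; [:: 0; 1; 3; 2; 4; 5]; [:: 0; 1; 4; 2; 3; 5];
  [:: 0; 1; 5; 2; 3; 4]; [:: 0; 2; 3; 1; 4; 5]; [:: 0; 2; 4; 1; 3; 5];
  [:: 0; 2; 5; 1; 3; 4]; [:: 0; 3; 4; 1; 2; 5]; [:: 0; 3; 5; 1; 2; 4];
  [:: 0; 4; 5; 1; 2; 3]].

(** [pairsC] matches entries of the two triples by position, so reordering the second triple of each
    split in all six ways gives the 60 choices. *)
Definition bijections : seq (seq nat) := Eval vm_compute in
  flatten [seq [seq take 3 l ++ p | p <- permutations (drop 3 l)] | l <- splits].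

Lemma representativesA : representatives pairsA matchings 48.
Proof. by vm_compute. Qed.

Lemma representativesB : representatives pairsB splits 72.
Proof. by vm_compute. Qed.

Lemma representativesC : representatives pairsC bijections 12.
Proof. by vm_compute. Qed.

Section Brackets.
Variable R : comNzRingType.
Implicit Type d : nat -> nat -> R.
Definition bracketA d := \sum_(l <- matchings) prod_pairs d pairsA l.
Definition bracketB d := \sum_(l <- splits) prod_pairs d pairsB l.
Definition bracketC d := \sum_(l <- bijections) prod_pairs d pairsC l.

Lemma expr_prod_pairs (x : 'I_6 -> R) (s : 'S_6) :
  [/\ Defs.exprA (x \o s) = prod_pairs (sqdiff x) pairsA (perm_seq s),
      Defs.exprB (x \o s) = prod_pairs (sqdiff x) pairsB (perm_seq s) &
      Defs.exprC (x \o s) = prod_pairs (sqdiff x) pairsC (perm_seq s)].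
Proof.
have h i j : (i < 6)%N -> (j < 6)%N -> sqdiff (x \o s) i j =
    sqdiff x (nth 0%N (perm_seq s) i) (nth 0%N (perm_seq s) j).
  by move=> i6 j6; rewrite !nth_perm_seq // /sqdiff /= !inord_val.
rewrite /Defs.exprC /Defs.exprA /Defs.exprB /prod_pairs /pairsA /pairsC /pairsB /=.
by rewrite !big_cons !big_nil /= -!h // !mulr1 !mulrA.
Qed.

Lemma sum_expr (x : 'I_6 -> R) :
  [/\ \sum_(s : 'S_6) Defs.exprA (x \o s) = bracketA (sqdiff x) *+ 48,
      \sum_(s : 'S_6) Defs.exprB (x \o s) = bracketB (sqdiff x) *+ 72 &
      \sum_(s : 'S_6) Defs.exprC (x \o s) = bracketC (sqdiff x) *+ 12].
Proof.
have dC i j : sqdiff x i j = sqdiff x j i by rewrite /sqdiff -sqrrN opprB.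
split.
- rewrite -(sum_perms dC representativesA).
  by apply: eq_bigr => s _; case: (expr_prod_pairs x s).
- rewrite -(sum_perms dC representativesB).
  by apply: eq_bigr => s _; case: (expr_prod_pairs x s).
- rewrite -(sum_perms dC representativesC).
  by apply: eq_bigr => s _; case: (expr_prod_pairs x s).
Qed.
End Brackets.

(** * Forms as products of linear factors, and the scaling of brackets *)

Section LinearFactors.
Variable R : comNzRingType.
Implicit Type L : seq (R * R).

(* A binary form is handled as a list of linear factors a z_1 - b z_2, so that a = 0
   stands for a root at infinity. *)
Definition form_poly L : {poly R} := \prod_(p <- L) (p.1 *: 'X - p.2%:P).
Definition form_coefs L : 'I_7 -> R := fun k => (form_poly L)`_(6 - k).
Definition bracket L i j : R :=
  (nth 0 (unzip1 L) i * nth 0 (unzip2 L) j - nth 0 (unzip1 L) j * nth 0 (unzip2 L) i) ^+ 2.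

(** Every index occurs once in [pairsA], twice in [pairsB] and three times in [pairsC]. Applied to
    squared brackets, this is the source of the degrees 2, 4 and 6. *)
Lemma prod_pairs_scale (d d' : nat -> nat -> R) (al : nat -> R) l :
  perm_eq l (iota 0 6) ->
  (forall i j, (i < 6)%N -> (j < 6)%N -> d i j = al i * al j * d' i j) ->
  let c := \prod_(k <- iota 0 6) al k in
  [/\ prod_pairs d pairsA l = c * prod_pairs d' pairsA l,
      prod_pairs d pairsB l = c ^+ 2 * prod_pairs d' pairsB l &
      prod_pairs d pairsC l = c ^+ 3 * prod_pairs d' pairsC l].
Proof.
move=> pl dE /=; rewrite -(perm_big _ pl) /=.
have lt6 k : k \in l -> (k < 6)%N by rewrite (perm_mem pl) mem_iota.
have := perm_size pl; rewrite size_iota.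
case: l {pl} lt6 => [|k0 [|k1 [|k2 [|k3 [|k4 [|k5 [|]]]]]]] //= lt6 _.
have h k k' : k \in [:: k0; k1; k2; k3; k4; k5] -> k' \in [:: k0; k1; k2; k3; k4; k5] ->
   d k k' = al k * al k' * d' k k'.
  by move=> /lt6 ? /lt6 ?; rewrite dE.
rewrite /prod_pairs /pairsC /pairsA /pairsB /= !big_cons !big_nil /=.
by split; rewrite !h ?inE ?eqxx ?orbT //; ring.
Qed.

End LinearFactors.

Lemma perms_ok : [&& all (fun l => perm_eq l (iota 0 6)) matchings,
  all (fun l => perm_eq l (iota 0 6)) splits & all (fun l => perm_eq l (iota 0 6)) bijections].
Proof. by vm_compute. Qed.

Lemma bracket_scale (R : comNzRingType) (d d' : nat -> nat -> R) (al : nat -> R) :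
  (forall i j, (i < 6)%N -> (j < 6)%N -> d i j = al i * al j * d' i j) ->
  let c := \prod_(k <- iota 0 6) al k in
  [/\ bracketA d = c * bracketA d', bracketB d = c ^+ 2 * bracketB d' &
      bracketC d = c ^+ 3 * bracketC d'].
Proof.
move=> dE c; have /and3P[/allP pA /allP pB /allP pC] := perms_ok.
split; rewrite /bracketA /bracketB /bracketC mulr_sumr; apply: eq_big_seq => l.
- by move=> /pA pl; case: (prod_pairs_scale pl dE).
- by move=> /pB pl; case: (prod_pairs_scale pl dE).
- by move=> /pC pl; case: (prod_pairs_scale pl dE).
Qed.

Lemma eq_bracket (R : comNzRingType) (d d' : nat -> nat -> R) :
  (forall i j, (i < 6)%N -> (j < 6)%N -> d i j = d' i j) ->
  [/\ bracketA d = bracketA d', bracketB d = bracketB d' & bracketC d = bracketC d'].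
Proof.
move=> dd; have [|] := @bracket_scale R d d' (fun=> 1).
  by move=> i j i6 j6; rewrite dd // !mul1r.
by rewrite big1 // !expr1n !mul1r.
Qed.

Lemma rmorph_bracket (R S : comNzRingType) (g : {rmorphism R -> S}) (d : nat -> nat -> R) :
  [/\ g (bracketA d) = bracketA (fun i j => g (d i j)),
      g (bracketB d) = bracketB (fun i j => g (d i j)) &
      g (bracketC d) = bracketC (fun i j => g (d i j))].
Proof.
have h (r : seq (seq nat)) P : g (\sum_(l <- r) prod_pairs d P l) =
    \sum_(l <- r) prod_pairs (fun i j => g (d i j)) P l.
  by rewrite rmorph_sum /=; apply: eq_bigr => l _; rewrite /prod_pairs rmorph_prod.
by split; apply: h.
Qed.

Definition map_pairs (R S : Type) (g : R -> S) (L : seq (R * R)) : seq (S * S) :=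
  [seq (g p.1, g p.2) | p <- L].

Lemma rmorph_form_coefs (R S : comNzRingType) (g : {rmorphism R -> S}) L k :
  g (form_coefs L k) = form_coefs (map_pairs g L) k.
Proof.
rewrite /form_coefs -coef_map /=; congr (polyseq _)`_ _.
rewrite /form_poly; elim: L => [|p L IH]; first by rewrite !big_nil rmorph1.
rewrite /map_pairs /= !big_cons rmorphM /= IH; congr (_ * _).
by rewrite rmorphB /= map_polyZ /= map_polyX map_polyC.
Qed.

Lemma rmorph_pair_bracket (R S : comNzRingType) (g : {rmorphism R -> S}) L i j :
  g (bracket L i j) = bracket (map_pairs g L) i j.
Proof.
have h (s : seq R) k : nth 0 (map g s) k = g (nth 0 s k).
  case: (ltnP k (size s)) => ks; first by rewrite (nth_map 0).
  by rewrite !nth_default ?size_map // rmorph0.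
rewrite /bracket rmorphXn rmorphB !rmorphM /= /map_pairs.
have -> : unzip1 [seq (g p.1, g p.2) | p <- L] = map g (unzip1 L) by rewrite /unzip1 -!map_comp.
have -> : unzip2 [seq (g p.1, g p.2) | p <- L] = map g (unzip2 L) by rewrite /unzip2 -!map_comp.
by rewrite !h.
Qed.

Section Invariants.
Variable C : numClosedFieldType.
Implicit Type L : seq (C * C).

Lemma poly_vanish (p : {poly C}) : (forall e, p.[e] = 0) -> p = 0.
Proof.
move=> p0; apply/eqP; apply/negPn/negP => nz.
pose s := [seq (i%:R : C) | i <- iota 0 (size p)].
have : (size s < size p)%N.
  apply: max_poly_roots nz _ _; first by apply/allP => e _; rewrite /root p0.
  by rewrite map_inj_uniq ?iota_uniq // => i j /eqP; rewrite eqr_nat => /eqP.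
by rewrite size_map size_iota ltnn.
Qed.

Lemma poly_eq_generic (p q r : {poly C}) : r != 0 ->
  (forall e, r.[e] != 0 -> p.[e] = q.[e]) -> p = q.
Proof.
move=> r0 pq; have : r * (p - q) = 0.
  apply: poly_vanish => e; rewrite hornerM hornerD hornerN.
  by have [->|/pq ->] := eqVneq r.[e] 0; rewrite ?mul0r // subrr mulr0.
by move=> /eqP; rewrite mulf_eq0 (negPf r0) subr_eq0 => /eqP.
Qed.

(** Without roots at infinity the roots are x_i = b_i / a_i, the leading coefficient u_0 is the
    product of the a_i, and a_i b_j - a_j b_i = a_i a_j (x_j - x_i); the scaling weights produce
    exactly the powers of u_0. *)
Lemma inv_form_coefs_generic L : size L = 6%N -> all (fun p => p.1 != 0) L ->
  [/\ (invA C).@[form_coefs L] = bracketA (bracket L),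
      (invB C).@[form_coefs L] = bracketB (bracket L) &
      (invC C).@[form_coefs L] = bracketC (bracket L)].
Proof.
move=> sL nz; pose x (i : 'I_6) := nth 0 (unzip2 L) i / nth 0 (unzip1 L) i.
pose u0 := \prod_(k <- iota 0 6) nth 0 (unzip1 L) k.
have nz1 k : (k < 6)%N -> nth 0 (unzip1 L) k != 0.
  by move=> k6; rewrite (nth_map (0, 0)) ?sL //; apply: (allP nz); rewrite mem_nth ?sL.
have uE : form_coefs L =1 sextic_coefs (sextic_of_roots u0 x).
  move=> k; rewrite /form_coefs /sextic_coefs; congr (polyseq _)`_ _.
  rewrite /form_poly /sextic_of_roots /u0 (big_nth (0, 0)) sL big_mkord.
  rewrite -[iota 0 6]/(index_iota 0 6) big_mkord -mul_polyC rmorph_prod -big_split /=.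
  apply: eq_bigr => i _; rewrite /x !(nth_map (0, 0)) ?sL //.
  rewrite mulrBr -rmorphM /= mulrCA mulfV ?mulr1 ?mul_polyC //.
  by have := nz1 i (ltn_ord i); rewrite (nth_map (0, 0)) ?sL.
have dE i j : (i < 6)%N -> (j < 6)%N -> bracket L i j =
    nth 0 (unzip1 L) i ^+ 2 * nth 0 (unzip1 L) j ^+ 2 * sqdiff x i j.
  move=> i6 j6; rewrite /bracket /sqdiff /x !inordK //.
  by have := nz1 i i6; have := nz1 j j6 => h1 h2; field; rewrite h1 h2.
have [-> -> ->] := bracket_scale dE.
have [eA eB eC] := sum_expr x.
rewrite !(meval_eq _ uE) invA_roots invB_roots invC_roots eA eB eC.
rewrite -!(mulr_natl (_ (sqdiff x))) !mulKf ?pnatr_eq0 // prodrXl -/u0.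
by rewrite -!exprM.
Qed.

Lemma horner_mmap (P : {mpoly C[7]}) (u : 'I_7 -> {poly C}) e :
  (mmap polyC u P).[e] = P.@[fun k => (u k).[e]].
Proof.
rewrite /meval /mmap -horner_evalE raddf_sum /=.
apply: eq_bigr => m _; rewrite horner_evalE hornerM hornerC; congr (_ * _).
rewrite /mmap1 -horner_evalE rmorph_prod; apply: eq_bigr => i _.
by rewrite rmorphXn.
Qed.

(** Roots at infinity are reached by replacing each a_i with a_i + e: both sides are polynomials in
    e that agree whenever no a_i + e vanishes, hence also at e = 0. *)
Lemma inv_form_coefs L : size L = 6%N ->
  [/\ (invA C).@[form_coefs L] = bracketA (bracket L),
      (invB C).@[form_coefs L] = bracketB (bracket L) &
      (invC C).@[form_coefs L] = bracketC (bracket L)].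
Proof.
move=> sL; pose M : seq ({poly C} * {poly C}) := [seq (p.1%:P + 'X, p.2%:P) | p <- L].
pose N e := map_pairs (horner_eval e) M.
have N0 : N 0 = L.
  rewrite /N /map_pairs /M -map_comp -[RHS]map_id; apply: eq_map => -[a b] /=.
  by rewrite /horner_eval !hornerE ?addr0.
have sN e : size (N e) = 6%N by rewrite !size_map.
pose r := \prod_(p <- L) (p.1%:P + 'X : {poly C}).
have r0 : r != 0.
  rewrite prodf_seq_neq0; apply/allP => p _ /=.
  by rewrite addrC -size_poly_eq0 size_XaddC.
have nzN e : r.[e] != 0 -> all (fun p => p.1 != 0) (N e).
  rewrite /r horner_prod prodf_seq_neq0 => /allP h; rewrite !all_map; apply/allP => p pL /=.
  exact: h p pL.
have cE (P : {mpoly C[7]}) e :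
    P.@[form_coefs (N e)] = (mmap polyC (form_coefs M) P).[e].
  rewrite horner_mmap; apply: meval_eq => k.
  exact: esym (rmorph_form_coefs (horner_eval e) M k).
(* [br] is polymorphic in the ring because it is taken both over the constants and over the
   polynomials in e. *)
have key P (br : forall R : comNzRingType, (nat -> nat -> R) -> R) :
    (forall e, br _ (bracket (N e)) = (br _ (bracket M)).[e]) ->
    (forall e, r.[e] != 0 -> P.@[form_coefs (N e)] = br _ (bracket (N e))) ->
    P.@[form_coefs L] = br _ (bracket L).
  move=> brE gen; rewrite -N0 cE brE; congr _.[0].
  by apply: (poly_eq_generic r0) => e re; rewrite -cE -brE gen.
have bE e i j : (i < 6)%N -> (j < 6)%N ->
  bracket (N e) i j = horner_eval e (bracket M i j).
  by move=> _ _; rewrite rmorph_pair_bracket.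
split.
- apply: (key _ bracketA) => e; last by move=> re; case: (inv_form_coefs_generic (sN e) (nzN e re)).
  by have [-> _ _] := eq_bracket (bE e); case: (rmorph_bracket (horner_eval e) (bracket M)) => <- _ _.
- apply: (key _ bracketB) => e; last by move=> re; case: (inv_form_coefs_generic (sN e) (nzN e re)).
  by have [_ -> _] := eq_bracket (bE e); case: (rmorph_bracket (horner_eval e) (bracket M)) => _ <- _.
- apply: (key _ bracketC) => e; last by move=> re; case: (inv_form_coefs_generic (sN e) (nzN e re)).
  by have [_ _ ->] := eq_bracket (bE e); case: (rmorph_bracket (horner_eval e) (bracket M)) => _ _ <-.
Qed.

Definition bracketJ (d : nat -> nat -> C) : C :=
  (2 * 48 ^+ 3)^-1 * bracketA d ^+ 3 + (5 / 24 ^+ 3) * (bracketA d * bracketB d)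
    - (24 ^+ 2)^-1 * bracketC d.

Lemma J6_form_coefs L : size L = 6%N ->
  (J6 C).@[form_coefs L] = bracketJ (bracket L).
Proof.
move=> /inv_form_coefs[eA eB eC].
by rewrite /J6 mevalB mevalD !mevalZ rmorphXn mevalM /= eA eB eC.
Qed.

End Invariants.

(** * Sextics as coefficient vectors, and the invariance of J_6 *)

Section SexticVectors.
Variable C : numClosedFieldType.
Local Notation sxt := 'rV[C]_7.
Implicit Types (w : sxt) (L : seq (C * C)).

(* The sextic \sum_k w_k z_1^(6 - k) z_2^k is represented by the row of its coefficients. *)
Definition v7 (x0 x1 x2 x3 x4 x5 x6 : C) : sxt :=
  \row_(i < 7) nth 0 [:: x0; x1; x2; x3; x4; x5; x6] i.
Definition co (k : nat) w : C := w 0 (inord k).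

Lemma co_v7 x0 x1 x2 x3 x4 x5 x6 (w := v7 x0 x1 x2 x3 x4 x5 x6) :
  (co 0 w = x0) * (co 1 w = x1) * (co 2 w = x2) * (co 3 w = x3) *
  (co 4 w = x4) * (co 5 w = x5) * (co 6 w = x6).
Proof. by rewrite /co /w !mxE !inordK. Qed.

Lemma co_ord w (k : 'I_7) : w 0 k = co k w.
Proof. by rewrite /co inord_val. Qed.

Lemma v7_ext w w' :
  co 0 w = co 0 w' -> co 1 w = co 1 w' -> co 2 w = co 2 w' -> co 3 w = co 3 w' ->
  co 4 w = co 4 w' -> co 5 w = co 5 w' -> co 6 w = co 6 w' -> w = w'.
Proof.
move=> *; apply/rowP => k; rewrite !co_ord.
by case: k => [[|[|[|[|[|[|[|k]]]]]]] ?].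
Qed.

Lemma v7_eta w : w = v7 (co 0 w) (co 1 w) (co 2 w) (co 3 w) (co 4 w) (co 5 w) (co 6 w).
Proof. by apply: v7_ext; rewrite co_v7. Qed.

Lemma coD k w w' : co k (w + w') = co k w + co k w'. Proof. by rewrite /co mxE. Qed.
Lemma coZ k c w : co k (c *: w) = c * co k w. Proof. by rewrite /co mxE. Qed.
Lemma coN k w : co k (- w) = - co k w. Proof. by rewrite /co mxE. Qed.
Lemma co0 k : co k 0 = 0. Proof. by rewrite /co mxE. Qed.

Definition polyV w : {poly C} :=
  (co 0 w)%:P * 'X^6 + (co 1 w)%:P * 'X^5 + (co 2 w)%:P * 'X^4 + (co 3 w)%:P * 'X^3 +
  (co 4 w)%:P * 'X^2 + (co 5 w)%:P * 'X + (co 6 w)%:P.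

Lemma coef_polyV w (k : 'I_7) : (polyV w)`_(6 - k) = w 0 k.
Proof.
rewrite co_ord /polyV !coefD !coefCM !coefXn coefX coefC.
by case: k => [[|[|[|[|[|[|[|k]]]]]]] ?] //=; rewrite !(mulr0, mulr1, addr0, add0r).
Qed.

Lemma horner_polyV w x : (polyV w).[x] = co 0 w * x ^+ 6 + co 1 w * x ^+ 5 +
  co 2 w * x ^+ 4 + co 3 w * x ^+ 3 + co 4 w * x ^+ 2 + co 5 w * x + co 6 w.
Proof. by rewrite /polyV !(hornerD, hornerM, hornerC, hornerXn, hornerX). Qed.

Lemma form_coefsV w L : form_poly L = polyV w -> w 0 =1 form_coefs L.
Proof. by move=> e k; rewrite /form_coefs e coef_polyV. Qed.

Lemma exists_factors w : exists2 L, size L = 6%N & form_poly L = polyV w.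
Proof.
have [r pE] := closed_field_poly_normal (polyV w).
have szV : (size (polyV w) <= 7)%N.
  rewrite /polyV -['X]expr1 -[X in _ + X]mulr1 -(expr0 'X).
  do ![apply: leq_trans (size_polyD _ _) _; rewrite geq_max; apply/andP; split];
    by apply: leq_trans (size_polyMleq _ _) _; rewrite size_polyC size_polyXn; case: (_ != _).
have [c0|c0] := eqVneq (lead_coef (polyV w)) 0.
  exists (nseq 6 (0, 0)); rewrite ?size_nseq //.
  rewrite pE c0 scale0r /form_poly /= !big_cons big_nil /=.
  by rewrite scale0r subr0 mul0r.
have sr : (size r <= 6)%N.
  by move: szV; rewrite pE size_scale // size_prod_XsubC.
(* The factor (0, -1) is z_2: each degree missing in the dehomogenized polynomial is a root at
   infinity. *)
pose M := [seq (1, z) | z <- r] ++ nseq (6 - size r) (0, -1) : seq (C * C).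
have sM : size M = 6%N by rewrite size_cat size_map size_nseq subnKC.
have ME : form_poly M = \prod_(z <- r) ('X - z%:P).
  rewrite /form_poly big_cat big_map /= [X in _ * X]big1_seq ?mulr1 => [|p].
    by apply: eq_bigr => z _; rewrite scale1r.
  by move=> /andP[_ /nseqP[-> _]] /=; rewrite scale0r sub0r polyCN opprK.
case: M sM ME => [//|[a b] M] sM ME.
exists ((lead_coef (polyV w) * a, lead_coef (polyV w) * b) :: M) => //.
move: ME; rewrite /form_poly !big_cons /= => ME.
by rewrite [RHS]pE -ME scalerAl; congr (_ * _); rewrite scalerBr scalerA polyCM mul_polyC.
Qed.

Definition J w : C := (J6 C).@[w 0].

Lemma J_bracket w L : size L = 6%N -> form_poly L = polyV w -> J w = bracketJ (bracket L).
Proof.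
move=> sL e; rewrite -J6_form_coefs // /J; apply: meval_eq => k.
by rewrite (form_coefsV e).
Qed.

(* The substitutions (z_1, z_2) := (z_1 + s z_2, z_2) and (z_2, - z_1). *)
Definition shift s w : sxt := v7 (co 0 w) (co 1 w + 6 * s * co 0 w)
  (co 2 w + 5 * s * co 1 w + 15 * s ^+ 2 * co 0 w)
  (co 3 w + 4 * s * co 2 w + 10 * s ^+ 2 * co 1 w + 20 * s ^+ 3 * co 0 w)
  (co 4 w + 3 * s * co 3 w + 6 * s ^+ 2 * co 2 w + 10 * s ^+ 3 * co 1 w + 15 * s ^+ 4 * co 0 w)
  (co 5 w + 2 * s * co 4 w + 3 * s ^+ 2 * co 3 w + 4 * s ^+ 3 * co 2 w + 5 * s ^+ 4 * co 1 w
   + 6 * s ^+ 5 * co 0 w)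
  (co 6 w + s * co 5 w + s ^+ 2 * co 4 w + s ^+ 3 * co 3 w + s ^+ 4 * co 2 w + s ^+ 5 * co 1 w
   + s ^+ 6 * co 0 w).
Definition swap w : sxt :=
  v7 (co 6 w) (- co 5 w) (co 4 w) (- co 3 w) (co 2 w) (- co 1 w) (co 0 w).

Lemma bracketJ_eq (d d' : nat -> nat -> C) :
  (forall i j, (i < 6)%N -> (j < 6)%N -> d i j = d' i j) -> bracketJ d = bracketJ d'.
Proof. by move=> /eq_bracket[eA eB eC]; rewrite /bracketJ eA eB eC. Qed.

Lemma bracket_nth L i j : size L = 6%N -> (i < 6)%N -> (j < 6)%N ->
  bracket L i j = ((nth (0, 0) L i).1 * (nth (0, 0) L j).2 -
                   (nth (0, 0) L j).1 * (nth (0, 0) L i).2) ^+ 2.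
Proof. by move=> sL i6 j6; rewrite /bracket !(nth_map (0, 0)) ?sL. Qed.

(** A factor (a, b) becomes (a, b - s a), which leaves the determinants a_i b_j - a_j b_i
    unchanged. *)
Lemma J_shift s w : J (shift s w) = J w.
Proof.
have [L sL LE] := exists_factors w.
pose L' := [seq (p.1, p.2 - s * p.1) | p <- L].
have sL' : size L' = 6%N by rewrite size_map.
have LE' : form_poly L' = polyV (shift s w).
  transitivity (polyV w \Po ('X + s%:P)).
    rewrite -LE /form_poly big_map rmorph_prod; apply: eq_bigr => p _ /=.
    rewrite comp_polyB comp_polyZ comp_polyX comp_polyC scalerDr -!mul_polyC.
    by ring.
  rewrite /polyV !(comp_polyD, comp_polyM, comp_polyC, comp_polyX, comp_Xn_poly).
  by rewrite /shift !co_v7; ring.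
rewrite (J_bracket sL' LE') (J_bracket sL LE); apply: bracketJ_eq => i j i6 j6.
by rewrite !bracket_nth // !(nth_map (0, 0)) ?sL //=; ring.
Qed.

Lemma J_swap w : J (swap w) = J w.
Proof.
have [L sL LE] := exists_factors w.
pose L' := [seq (p.2, - p.1) | p <- L].
have sL' : size L' = 6%N by rewrite size_map.
have LE' : form_poly L' = polyV (swap w).
  (* Away from e = 0 the swapped polynomial takes the value e^6 F(-1/e), where F is the original
     one. *)
  apply: (@poly_eq_generic _ _ _ 'X) => [|e]; first by rewrite polyX_eq0.
  rewrite hornerX => e0.
  have -> : (form_poly L').[e] = (- e) ^+ 6 * (form_poly L).[- e^-1].
    rewrite -sL /L' /form_poly; elim: L {sL LE L' sL'} => [|p L IH] /=.
      by rewrite !big_nil !hornerE.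
    rewrite !big_cons hornerM IH exprS hornerM; move: (_.[- e^-1]) => A.
    by rewrite !hornerE /=; field.
  by rewrite LE !horner_polyV /swap !co_v7; field.
rewrite (J_bracket sL' LE') (J_bracket sL LE); apply: bracketJ_eq => i j i6 j6.
by rewrite !bracket_nth // !(nth_map (0, 0)) ?sL //=; ring.
Qed.

Lemma J_scale c w : J (c *: w) = c ^+ 6 * J w.
Proof.
have [[|[a b] L] // sL LE] := exists_factors w.
have sL' : size ((c * a, c * b) :: L) = 6%N by [].
have LE' : form_poly ((c * a, c * b) :: L) = polyV (c *: w).
  have -> : polyV (c *: w) = c *: polyV w.
    by rewrite /polyV !coZ -mul_polyC; ring.
  rewrite -LE /form_poly !big_cons /= scalerAl; congr (_ * _).
  by rewrite scalerBr scalerA polyCM mul_polyC.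
rewrite (J_bracket sL' LE') (J_bracket sL LE).
(* The scalar is carried by the factor 0 alone, so only the squared brackets involving it acquire
   c^2. *)
pose al k := if k == 0%N then c ^+ 2 else 1.
have dE i j : (i < 6)%N -> (j < 6)%N ->
    bracket ((c * a, c * b) :: L) i j = al i * al j * bracket ((a, b) :: L) i j.
  move=> i6 j6; rewrite !bracket_nth // /al.
  by case: i i6 => [|i] i6; case: j j6 => [|j] j6 //=; ring.
rewrite /bracketJ; have [-> -> ->] := bracket_scale dE.
by rewrite /al /= !big_cons big_nil /=; ring.
Qed.
End SexticVectors.

(** * Values of J_6 on the normal forms of sextics *)

Section Values.
Variable C : numClosedFieldType.

Section FourRoots.
Variables x1 x2 x3 x4 : C.
(** The factors of z_1 z_2 (z_1 - x_1 z_2) ... (z_1 - x_4 z_2), whose coefficients are 0, 1, u_2,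
    ..., u_5, 0. *)
Let L : seq (C * C) := [:: (0, -1); (1, 0); (1, x1); (1, x2); (1, x3); (1, x4)].
Let u2 := - (x1 + x2 + x3 + x4).
Let u3 := x1 * x2 + x1 * x3 + x1 * x4 + x2 * x3 + x2 * x4 + x3 * x4.
Let u4 := - (x1 * x2 * x3 + x1 * x2 * x4 + x1 * x3 * x4 + x2 * x3 * x4).
Let u5 := x1 * x2 * x3 * x4.

Lemma bracketA_roots : bracketA (bracket L) = 40 * u5 - 16 * u2 * u4 + 6 * u3 ^+ 2.
Proof.
rewrite /bracketA /matchings unlock /prod_pairs unlock /pairsA /bracket /L /=; rewrite /u2 /u3 /u4 /u5.
by ring.
Qed.

Lemma bracketB_roots : bracketB (bracket L) =
  4 * u2 * u4 * u5 - 12 * u3 * u4 ^+ 2 + 36 * u3 ^+ 2 * u5 - 80 * u5 ^+ 2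
  - 12 * u2 ^+ 2 * u3 * u5 + 4 * u2 ^+ 2 * u4 ^+ 2.
Proof.
rewrite /bracketB /splits unlock /prod_pairs unlock /pairsB /bracket /L /=; rewrite /u2 /u3 /u4 /u5.
by ring.
Qed.

Lemma bracketC_roots : bracketC (bracket L) =
  76 * u2 * u3 * u4 ^+ 3 - 238 * u2 * u3 ^+ 2 * u4 * u5 + 26 * u2 ^+ 2 * u3 * u5 ^+ 2
  + 28 * u2 ^+ 2 * u4 ^+ 2 * u5 - 24 * u3 ^+ 3 * u4 ^+ 2 + 72 * u3 ^+ 4 * u5
  + 64 * u2 * u4 * u5 ^+ 2 + 26 * u3 * u4 ^+ 2 * u5 + 176 * u3 ^+ 2 * u5 ^+ 2
  - 36 * u4 ^+ 4 - 320 * u5 ^+ 3 + 8 * u2 ^+ 2 * u3 ^+ 2 * u4 ^+ 2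
  - 24 * u2 ^+ 2 * u3 ^+ 3 * u5 + 76 * u2 ^+ 3 * u3 * u4 * u5
  - 24 * u2 ^+ 3 * u4 ^+ 3 - 36 * u2 ^+ 4 * u5 ^+ 2.
Proof.
rewrite /bracketC /bijections unlock /prod_pairs unlock /pairsC /pairsB /bracket /L /=; rewrite /u2 /u3 /u4 /u5.
by ring.
Qed.
End FourRoots.

Lemma quartic_roots (u2 u3 u4 u5 : C) : exists x1 x2 x3 x4,
  [/\ u2 = - (x1 + x2 + x3 + x4),
      u3 = x1 * x2 + x1 * x3 + x1 * x4 + x2 * x3 + x2 * x4 + x3 * x4,
      u4 = - (x1 * x2 * x3 + x1 * x2 * x4 + x1 * x3 * x4 + x2 * x3 * x4) &
      u5 = x1 * x2 * x3 * x4].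
Proof.
pose q : {poly C} := u2 *: 'X^3 + u3 *: 'X^2 + u4 *: 'X + u5%:P.
have sq : (size q < size ('X^4 : {poly C}))%N.
  rewrite size_polyXn /q -['X]expr1 -mul_polyC -!mul_polyC.
  rewrite -[X in _ + X]mulr1 -(expr0 'X).
  do ![apply: leq_ltn_trans (size_polyD _ _) _; rewrite gtn_max; apply/andP; split];
    by apply: leq_ltn_trans (size_polyMleq _ _) _; rewrite size_polyC size_polyXn; case: (_ != _).
have [r] := closed_field_poly_normal ('X^4 + q).
rewrite (lead_coefDl sq) lead_coefXn scale1r => E.
have := congr1 (fun p : {poly C} => size p) E.
rewrite size_polyDl // size_polyXn size_prod_XsubC => -[].
case: r E => [|x1 [|x2 [|x3 [|x4 [|]]]]] // + _.
rewrite !big_cons big_nil mulr1.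
have -> : ('X - x1%:P) * (('X - x2%:P) * (('X - x3%:P) * ('X - x4%:P))) =
    'X^4 + ((- (x1 + x2 + x3 + x4)) *: 'X^3 +
   (x1 * x2 + x1 * x3 + x1 * x4 + x2 * x3 + x2 * x4 + x3 * x4) *: 'X^2 +
   (- (x1 * x2 * x3 + x1 * x2 * x4 + x1 * x3 * x4 + x2 * x3 * x4)) *: 'X +
   (x1 * x2 * x3 * x4)%:P).
  by rewrite -!mul_polyC; ring.
move=> /addrI E; exists x1, x2, x3, x4.
have h k := congr1 (fun p : {poly C} => p`_k) E.
have := (h 0%N, h 1%N, h 2%N, h 3%N).
rewrite /q !coefD !coefZ !coefXn !coefX !coefC /= !(mulr0, mulr1, addr0, add0r).
by case=> [[[-> ->] ->] ->].
Qed.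

(* The discriminant of the intersection with [line] of [conic], defined below. *)
Definition discr (u2 u3 u4 u5 : C) : C :=
  - u2 * u3 * u4 ^+ 3 + 7 / 4 * u2 * u3 ^+ 2 * u4 * u5 - u2 * u3 ^+ 4 * u4 / 8
  + u2 * u4 * u5 ^+ 2 - 7 / 2 * u2 ^+ 2 * u3 * u5 ^+ 2 + u2 ^+ 2 * u3 ^+ 2 * u4 ^+ 2 / 4
  + u2 ^+ 2 * u3 ^+ 3 * u5 / 4 + 2 * u2 ^+ 2 * u4 ^+ 2 * u5 - u2 ^+ 3 * u3 * u4 * u5
  + u2 ^+ 4 * u5 ^+ 2 - 7 / 2 * u3 * u4 ^+ 2 * u5 + 11 / 4 * u3 ^+ 2 * u5 ^+ 2
  + u3 ^+ 3 * u4 ^+ 2 / 4 - 7 / 16 * u3 ^+ 4 * u5 + u3 ^+ 6 / 64 + u4 ^+ 4 - 5 * u5 ^+ 3.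

(** The invariants are accessible only through roots, so the quartic factor is split first. Once A,
    B and C are expressed in the u_k, what remains is an identity of polynomials in u_2, ...,
    u_5. *)
Lemma J_simple_root (u2 u3 u4 u5 : C) : 16 * J (v7 0 1 u2 u3 u4 u5 0) = discr u2 u3 u4 u5.
Proof.
have [x1 [x2 [x3 [x4 [e2 e3 e4 e5]]]]] := quartic_roots u2 u3 u4 u5.
pose L : seq (C * C) := [:: (0, -1); (1, 0); (1, x1); (1, x2); (1, x3); (1, x4)].
have LE : form_poly L = polyV (v7 0 1 u2 u3 u4 u5 0).
  rewrite /form_poly /L !big_cons big_nil /polyV !co_v7 /= e2 e3 e4 e5 -!mul_polyC.
  by ring.
rewrite (J_bracket _ LE) // /bracketJ bracketA_roots bracketB_roots bracketC_roots.
rewrite -e2 -e3 -e4 -e5 /discr; by field.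
Qed.

(** Every matching pairs two of the four equal roots, and every split puts two of them in one
    triple, so A, B and C all vanish. *)
Lemma J_quadruple_root (a b c : C) : J (v7 0 0 0 0 a b c) = 0.
Proof.
have [z [x [y LE]]] : exists z x y,
    form_poly [:: (0, -1); (0, -1); (0, -1); (0, -1); z; (x, y)] = polyV (v7 0 0 0 0 a b c).
  (* The residual quadratic is factored as (r z_1 - s z_2) (t z_1 - u z_2), also when its leading
     coefficient is zero. *)
  have [r [s [t [u [e e2 e3]]]]] : exists r s t u, [/\ a = r * t, b = - (r * u + s * t) & c = s * u].
    have [->|a0] := eqVneq a 0.
      by exists 0, (-1), b, (- c); split; ring.
    pose d := sqrtC (b ^+ 2 - 4 * a * c).
    exists a, ((- b + d) / 2), 1, ((- b - d) / (2 * a)); split; first by ring.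
      by field.
    have -> : (- b + d) / 2 * ((- b - d) / (2 * a)) = (b ^+ 2 - d ^+ 2) / (4 * a) by field.
    by rewrite sqrtCK; field.
  exists (r, s), t, u.
  rewrite /form_poly !big_cons big_nil /polyV !co_v7 /= e e2 e3 -!mul_polyC; ring.
case: z LE => r s LE.
rewrite (J_bracket _ LE) // /bracketJ /bracketA /bracketB /bracketC.
rewrite /matchings /splits /bijections unlock /prod_pairs unlock /pairsC /pairsA /pairsB /bracket /=.
by ring.
Qed.

(** Only the six matchings between the two groups of equal roots contribute to A, each with 1; any
    triple contains two equal roots, so B = C = 0. *)
Lemma J_two_triple_roots : J (v7 0 0 0 (1 : C) 0 0 0) != 0.
Proof.
have LE : form_poly [:: (0, -1); (0, -1); (0, -1); (1, 0); (1, 0); (1, 0)] =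
    polyV (v7 0 0 0 1 0 0 0 : 'rV[C]_7).
  by rewrite /form_poly !big_cons big_nil /polyV !co_v7 /= -!mul_polyC; ring.
rewrite (J_bracket _ LE) // /bracketJ.
have -> : bracketA (bracket [:: (0, -1); (0, -1); (0, -1); (1, 0); (1, 0); (1, 0)]) = 6 :> C.
  by rewrite /bracketA /matchings unlock /prod_pairs unlock /pairsA /bracket /=; ring.
have -> : bracketB (bracket [:: (0, -1); (0, -1); (0, -1); (1, 0); (1, 0); (1, 0)]) = 0 :> C.
  by rewrite /bracketB /splits unlock /prod_pairs unlock /pairsB /bracket /=; ring.
have -> : bracketC (bracket [:: (0, -1); (0, -1); (0, -1); (1, 0); (1, 0); (1, 0)]) = 0 :> C.
  by rewrite /bracketC /bijections unlock /prod_pairs unlock /pairsC /pairsB /bracket /=; ring.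
rewrite !mulr0 subr0 addr0 mulf_neq0 ?invr_eq0 ?mulf_neq0 ?expf_neq0 ?pnatr_eq0 //.
Qed.

(** Here A = 8 r^2, B = 4 r^4 and C = 8 r^6, and the three terms of J_6 cancel. *)
Lemma J_three_double_roots (r : C) : J (v7 0 0 1 (-2 * r) (r ^+ 2) 0 0) = 0.
Proof.
pose L : seq (C * C) := [:: (0, -1); (0, -1); (1, 0); (1, 0); (1, r); (1, r)].
have LE : form_poly L = polyV (v7 0 0 1 (-2 * r) (r ^+ 2) 0 0).
  by rewrite /form_poly !big_cons big_nil /polyV !co_v7 /= -!mul_polyC; ring.
rewrite (J_bracket _ LE) // /bracketJ /bracketA /bracketB /bracketC.
rewrite /matchings /splits /bijections unlock /prod_pairs unlock /pairsC /pairsA /pairsB /bracket /L /=.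
by field.
Qed.
End Values.

(** * Isotropic spaces of sextics *)

Section Counting.
Local Open Scope classical_set_scope.

Definition exactly_two (A : Type) (S : set A) := exists x y, x <> y /\ S = [set x; y].
Definition one_or_infinite (A : Type) (S : set A) :=
  (exists x, S = [set x]) \/ infinite_set S.

Lemma infinite_family (A : Type) (S : set A) (F : nat -> A) :
  injective F -> (forall n, S (F n)) -> infinite_set S.
Proof.
move=> Finj FS finS; apply: infinite_nat.
have <- : F @^-1` S = setT by apply/seteqP; split => // n _; exact: FS.
by apply: finite_preimage finS => m n _ _; exact: Finj.
Qed.

(** This turns the two implications, for J_6 nonzero and for J_6 zero, into an equivalence. *)
Lemma one_or_infinite_not_two (A : Type) (S : set A) :
  exactly_two S -> ~ one_or_infinite S.
Proof.
move=> [x [y [xy ->]]] [[z e]|]; last by apply; exact: finite_set2.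
have xz : [set z] x by rewrite -e; left.
have yz : [set z] y by rewrite -e; right.
by apply: xy; rewrite xz yz.
Qed.

Section Bijection.
Variables (A A' : Type) (S : set A) (S' : set A') (Q : A -> A' -> Prop).
Hypotheses (QS : forall x, S x -> exists2 y, S' y & Q x y)
  (QS' : forall y, S' y -> exists2 x, S x & Q x y)
  (Qfun : forall x y y', Q x y -> Q x y' -> y = y')
  (Qinj : forall x x' y, Q x y -> Q x' y -> x = x').

(** The bijection is given as a relation, because an icosahedral set and its subspace are linked by
    an inductive predicate and not by a function. *)
Lemma exactly_two_bij : exactly_two S' -> exactly_two S.
Proof.
move=> [y [y' [yy' e]]].
have [x Sx Qx] : exists2 x, S x & Q x y by apply: QS'; rewrite e; left.
have [x' Sx' Qx'] : exists2 x', S x' & Q x' y' by apply: QS'; rewrite e; right.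
exists x, x'; split; first by move=> xx'; apply/yy'/(Qfun Qx); rewrite xx'.
apply/seteqP; split => [z /QS[w]|z [] -> //].
by rewrite e => -[] -> Qz; [left; exact: Qinj Qz Qx|right; exact: Qinj Qz Qx'].
Qed.

Lemma one_or_infinite_bij : one_or_infinite S' -> one_or_infinite S.
Proof.
case=> [[y e]|infS']; [left|right].
  have [x Sx Qx] : exists2 x, S x & Q x y by apply: QS'; rewrite e.
  exists x; apply/seteqP; split => [z /QS[w]|z -> //].
  by rewrite e => -> Qz; exact: Qinj Qz Qx.
move=> finS; apply: (infS').
have [y0 _] : S' !=set0 by apply/set0P/eqP => S0; apply: infS'; rewrite S0.
(* Choosing partners turns the relation into a map whose image of [S] covers [S']; [y0] is the value
   at points without partner. *)
pose g x := if pselect (exists y, Q x y) is left e then projT1 (cid e) else y0.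
suff -> : S' = S' `&` g @` S by apply: finite_setIr; exact: finite_image.
apply/seteqP; split => [y S'y|y []//]; split => //.
have [x Sx Qx] := QS' S'y; exists x => //.
rewrite /g; case: pselect => [e|ne]; last by case: ne; exists y.
by apply: Qfun Qx; exact: projT2 (cid e).
Qed.
End Bijection.
End Counting.

Lemma det3 (R : comNzRingType) (A : 'M[R]_3) : let a i j := A (inord i) (inord j) in
  \det A = a 0 0 * (a 1 1 * a 2 2 - a 1 2 * a 2 1) - a 0 1 * (a 1 0 * a 2 2 - a 1 2 * a 2 0)
   + a 0 2 * (a 1 0 * a 2 1 - a 1 1 * a 2 0).
Proof.
move=> a; have aE i j : A i j = a i j by rewrite /a !inord_val.
rewrite (expand_det_row _ ord0) !big_ord_recl big_ord0 /cofactor.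
rewrite !(expand_det_row _ ord0) !big_ord_recl !big_ord0 /cofactor !det_mx11 !mxE !aE /=.
rewrite /bump /=.
ring.
Qed.

Lemma kernel3 (F : fieldType) (p q r p' q' r' p'' q'' r'' : F) :
  p * (q' * r'' - r' * q'') - q * (p' * r'' - r' * p'') + r * (p' * q'' - q' * p'') = 0 ->
  exists x y z, [/\ ~ [/\ x = 0, y = 0 & z = 0], x * p + y * q + z * r = 0,
    x * p' + y * q' + z * r' = 0 & x * p'' + y * q'' + z * r'' = 0].
Proof.
have vE (v : 'rV[F]_3) (B : 'M[F]_3) j : v *m B = 0 ->
    v 0 0 * B 0 j + v 0 1 * B 1 j + v 0 2 * B 2 j = 0.
  move=> /(congr1 (fun u : 'rV_3 => u 0 j)); rewrite !mxE !big_ord_recl big_ord0 addr0 addrA.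
  have e1 : lift ord0 ord0 = 1 :> 'I_3 by apply/val_inj.
  have e2 : lift ord0 (lift ord0 ord0) = 2 :> 'I_3 by apply/val_inj.
  by rewrite e2 e1.
pose A : 'M[F]_3 := \matrix_(i, j) nth 0 (nth [::] [:: [:: p; p'; p'']; [:: q; q'; q'']; [:: r; r'; r'']] i) j.
have dA : \det A = p * (q' * r'' - r' * q'') - q * (p' * r'' - r' * p'') + r * (p' * q'' - q' * p'').
  by rewrite det3 /A !mxE !inordK //=; ring.
rewrite -dA => /eqP/det0P[v nz vA].
exists (v 0 0), (v 0 1), (v 0 2); split.
- move=> [v0 v1 v2]; move/eqP: nz; apply; apply/rowP => j; rewrite mxE.
  by case: j => [[|[|[|]]] lj] //; [rewrite -[RHS]v0|rewrite -[RHS]v1|rewrite -[RHS]v2]; congr (v 0 _); apply/val_inj.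
- by have := vE _ _ 0 vA; rewrite !mxE.
- by have := vE _ _ 1 vA; rewrite !mxE.
- by have := vE _ _ 2 vA; rewrite !mxE.
Qed.

Section Span3.
Variables (K : fieldType) (vT : vectType K).
Implicit Types (U : {vspace vT}) (a b c : vT).

Definition indep3 a b c :=
  forall x y z : K, x *: a + y *: b + z *: c = 0 -> [/\ x = 0, y = 0 & z = 0].

Lemma span3P a b c w :
  reflect (exists x y z, w = x *: a + y *: b + z *: c) (w \in <<[:: a; b; c]>>%VS).
Proof.
apply: (iffP idP) => [|[x [y [z ->]]]]; last first.
  by rewrite !rpredD // rpredZ // memv_span // !inE eqxx ?orbT.
rewrite !span_cons span_nil addv0 => /memv_addP[_ /vlineP[x ->] [_ /memv_addP[_ /vlineP[y ->]
  [_ /vlineP[z ->] ->]] ->]].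
by exists x, y, z; rewrite addrA.
Qed.

Lemma dim_span3 a b c : indep3 a b c -> \dim <<[:: a; b; c]>> = 3%N.
Proof.
move=> ind; suff fr : free (in_tuple [:: a; b; c]) by rewrite (eqP fr).
apply/freeP => k.
rewrite !big_ord_recl big_ord0 /= addr0 /= addrA => /ind[k0 k1 k2].
case=> [[|[|[|i]]] lti] //; [move: k0|move: k1|move: k2] => <-; congr k; exact/val_inj.
Qed.

Lemma eq_span3 U a b c : \dim U = 3%N -> a \in U -> b \in U -> c \in U ->
  indep3 a b c -> U = <<[:: a; b; c]>>%VS.
Proof.
move=> dU aU bU cU ind; apply/eqP; rewrite eq_sym eqEdim dU dim_span3 // andbT.
by apply/span_subvP => v; rewrite !inE => /or3P[] /eqP ->.
Qed.

Lemma basis3 U : \dim U = 3%N ->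
  exists a b c, indep3 a b c /\ U = <<[:: a; b; c]>>%VS.
Proof.
move=> dU; have := vbasisP U; case: (vbasis U) => s; rewrite dU => /= /eqP.
case: s => [|a [|b [|c []]]] //= _ /andP[/eqP <- fr]; exists a, b, c; split=> // x y z.
have {}fr : free (in_tuple [:: a; b; c]) by [].
move/freeP: fr => fr e.
have /= := fr (fun i => nth 0 [:: x; y; z] i).
rewrite !big_ord_recl big_ord0 /= addr0 /= addrA => /(_ e) h.
by have := h ord0; have := h (lift ord0 ord0); have := h (lift ord0 (lift ord0 ord0)).
Qed.

End Span3.

(** * The skew forms, the apolar form and their symmetries *)

Section Isotropic.
Variable C : numClosedFieldType.
Local Notation sxt := 'rV[C]_7.
Implicit Types (v w f : sxt) (U : {vspace sxt}).

(** The Pluecker coordinates of the pair v, w. *)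
Definition pl i j v w : C := co i v * co j w - co j v * co i w.
(* The skew forms omega_u for u running through the standard basis of sl_2, up to scalars. *)
Definition om_e v w := - 15 * pl 0 5 v w + 5 * pl 1 4 v w - 3 * pl 2 3 v w.
Definition om_h v w := 45 * pl 0 6 v w - 5 * pl 1 5 v w + pl 2 4 v w.
Definition om_f v w := 15 * pl 1 6 v w - 5 * pl 2 5 v w + 3 * pl 3 4 v w.
(* A multiple of the pairing of cubics: see [apolar_sextic_row]. *)
Definition apolar v w :=
  60 * co 0 v * co 6 w - 10 * co 1 v * co 5 w + 4 * co 2 v * co 4 w - 3 * co 3 v * co 3 w
  + 4 * co 4 v * co 2 w - 10 * co 5 v * co 1 w + 60 * co 6 v * co 0 w.

Definition ortho v w := [/\ om_e v w = 0, om_h v w = 0 & om_f v w = 0].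
Definition isotropic U := \dim U = 3%N /\ forall v w, v \in U -> w \in U -> ortho v w.
Definition apolar_isotropics f : set {vspace sxt} :=
  [set U | isotropic U /\ forall w, w \in U -> apolar f w = 0]%classic.

Lemma ortho_span3 a b c : ortho a b -> ortho a c -> ortho b c ->
  forall v w, v \in <<[:: a; b; c]>>%VS -> w \in <<[:: a; b; c]>>%VS -> ortho v w.
Proof.
move=> [e1 h1 f1] [e2 h2 f2] [e3 h3 f3] v w.
move=> /span3P[x [y [z ->]]] /span3P[x' [y' [z' ->]]].
have key (om : sxt -> sxt -> C) :
    om a b = 0 -> om a c = 0 -> om b c = 0 ->
    om (x *: a + y *: b + z *: c) (x' *: a + y' *: b + z' *: c) =
      (x * y' - y * x') * om a b + (x * z' - z * x') * om a c + (y * z' - z * y') * om b c ->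
    om (x *: a + y *: b + z *: c) (x' *: a + y' *: b + z' *: c) = 0.
  by move=> -> -> ->; rewrite !mulr0 !addr0.
split; apply: key => //; rewrite /om_e /om_h /om_f /pl !(coD, coZ); ring.
Qed.

Lemma iso_span3 a b c : indep3 a b c -> ortho a b -> ortho a c -> ortho b c ->
  isotropic <<[:: a; b; c]>>%VS.
Proof.
by move=> ind ab ac bc; split; [exact: dim_span3|exact: ortho_span3].
Qed.

Lemma apolar_span3 f a b c : apolar f a = 0 -> apolar f b = 0 -> apolar f c = 0 ->
  forall w, w \in <<[:: a; b; c]>>%VS -> apolar f w = 0.
Proof.
move=> fa fb fc w /span3P[x [y [z ->]]].
transitivity (x * apolar f a + y * apolar f b + z * apolar f c).
  by rewrite /apolar !(coD, coZ); ring.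
by rewrite fa fb fc !mulr0 !addr0.
Qed.

Lemma apolar_isotropics_span3 f a b c : indep3 a b c -> ortho a b -> ortho a c -> ortho b c ->
  apolar f a = 0 -> apolar f b = 0 -> apolar f c = 0 -> apolar_isotropics f <<[:: a; b; c]>>%VS.
Proof. by move=> *; split; [exact: iso_span3|exact: apolar_span3]. Qed.

(** Two linear conditions leave a nonzero vector in a space of dimension three; the third column
    given to [kernel3] is zero. *)
Lemma exists_zero_coords U i j : \dim U = 3%N ->
  exists w, [/\ w \in U, w != 0, co i w = 0 & co j w = 0].
Proof.
move=> dU; have [a [b [c [ind UE]]]] := basis3 dU.
have [|x [y [z [nz hi hj _]]]] :=
    @kernel3 _ (co i a) (co i b) (co i c) (co j a) (co j b) (co j c) 0 0 0; first by ring.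
exists (x *: a + y *: b + z *: c); split=> //.
- by rewrite UE; apply/span3P; exists x, y, z.
- by apply/eqP => /ind.
- by rewrite !(coD, coZ).
- by rewrite !(coD, coZ).
Qed.

Section Transport.
Variables (T T' : {linear sxt -> sxt}).
Hypotheses (TK : cancel T T') (T'K : cancel T' T).

Definition image_by U : {vspace sxt} := (linfun T @: U)%VS.

Lemma mem_image_by U w : (w \in image_by U) = (T' w \in U).
Proof.
apply/memv_imgP/idP => [[v vU ->]|h]; first by rewrite lfunE /= TK.
by exists (T' w); rewrite // lfunE /= T'K.
Qed.

Lemma dim_image_by U : \dim (image_by U) = \dim U.
Proof.
apply: limg_dim_eq; have /eqP -> : lker (linfun T) == 0%VS; last by rewrite capv0.
by apply/lker0P => v w; rewrite !lfunE /= => /(can_inj TK).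
Qed.

Lemma image_by_span3 a b c :
  image_by <<[:: a; b; c]>> = <<[:: T a; T b; T c]>>%VS.
Proof. by rewrite /image_by limg_span /= !lfunE. Qed.

Lemma iso_image_by U : (forall v w, ortho v w -> ortho (T v) (T w)) ->
  isotropic U -> isotropic (image_by U).
Proof.
move=> To [dU oU]; split=> [|v w]; first by rewrite dim_image_by.
rewrite !mem_image_by => vU wU; rewrite -(T'K v) -(T'K w).
exact/To/oU.
Qed.

Lemma apolar_isotropics_image_by f U : (forall v w, ortho v w -> ortho (T v) (T w)) ->
  (forall v w, apolar v w = 0 -> apolar (T v) (T w) = 0) ->
  apolar_isotropics f U -> apolar_isotropics (T f) (image_by U).
Proof.
move=> To Ta [iU fU]; split; first exact: iso_image_by.
by move=> w; rewrite mem_image_by => /fU /Ta; rewrite T'K.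
Qed.

End Transport.


Lemma image_byK (T T' : {linear sxt -> sxt}) : cancel T T' -> cancel T' T ->
  cancel (image_by T) (image_by T').
Proof.
move=> TK T'K U; apply/vspaceP => w.
by rewrite (mem_image_by T'K TK) (mem_image_by TK T'K) TK.
Qed.

Ltac v7_linear := move=> c v w; apply: v7_ext; rewrite !(co_v7, coD, coZ); ring.

Lemma shift_linear s : linear (@shift C s). Proof. v7_linear. Qed.
Lemma swap_linear : linear (@swap C). Proof. v7_linear. Qed.
HB.instance Definition _ s := GRing.isLinear.Build C sxt sxt _ (@shift C s) (shift_linear s).
HB.instance Definition _ := GRing.isLinear.Build C sxt sxt _ (@swap C) swap_linear.

Lemma shiftK s : cancel (@shift C s) (shift (- s)).
Proof. by move=> w; apply: v7_ext; rewrite !co_v7; ring. Qed.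
Lemma shiftNK s : cancel (@shift C (- s)) (shift s).
Proof. by move=> w; have := shiftK (- s) w; rewrite opprK. Qed.
Lemma swapK : involutive (@swap C).
Proof. by move=> w; apply: v7_ext; rewrite !co_v7; ring. Qed.

Lemma om_shift s v w :
  [/\ om_e (shift s v) (shift s w) = om_e v w,
      om_h (shift s v) (shift s w) = om_h v w - s * om_e v w &
      om_f (shift s v) (shift s w) = om_f v w + 2 * s * om_h v w - s ^+ 2 * om_e v w].
Proof.
split; rewrite /om_e /om_h /om_f /pl !co_v7; ring.
Qed.

Lemma ortho_shift s v w : ortho v w -> ortho (shift s v) (shift s w).
Proof.
move=> [e h f]; have [e' h' f'] := om_shift s v w.
by split; rewrite ?e' ?h' ?f' e ?h ?f; ring.
Qed.

Lemma ortho_swap v w : ortho v w -> ortho (swap v) (swap w).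
Proof.
move=> [e h f].
have [e' h' f'] : [/\ om_e (swap v) (swap w) = - om_f v w,
    om_h (swap v) (swap w) = - om_h v w & om_f (swap v) (swap w) = - om_e v w].
  by split; rewrite /om_e /om_h /om_f /pl !co_v7; ring.
by split; rewrite ?e' ?h' ?f' ?e ?h ?f oppr0.
Qed.

Lemma apolar_shift s v w : apolar (shift s v) (shift s w) = apolar v w.
Proof. by rewrite /apolar !co_v7; ring. Qed.

Lemma apolar_swap v w : apolar (swap v) (swap w) = apolar v w.
Proof. by rewrite /apolar !co_v7; ring. Qed.

Definition dichotomy f :=
  (J f != 0 -> exactly_two (apolar_isotropics f)) /\ (J f = 0 -> one_or_infinite (apolar_isotropics f)).

Lemma dichotomy_transport (T T' : {linear sxt -> sxt}) f :
  cancel T T' -> cancel T' T ->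
  (forall v w, ortho v w -> ortho (T v) (T w)) ->
  (forall v w, ortho v w -> ortho (T' v) (T' w)) ->
  (forall v w, apolar (T v) (T w) = apolar v w) ->
  (forall v w, apolar (T' v) (T' w) = apolar v w) ->
  J (T f) = J f -> dichotomy (T f) -> dichotomy f.
Proof.
move=> TK T'K oT oT' aT aT' Jf [h2 h1].
have QS U : apolar_isotropics f U -> exists2 V, apolar_isotropics (T f) V & V = image_by T U.
  move=> ZU; exists (image_by T U) => //; apply: (apolar_isotropics_image_by TK T'K) => // v w.
  by rewrite aT.
have QS' V : apolar_isotropics (T f) V -> exists2 U, apolar_isotropics f U & V = image_by T U.
  move=> ZV; exists (image_by T' V); last by rewrite (image_byK T'K TK).
  rewrite -[f]TK; apply: (apolar_isotropics_image_by T'K TK) => // v w.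
  by rewrite aT'.
split=> Jf0.
- apply: (exactly_two_bij QS QS') => [U V V' -> ->|U U' V -> e|] //; last first.
    by apply: h2; rewrite Jf.
  exact: (can_inj (image_byK TK T'K)).
- apply: (one_or_infinite_bij QS QS') => [U V V' -> ->|U U' V -> e|] //; last first.
    by apply: h1; rewrite Jf.
  exact: (can_inj (image_byK TK T'K)).
Qed.

Lemma dichotomy_shift s f : dichotomy (shift s f) -> dichotomy f.
Proof.
apply: (@dichotomy_transport (shift s) (shift (- s))) => //.
- exact: shiftK.
- exact: shiftNK.
- exact: ortho_shift.
- exact: ortho_shift.
- exact: apolar_shift.
- exact: apolar_shift.
- exact: J_shift.
Qed.

Lemma dichotomy_swap f : dichotomy (swap f) -> dichotomy f.
Proof.
apply: (@dichotomy_transport (@swap C) (@swap C)) => //.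
- exact: swapK.
- exact: swapK.
- exact: ortho_swap.
- exact: ortho_swap.
- exact: apolar_swap.
- exact: apolar_swap.
- exact: J_swap.
Qed.

Lemma dichotomy_scale c f : c != 0 -> dichotomy (c *: f) -> dichotomy f.
Proof.
move=> c0; rewrite /dichotomy J_scale mulf_eq0 expf_eq0 (negPf c0) andbF /= => -[h2 h1].
have -> : apolar_isotropics f = apolar_isotropics (c *: f); last first.
  by split=> // Jf; apply: h1; rewrite Jf mulr0.
have e w : apolar (c *: f) w = c * apolar f w by rewrite /apolar !coZ; ring.
apply/seteqP; split=> U [iU fU]; split=> // w /fU; first by rewrite e => ->; rewrite mulr0.
by rewrite e => /eqP; rewrite mulf_eq0 (negPf c0) => /eqP.
Qed.

Lemma root6 (c0 c1 c2 c3 c4 c5 : C) : exists s, s ^+ 6 + c5 * s ^+ 5 + c4 * s ^+ 4 +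
  c3 * s ^+ 3 + c2 * s ^+ 2 + c1 * s + c0 = 0.
Proof.
have [s e] := @solve_monicpoly C 6 (fun i => - nth 0 [:: c0; c1; c2; c3; c4; c5] i) isT.
by exists s; rewrite e !big_ord_recl big_ord0 /= /bump /=; ring.
Qed.

(** The number of leading zero coefficients is the multiplicity of the root at infinity; [shift]
    moves a chosen root to 0 and [swap] exchanges 0 and infinity. Whenever the case analysis meets a
    simple root, this root is brought to infinity and a second one to 0, which is the first
    hypothesis. *)
Lemma dichotomy_reduction :
  (forall u2 u3 u4 u5 : C, dichotomy (v7 0 1 u2 u3 u4 u5 0)) ->
  (forall a b c : C, dichotomy (v7 0 0 0 0 a b c)) ->
  dichotomy (v7 0 0 0 1 0 0 0) ->
  (forall r : C, r != 0 -> dichotomy (v7 0 0 1 (-2 * r) (r ^+ 2) 0 0)) ->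
  forall f, f != 0 -> dichotomy f.
Proof.
move=> simple quadruple triples doubles.
(* A simple root at infinity: a root of the residual quintic is translated to 0. *)
have case1 f : co 0 f = 0 -> co 1 f != 0 -> dichotomy f.
  move=> f0 f1; apply: (@dichotomy_scale (co 1 f)^-1); rewrite ?invr_eq0 //.
  set g := _ *: f.
  have g0 : co 0 g = 0 by rewrite coZ f0 mulr0.
  have g1 : co 1 g = 1 by rewrite coZ mulVf.
  have [s rs] : exists s, s ^+ 5 + co 2 g * s ^+ 4 + co 3 g * s ^+ 3 + co 4 g * s ^+ 2
      + co 5 g * s + co 6 g = 0.
    have [s e] := @solve_monicpoly C 5
      (fun i => - nth 0 [:: co 6 g; co 5 g; co 4 g; co 3 g; co 2 g] i) isT.
    by exists s; rewrite e !big_ord_recl big_ord0 /= /bump /=; ring.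
  apply: (@dichotomy_shift s); set h := shift s g.
  have -> : h = v7 0 1 (co 2 h) (co 3 h) (co 4 h) (co 5 h) 0; last exact: simple.
  apply: v7_ext; rewrite !co_v7 ?g0 ?g1 //; try by ring.
  by rewrite -[RHS]rs; ring.
have swap1 f : co 6 f = 0 -> co 5 f != 0 -> dichotomy f.
  by move=> f6 f5; apply/dichotomy_swap/case1; rewrite co_v7 ?oppr_eq0.
(* A root of multiplicity three or more at infinity: unless it is at least quadruple, the residual
   cubic has either a simple root or a triple one. *)
have case3 f : co 0 f = 0 -> co 1 f = 0 -> co 2 f = 0 -> dichotomy f.
  move=> f0 f1 f2; have [f3|f3] := eqVneq (co 3 f) 0.
    by rewrite (v7_eta f) f0 f1 f2 f3; exact: quadruple.
  apply: (@dichotomy_scale (co 3 f)^-1); rewrite ?invr_eq0 //.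
  set g := _ *: f.
  have [g0 g1 g2 g3] : [/\ co 0 g = 0, co 1 g = 0, co 2 g = 0 & co 3 g = 1].
    by rewrite !coZ f0 f1 f2 !mulr0 mulVf.
  have [s rs] : exists s, s ^+ 3 + co 4 g * s ^+ 2 + co 5 g * s + co 6 g = 0.
    have [s e] := @solve_monicpoly C 3 (fun i => - nth 0 [:: co 6 g; co 5 g; co 4 g] i) isT.
    by exists s; rewrite e !big_ord_recl big_ord0 /= /bump /=; ring.
  apply: (@dichotomy_shift s); set h := shift s g.
  have [h0 h1 h2 h3] : [/\ co 0 h = 0, co 1 h = 0, co 2 h = 0 & co 3 h = 1].
    by rewrite !co_v7 g0 g1 g2 g3; split; ring.
  have h6 : co 6 h = 0 by rewrite co_v7 g0 g1 g2 g3 -[RHS]rs; ring.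
  have [h5|] := eqVneq (co 5 h) 0; last exact: swap1.
  have [h4|h4] := eqVneq (co 4 h) 0.
    by rewrite (v7_eta h) h0 h1 h2 h3 h4 h5 h6.
  apply: (@dichotomy_shift (- co 4 h)); apply: swap1; rewrite co_v7 h0 h1 h2 h3 ?h5 ?h6.
    by ring.
  have -> : 0 + 2 * - co 4 h * co 4 h + 3 * (- co 4 h) ^+ 2 * 1 + 4 * (- co 4 h) ^+ 3 * 0 +
    5 * (- co 4 h) ^+ 4 * 0 + 6 * (- co 4 h) ^+ 5 * 0 = co 4 h ^+ 2 by ring.
  by rewrite expf_neq0.
(* A double root at infinity: once a multiple root of the residual quartic is at 0, a quadratic is
   left, and [2 * t + co 3 h] is its derivative at its root t. *)
have case2 f : co 0 f = 0 -> co 1 f = 0 -> co 2 f != 0 -> dichotomy f.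
  move=> f0 f1 f2.
  apply: (@dichotomy_scale (co 2 f)^-1); rewrite ?invr_eq0 //.
  set g := _ *: f.
  have [g0 g1 g2] : [/\ co 0 g = 0, co 1 g = 0 & co 2 g = 1].
    by rewrite !coZ f0 f1 !mulr0 mulVf.
  have [s rs] : exists s, s ^+ 4 + co 3 g * s ^+ 3 + co 4 g * s ^+ 2 + co 5 g * s + co 6 g = 0.
    have [s e] := @solve_monicpoly C 4
      (fun i => - nth 0 [:: co 6 g; co 5 g; co 4 g; co 3 g] i) isT.
    by exists s; rewrite e !big_ord_recl big_ord0 /= /bump /=; ring.
  apply: (@dichotomy_shift s); set h := shift s g.
  have [h0 h1 h2] : [/\ co 0 h = 0, co 1 h = 0 & co 2 h = 1].
    by rewrite !co_v7 g0 g1 g2; split; ring.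
  have h6 : co 6 h = 0 by rewrite co_v7 g0 g1 g2 -[RHS]rs; ring.
  have [h5|] := eqVneq (co 5 h) 0; last exact: swap1.
  have [t rt] : exists t, t ^+ 2 + co 3 h * t + co 4 h = 0.
    have [t e] := @solve_monicpoly C 2 (fun i => - nth 0 [:: co 4 h; co 3 h] i) isT.
    by exists t; rewrite e !big_ord_recl big_ord0 /= /bump /=; ring.
  have [d|nd] := eqVneq (2 * t + co 3 h) 0; last first.
    have [t0|t0] := eqVneq t 0.
      have [h4 h3] : co 4 h = 0 /\ co 3 h != 0.
        by move: rt nd; rewrite t0 expr0n /= !mulr0 !add0r.
      have [c c2] : exists c, c = - co 3 h by exists (- co 3 h).
      apply: (@dichotomy_shift c); apply: swap1; rewrite co_v7 h0 h1 h2 h4 h5 ?h6 c2.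
        by ring.
      set A := (X in X != 0); have -> : A = - co 3 h ^+ 3 by rewrite /A; ring.
      by rewrite oppr_eq0 expf_neq0.
    apply: (@dichotomy_shift t); apply: swap1; rewrite co_v7 h0 h1 h2 h5 ?h6.
      transitivity (t ^+ 2 * (t ^+ 2 + co 3 h * t + co 4 h)); first by ring.
      by rewrite rt mulr0.
    set A := (X in X != 0).
    have -> : A = 2 * t * (t ^+ 2 + co 3 h * t + co 4 h) + t ^+ 2 * (2 * t + co 3 h).
      by rewrite /A; ring.
    by rewrite rt mulr0 add0r mulf_neq0 ?expf_neq0.
  have h3 : co 3 h = -2 * t by rewrite -[LHS]addr0 -oppr0 -d; ring.
  have h4 : co 4 h = t ^+ 2 by rewrite -[LHS]subr0 -rt h3; ring.
  have [t0|t0] := eqVneq t 0; last first.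
    by rewrite (v7_eta h) h0 h1 h2 h3 h4 h5 h6; exact: doubles.
  apply: dichotomy_swap; apply: case3; rewrite co_v7 ?h5 ?h6 ?oppr0 //.
  by rewrite h4 t0 expr0n.
have main0 f : f != 0 -> co 0 f = 0 -> dichotomy f.
  move=> _ f0; have [f1|] := eqVneq (co 1 f) 0; last exact: case1.
  by have [f2|] := eqVneq (co 2 f) 0; [exact: case3|exact: case2].
move=> f nz; have [f0|f0] := eqVneq (co 0 f) 0; first exact: main0.
apply: (@dichotomy_scale (co 0 f)^-1); rewrite ?invr_eq0 //.
set g := _ *: f; have g0 : co 0 g = 1 by rewrite coZ mulVf.
have [s rs] := root6 (co 6 g) (co 5 g) (co 4 g) (co 3 g) (co 2 g) (co 1 g).
apply: (@dichotomy_shift s); apply: dichotomy_swap; set h := swap _.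
have h6 : co 6 h = 1 by rewrite !co_v7.
apply: main0; first by apply: contraTneq (oner_neq0 C) => h0; rewrite -h6 h0 co0 eqxx.
by rewrite !co_v7 g0 -[RHS]rs; ring.
Qed.

End Isotropic.

(** * Sextics with a simple root *)

Section BinaryQuadratic.
Variable C : numClosedFieldType.
Implicit Types al be ga : C.

Lemma binary_two al be ga : be ^+ 2 - al * ga != 0 ->
  exists x1 y1 x2 y2 : C, [/\ x1 * y2 - x2 * y1 != 0,
    al * x1 ^+ 2 + 2 * be * x1 * y1 + ga * y1 ^+ 2 = 0,
    al * x2 ^+ 2 + 2 * be * x2 * y2 + ga * y2 ^+ 2 = 0 &
    forall x y, al * x ^+ 2 + 2 * be * x * y + ga * y ^+ 2 = 0 ->
      x * y1 - y * x1 = 0 \/ x * y2 - y * x2 = 0].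
Proof.
have [->|al0] := eqVneq al 0; move=> D.
  have be0 : be != 0 by apply: contraNneq D => ->; rewrite expr0n /= mul0r subr0.
  exists 1, 0, ga, (- 2 * be); split; [|by ring|by ring|move=> x y].
    by rewrite mul1r mulr0 subr0 mulf_neq0 // oppr_eq0 pnatr_eq0.
  have -> : 0 * x ^+ 2 + 2 * be * x * y + ga * y ^+ 2 = y * (2 * be * x + ga * y) by ring.
  move=> /eqP; rewrite mulf_eq0 => /orP[/eqP ->|/eqP e]; first by left; ring.
  right; have -> : x * (-2 * be) - y * ga = - (2 * be * x + ga * y) by ring.
  by rewrite e oppr0.
pose d := sqrtC (be ^+ 2 - al * ga).
have d2 : d ^+ 2 = be ^+ 2 - al * ga by rewrite sqrtCK.
have d0 : d != 0 by rewrite sqrtC_eq0.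
have E x y : al * (al * x ^+ 2 + 2 * be * x * y + ga * y ^+ 2) =
    (x * al - y * (- be + d)) * (x * al - y * (- be - d)).
  by ring: d2.
have root x y : al * (al * x ^+ 2 + 2 * be * x * y + ga * y ^+ 2) = 0 ->
    al * x ^+ 2 + 2 * be * x * y + ga * y ^+ 2 = 0.
  by move=> /eqP; rewrite mulf_eq0 (negPf al0) => /eqP.
exists (- be + d), al, (- be - d), al; split.
- have -> : (- be + d) * al - (- be - d) * al = 2 * d * al by ring.
  by rewrite !mulf_neq0 // pnatr_eq0.
- by apply: root; rewrite E; ring.
- by apply: root; rewrite E; ring.
move=> x y e; have /esym/eqP := E x y; rewrite e mulr0 mulf_eq0 => /orP[] /eqP ->; by [left|right].
Qed.

Lemma binary_one al be ga : be ^+ 2 - al * ga = 0 ->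
  exists x1 y1 : C, [/\ ~ (x1 = 0 /\ y1 = 0),
    al * x1 ^+ 2 + 2 * be * x1 * y1 + ga * y1 ^+ 2 = 0 &
    (forall x y, al * x ^+ 2 + 2 * be * x * y + ga * y ^+ 2 = 0 -> x * y1 - y * x1 = 0) \/
    (forall x y, al * x ^+ 2 + 2 * be * x * y + ga * y ^+ 2 = 0)].
Proof.
have [->|al0] := eqVneq al 0; move=> D.
  have {D} be0 : be = 0 by move/eqP: D; rewrite mul0r subr0 expf_eq0 => /eqP.
  exists 1, 0; split; [by case=> /eqP; rewrite oner_eq0|by ring|rewrite be0].
  have [->|ga0] := eqVneq ga 0; first by right=> x y; ring.
  left=> x y; have -> : 0 * x ^+ 2 + 2 * 0 * x * y + ga * y ^+ 2 = ga * y ^+ 2 by ring.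
  by move=> /eqP; rewrite mulf_eq0 (negPf ga0) expf_eq0 => /eqP ->; ring.
have E x y : al * (al * x ^+ 2 + 2 * be * x * y + ga * y ^+ 2) = (x * al - y * (- be)) ^+ 2.
  have {}D : be ^+ 2 = al * ga by apply/eqP; rewrite -subr_eq0 D.
  by ring: D.
exists (- be), al; split; first by case=> _ /eqP; rewrite (negPf al0).
  have /eqP := E (- be) al; rewrite [X in _ == X ^+ 2](_ : _ = 0); last by ring.
  by rewrite expr0n /= mulf_eq0 (negPf al0) => /eqP.
left=> x y e; have /esym/eqP := E x y.
by rewrite e mulr0 expf_eq0 => /eqP.
Qed.
End BinaryQuadratic.

Section SimpleRoot.
Variable C : numClosedFieldType.
Local Notation sxt := 'rV[C]_7.
Variables u2 u3 u4 u5 : C.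
Implicit Types (a b v w : sxt) (U : {vspace sxt}).

Let f := v7 0 1 u2 u3 u4 u5 0.
(* If [U] is isotropic and apolar to [f] then it contains [base s] for some s, some
   a = (0, 1, ...) and some b = (0, 0, b_2, ...): see [basis_shape]. The conditions left on b
   are that (b_2 : b_3 : b_4) lies on a line and on a conic, and they determine [U]. *)
Let base s := v7 (1 / 6) (u2 / 5) (u3 / 4) (u4 / 3) (u5 / 2) 0 s.

(** For b with vanishing coordinates 0 and 1, [line b] and [weight0 b] are [om_f (base s) b] and
    [om_h (base s) b], which do not involve s. *)
Let line b := 3 * u2 * co 6 b - 5 / 4 * u3 * co 5 b + u4 * co 4 b - 3 / 2 * u5 * co 3 b.
Let weight0 b := 15 / 2 * co 6 b - u2 * co 5 b + u3 / 4 * co 4 b - u5 / 2 * co 2 b.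
(** The values that [ortho a b] forces on the minors [pl 2 3 a b], [pl 2 4 a b] and [pl 3 4 a b];
    the quotient by 10 inside [m34] is [pl 2 5 a b], obtained from apolarity to f. [conic] is the
    Pluecker relation under which a vector a with these minors exists. *)
Let m23 b := 5 / 3 * co 4 b.
Let m24 b := 5 * co 5 b.
Let m34 b := (5 * ((4 * u2 * m24 b - 3 * u3 * m23 b + 10 * u5 * co 2 b) / 10) - 15 * co 6 b) / 3.
Let conic b := co 2 b * m34 b - co 3 b * m24 b + co 4 b * m23 b.

Definition conic_line b :=
  [/\ b != 0, co 0 b = 0 /\ co 1 b = 0, apolar f b = 0 /\ weight0 b = 0, line b = 0 & conic b = 0].

Lemma apolar_f w : apolar f w = - 10 * co 5 w + 4 * u2 * co 4 w - 3 * u3 * co 3 w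
  + 4 * u4 * co 2 w - 10 * u5 * co 1 w.
Proof. by rewrite /apolar !co_v7; ring. Qed.

(** Apolarity to f determines coordinate 5 and [weight0] determines coordinate 6, so that b amounts
    to a point (x : y : z) of the plane. *)
Let point x y z := v7 0 0 x y z ((4 * u2 * z - 3 * u3 * y + 4 * u4 * x) / 10)
  (2 / 15 * (u2 * ((4 * u2 * z - 3 * u3 * y + 4 * u4 * x) / 10) - u3 / 4 * z + u5 / 2 * x)).

Lemma point_eta b : co 0 b = 0 -> co 1 b = 0 -> apolar f b = 0 -> weight0 b = 0 ->
  b = point (co 2 b) (co 3 b) (co 4 b).
Proof.
move=> b0 b1; rewrite apolar_f /weight0 b1 => fb hb.
have b5 : co 5 b = (4 * u2 * co 4 b - 3 * u3 * co 3 b + 4 * u4 * co 2 b) / 10.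
  apply/(canRL (mulfK _)); rewrite ?pnatr_eq0 //; apply/eqP; rewrite -subr_eq0; apply/eqP.
  by rewrite -[RHS]oppr0 -[in RHS]fb; ring.
have b6 : co 6 b = 2 / 15 * (u2 * co 5 b - u3 / 4 * co 4 b + u5 / 2 * co 2 b).
  apply/eqP; rewrite -subr_eq0; apply/eqP.
  by rewrite -[RHS](mulr0 (2 / 15)) -[in RHS]hb; field.
by apply: v7_ext; rewrite !co_v7 ?b6 ?b5.
Qed.

Let l2 := u2 * u5 / 5 + 4 / 25 * u2 ^+ 2 * u4 - u3 * u4 / 2.
Let l3 := - (3 / 25) * u2 ^+ 2 * u3 + 3 / 8 * u3 ^+ 2 - 3 / 2 * u5.
Let l4 := - (3 / 5) * u2 * u3 + 4 / 25 * u2 ^+ 3 + u4.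
Let q22 := 16 / 15 * u2 * u4 + 4 / 3 * u5.
Let q23 := - (2 / 5) * u2 * u3 - u4.
Let q24 := 8 / 15 * u2 ^+ 2 - u3 / 3.
Let q33 := 3 / 2 * u3.
Let q34 := - u2.
Let quad x y z := q22 * x ^+ 2 + q33 * y ^+ 2 + 5 / 3 * z ^+ 2 + 2 * q23 * x * y
  + 2 * q24 * x * z + 2 * q34 * y * z.

Lemma line_point x y z : line (point x y z) = l2 * x + l3 * y + l4 * z.
Proof. by rewrite /line !co_v7 /l2 /l3 /l4; field. Qed.

Lemma conic_point x y z : conic (point x y z) = quad x y z.
Proof.
by rewrite /conic /m34 /m23 /m24 !co_v7 /quad /q22 /q23 /q24 /q33 /q34; field.
Qed.

Lemma conic_lineP x y z : conic_line (point x y z) <->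
  [/\ ~ [/\ x = 0, y = 0 & z = 0], l2 * x + l3 * y + l4 * z = 0 & quad x y z = 0].
Proof.
have nzP : (point x y z == 0) <-> [/\ x = 0, y = 0 & z = 0].
  split=> [/eqP e|[-> -> ->]].
    have := congr1 (co 2) e; have := congr1 (co 3) e; have := congr1 (co 4) e.
    by rewrite !co_v7 !co0.
  by apply/eqP; apply: v7_ext; rewrite co_v7 co0 //; ring.
split=> [[nz _ _ lb cb]|[nz lb cb]].
  by split; [move=> /nzP e; rewrite e in nz|rewrite -line_point|rewrite -conic_point].
split; [by apply/negP => /nzP| | |by rewrite line_point|by rewrite conic_point].
- by rewrite !co_v7.
- by rewrite apolar_f /weight0 !co_v7; split; field.
Qed.

Lemma conic_line_eta b : conic_line b -> b = point (co 2 b) (co 3 b) (co 4 b).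
Proof. by case=> _ [? ?] [? ?] _ _; exact: point_eta. Qed.

Lemma pointZ k x y z : k *: point x y z = point (k * x) (k * y) (k * z).
Proof. by apply: v7_ext; rewrite coZ !co_v7; field. Qed.

Lemma proportional2 (x1 y1 x y : C) : ~ (x1 = 0 /\ y1 = 0) -> x * y1 - y * x1 = 0 ->
  exists k, x = k * x1 /\ y = k * y1.
Proof.
move=> nz /eqP; rewrite subr_eq0 => /eqP e.
have [x10|x10] := eqVneq x1 0.
  have y10 : y1 != 0 by apply/eqP => y10; apply: nz.
  exists (y / y1); rewrite x10 mulr0 divfK //; split=> //.
  by apply/eqP; rewrite -(mulIr_eq0 _ (mulIf y10)) e x10 mulr0.
by exists (x / x1); rewrite divfK //; split=> //; rewrite mulrAC e mulfK.
Qed.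

(* Counts the points when the line is parametrized by [pm], which turns the equation of
   the conic into a binary quadratic form. *)
Lemma conic_line_param (pm : C -> C -> sxt) al be ga :
  (forall k s t, k *: pm s t = pm (k * s) (k * t)) ->
  (forall s t s' t', pm s t = pm s' t' -> s = s' /\ t = t') ->
  (forall s t, conic_line (pm s t) <->
     ~ (s = 0 /\ t = 0) /\ al * s ^+ 2 + 2 * be * s * t + ga * t ^+ 2 = 0) ->
  (forall b, conic_line b -> exists s t, b = pm s t) ->
  (be ^+ 2 - al * ga != 0 -> exists b1 b2, [/\ conic_line b1, conic_line b2,
     forall k, b1 <> k *: b2 &
     forall b, conic_line b -> exists2 k, k != 0 & b = k *: b1 \/ b = k *: b2]) /\
  (be ^+ 2 - al * ga = 0 ->
     (exists2 b1, conic_line b1 & forall b, conic_line b -> exists2 k, k != 0 & b = k *: b1) \/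
     exists F : nat -> sxt, (forall n, conic_line (F n)) /\
       (forall i j k, F i = k *: F j -> i = j)).
Proof.
move=> pmZ pm_inj pmP pm_surj.
have prop s t x1 y1 : conic_line (pm s t) -> ~ (x1 = 0 /\ y1 = 0) -> s * y1 - t * x1 = 0 ->
    exists2 k, k != 0 & pm s t = k *: pm x1 y1.
  move=> /pmP[nz _] nz1 /(proportional2 nz1)[k [es et]]; rewrite es et in nz *.
  exists k; last by rewrite pmZ.
  by apply/eqP => k0; apply: nz; rewrite k0 !mul0r.
split=> [D|D].
  have [x1 [y1 [x2 [y2 [det r1 r2 all]]]]] := binary_two D.
  have nz1 : ~ (x1 = 0 /\ y1 = 0).
    by case=> x0 y0; move: det; rewrite x0 y0 mul0r mulr0 subr0 eqxx.
  have nz2 : ~ (x2 = 0 /\ y2 = 0).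
    by case=> x0 y0; move: det; rewrite x0 y0 mul0r mulr0 subr0 eqxx.
  exists (pm x1 y1), (pm x2 y2); split; [by apply/pmP|by apply/pmP| |].
    move=> k; rewrite pmZ => /pm_inj[ex ey]; move: det.
    by rewrite ex ey (_ : _ - _ = 0) ?eqxx //; ring.
  move=> b cb; have [s [t e]] := pm_surj _ cb; rewrite e in cb *.
  have [_ /all[/(prop _ _ _ _ cb nz1)[k k0 ek]|/(prop _ _ _ _ cb nz2)[k k0 ek]]] :=
    iffLR (pmP _ _) cb.
    by exists k => //; left.
  by exists k => //; right.
have [x1 [y1 [nz1 r1 [all|all]]]] := binary_one D; [left|right].
  exists (pm x1 y1); first by apply/pmP.
  move=> b cb; have [s [t e]] := pm_surj _ cb; rewrite e in cb *.
  by have [_ /all/(prop _ _ _ _ cb nz1)] := iffLR (pmP _ _) cb.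
exists (fun n => pm 1 n%:R); split=> [n|i j k].
  by apply/pmP; split=> // -[/eqP]; rewrite oner_eq0.
rewrite pmZ => /pm_inj[ek /eqP]; rewrite -[k]mulr1 -ek mul1r eqr_nat => /eqP; exact.
Qed.

(** The line is parametrized according to a coefficient that does not vanish; the restricted conic
    then has discriminant [discr], up to a nonzero square. If all three coefficients vanish, the
    line degenerates to the whole plane and all points of the conic are solutions. *)
Lemma count_conic_line :
  (discr u2 u3 u4 u5 != 0 -> exists b1 b2, [/\ conic_line b1, conic_line b2,
     forall k, b1 <> k *: b2 &
     forall b, conic_line b -> exists2 k, k != 0 & b = k *: b1 \/ b = k *: b2]) /\
  (discr u2 u3 u4 u5 = 0 ->
     (exists2 b1, conic_line b1 & forall b, conic_line b -> exists2 k, k != 0 & b = k *: b1) \/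
     exists F : nat -> sxt, (forall n, conic_line (F n)) /\
       (forall i j k, F i = k *: F j -> i = j)).
Proof.
have [l40|l40] := eqVneq l4 0; last first.
  pose al := l4 ^+ 2 * q22 + 5 / 3 * l2 ^+ 2 - 2 * q24 * l2 * l4.
  pose be := 5 / 3 * l2 * l3 + l4 ^+ 2 * q23 - q24 * l3 * l4 - q34 * l2 * l4.
  pose ga := l4 ^+ 2 * q33 + 5 / 3 * l3 ^+ 2 - 2 * q34 * l3 * l4.
  have Dd : be ^+ 2 - al * ga = l4 ^+ 2 * discr u2 u3 u4 u5.
    rewrite /be /al /ga /discr /q22 /q23 /q24 /q33 /q34 /l2 /l3 /l4; by field.
  have := @conic_line_param (fun s t => point (l4 * s) (l4 * t) (- (l2 * s + l3 * t))) al be ga.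
  rewrite Dd mulf_eq0 expf_eq0 (negPf l40) /=.
  case=> [k s t|s t s' t' e|s t|b cb|two one].
  - by rewrite pointZ; congr point; ring.
  - have := congr1 (co 2) e; have := congr1 (co 3) e.
    by rewrite !co_v7 => /(mulfI l40) -> /(mulfI l40) ->.
  - have E : quad (l4 * s) (l4 * t) (- (l2 * s + l3 * t)) =
        al * s ^+ 2 + 2 * be * s * t + ga * t ^+ 2.
      by rewrite /quad /al /be /ga; field.
    rewrite conic_lineP E; split=> [[nz _ e]|[nz e]]; split=> //.
    + by case=> s0 t0; apply: nz; rewrite s0 t0; split; ring.
    + by case=> /eqP + /eqP + _; rewrite !mulf_eq0 (negPf l40) /= => /eqP s0 /eqP t0; apply: nz.
    + by ring.
  - have e := conic_line_eta cb; rewrite e in cb; have [_ lb _] := iffLR (conic_lineP _ _ _) cb.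
    exists (co 2 b / l4), (co 3 b / l4); rewrite {1}e; congr point; [by field|by field|].
    apply: (mulfI l40); apply/eqP; rewrite -subr_eq0; apply/eqP.
    by rewrite -[RHS]lb; field.
  - by split=> [d0|d0]; [apply: two|apply: one; rewrite d0 mulr0].
have [l0|l0] := boolP ((l2 == 0) && (l3 == 0)); last first.
  pose al := q22 * l3 ^+ 2 + q33 * l2 ^+ 2 - 2 * q23 * l2 * l3.
  pose be := - q24 * l3 + q34 * l2.
  have Dd : be ^+ 2 - al * (5 / 3) = discr u2 u3 u4 u5.
    move: l40; rewrite /be /al /discr /q22 /q23 /q24 /q33 /q34 /l2 /l3 /l4 => l40.
    have e4 : u4 = 3 / 5 * u2 * u3 - 4 / 25 * u2 ^+ 3.
      by rewrite -[RHS]addr0 -[in RHS]l40; field.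
    rewrite e4; by field.
  have := @conic_line_param (fun s t => point (- l3 * s) (l2 * s) t) al be (5 / 3).
  rewrite Dd.
  have nl (s : C) : - l3 * s = 0 -> l2 * s = 0 -> s = 0.
    move=> /eqP + /eqP; rewrite !mulf_eq0 oppr_eq0 => /orP[l30|/eqP //] /orP[l20|/eqP //].
    by rewrite l20 l30 in l0.
  case=> [k s t|s t s' t' e|s t|b cb|two one].
  - by rewrite pointZ; congr point; ring.
  - have := congr1 (co 2) e; have := congr1 (co 3) e; have := congr1 (co 4) e.
    rewrite !co_v7 => -> e3 e2; split=> //; apply/eqP; rewrite -subr_eq0; apply/eqP/nl.
      by rewrite mulrBr e2 subrr.
    by rewrite mulrBr e3 subrr.
  - have E : quad (- l3 * s) (l2 * s) t = al * s ^+ 2 + 2 * be * s * t + 5 / 3 * t ^+ 2.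
      by rewrite /quad /al /be; field.
    rewrite conic_lineP E; split=> [[nz _ e]|[nz e]]; split=> //.
    + by case=> s0 t0; apply: nz; rewrite s0 t0; split; ring.
    + by case=> e2 e3 t0; apply: nz; split=> //; exact: nl.
    + by rewrite l40; ring.
  - have e := conic_line_eta cb; rewrite e in cb; have [_ lb _] := iffLR (conic_lineP _ _ _) cb.
    rewrite l40 mul0r addr0 in lb.
    have nz : ~ (- l3 = 0 /\ l2 = 0).
      by case=> /eqP; rewrite oppr_eq0 => l30 l20; rewrite l30 l20 eqxx in l0.
    have [|k [e2 e3]] := @proportional2 (- l3) l2 (co 2 b) (co 3 b) nz.
      by rewrite -[RHS]lb; ring.
    by exists k, (co 4 b); rewrite {1}e e2 e3; congr point; ring.
  - by split=> [d0|d0]; [apply: two|apply: one].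
move/andP: l0 => [/eqP l20 /eqP l30].
have d0 : discr u2 u3 u4 u5 = 0.
  (* [discr] is minus the adjugate quadratic form of the conic evaluated at (l2, l3, l4): the
     condition for the line to be tangent. *)
  have <- : - (5 / 3 * (q22 * l3 ^+ 2 + q33 * l2 ^+ 2 - 2 * q23 * l2 * l3)
     - (q24 * l3 - q34 * l2) ^+ 2 + l4 * (2 * (q23 * q34 - q24 * q33) * l2
       + 2 * (q24 * q23 - q22 * q34) * l3 + (q22 * q33 - q23 ^+ 2) * l4)) = discr u2 u3 u4 u5.
    by rewrite /discr /q22 /q23 /q24 /q33 /q34 /l2 /l3 /l4; field.
  by rewrite l20 l30 l40; ring.
split=> [|_]; first by rewrite d0 eqxx.
right.
(* The coefficient 5/3 of z^2 is nonzero, so there is a point of the conic over every (1 : n). *)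
have ez n : exists z, quad 1 n%:R z = 0.
  have [z e] := @solve_monicpoly C 2 (fun i => nth 0
    [:: - (3 / 5) * (q22 + q33 * n%:R ^+ 2 + 2 * q23 * n%:R);
        - (3 / 5) * (2 * q24 + 2 * q34 * n%:R)] i) isT.
  exists z; rewrite /quad e !big_ord_recl big_ord0 /= /bump /=; by field.
exists (fun n => point 1 n%:R (projT1 (cid (ez n)))); split=> [n|i j k].
  apply/conic_lineP; split; first by case=> /eqP; rewrite oner_eq0.
    by rewrite l20 l30 l40; ring.
  exact: projT2 (cid (ez n)).
rewrite pointZ => e; have e3 := congr1 (co 3) e; have := congr1 (co 2) e.
move: e3; rewrite !co_v7 mulr1 => /eqP + k1.
by rewrite -k1 mul1r eqr_nat => /eqP.
Qed.


Lemma natr_neq0 n : (n.+1%:R : C) != 0. Proof. by rewrite pnatr_eq0. Qed.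

Lemma mulfI0 n (x : C) : n.+1%:R * x = 0 -> x = 0.
Proof. by move/eqP; rewrite mulf_eq0 (negPf (natr_neq0 n)) => /eqP. Qed.

(** Linear consequences of known relations are proved by naming the multiplier, after which [ring]
    or [field] checks the identity. *)
Lemma lincomb (x y k A : C) : A = 0 -> x - y = k * A -> x = y.
Proof. by move=> -> e; apply/eqP; rewrite -subr_eq0 e mulr0. Qed.

Lemma lincomb2 (x y k A l B : C) : A = 0 -> B = 0 -> x - y = k * A + l * B -> x = y.
Proof. by move=> -> -> e; apply/eqP; rewrite -subr_eq0 e !mulr0 addr0. Qed.

Lemma proportional3 (x y z x' y' z' : C) : ~ [/\ x' = 0, y' = 0 & z' = 0] ->
  x * y' - y * x' = 0 -> x * z' - z * x' = 0 -> y * z' - z * y' = 0 ->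
  exists k, [/\ x = k * x', y = k * y' & z = k * z'].
Proof.
move=> nz e1 e2 e3; have [x0|x0] := eqVneq x' 0; last first.
  exists (x / x'); split; first by field.
    by apply: (lincomb (k := - x'^-1) e1); field.
  by apply: (lincomb (k := - x'^-1) e2); field.
have [y0|y0] := eqVneq y' 0; last first.
  exists (y / y'); split; [|by field|].
    by apply: (lincomb (k := y'^-1) e1); field.
  by apply: (lincomb (k := - y'^-1) e3); field.
have [z0|z0] := eqVneq z' 0; first by case: nz.
exists (z / z'); split; [| |by field].
  by apply: (lincomb (k := z'^-1) e2); field.
by apply: (lincomb (k := z'^-1) e3); field.
Qed.

(** The elements of U with [co i] zero form a space of dimension at least two. Vanishing minors
    would make their coordinates 2, 3, 4 proportional, although these coordinates determine the
    element. *)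
Lemma not_all_minors_zero U i : \dim U = 3%N ->
  (forall v w, v \in U -> w \in U -> co i v = 0 -> co i w = 0 ->
     [/\ pl 2 3 v w = 0, pl 2 4 v w = 0 & pl 3 4 v w = 0]) ->
  (forall v, v \in U -> co i v = 0 -> co 2 v = 0 -> co 3 v = 0 -> co 4 v = 0 -> v = 0) ->
  False.
Proof.
move=> dU minors inj.
have [v [vU v0 vi v2]] := exists_zero_coords i 2 dU.
have [w [wU w0 wi w3]] := exists_zero_coords i 3 dU.
have [x [xU x0 xi x4]] := exists_zero_coords i 4 dU.
have := minors v w vU wU vi wi; rewrite /pl v2 w3 !(mul0r, mulr0, subr0, sub0r).
move=> [/eqP + /eqP + /eqP]; rewrite !oppr_eq0 !mulf_eq0.
have [w2|w2] := eqVneq (co 2 w) 0; rewrite ?orbF ?orbT /=; last first.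
  by move=> /eqP v3 /eqP v4 _; move/eqP: v0; apply; exact: inj.
have w4 : co 4 w != 0.
  by apply: contraNneq w0 => w4; rewrite (inj w).
move=> _ _ _; have := minors w x wU xU wi xi.
rewrite /pl w2 w3 x4 !(mul0r, mulr0, subr0, sub0r) => -[_ /eqP + /eqP].
rewrite !oppr_eq0 !mulf_eq0 (negPf w4) /= => /eqP x2 /eqP x3.
by move/eqP: x0; apply; exact: inj.
Qed.

Section Fixed.
Variable U : {vspace sxt}.
Hypothesis ZU : apolar_isotropics f U.

Let dU : \dim U = 3%N. Proof. by case: ZU => -[]. Qed.
Let oU v w : v \in U -> w \in U -> ortho v w. Proof. by case: ZU => -[_ h] _; exact: h. Qed.
Let fU w : w \in U -> apolar f w = 0. Proof. by case: ZU => _; apply. Qed.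

(** For such v and w, [om_e] and [om_h] reduce to multiples of [pl 2 3] and [pl 2 4]; apolarity
    expresses [pl 2 5] through these two, and [om_f] then gives [pl 3 4]. *)
Lemma minors_zero v w : v \in U -> w \in U -> co 0 v = 0 -> co 0 w = 0 ->
  co 1 v = 0 -> co 1 w = 0 -> [/\ pl 2 3 v w = 0, pl 2 4 v w = 0 & pl 3 4 v w = 0].
Proof.
move=> vU wU v0 w0 v1 w1; have [] := oU vU wU; have := fU vU; have := fU wU.
rewrite !apolar_f v1 w1 => fw fv.
have p25 : 10 * pl 2 5 v w = 4 * u2 * pl 2 4 v w - 3 * u3 * pl 2 3 v w.
  by apply: (lincomb2 (k := - co 2 v) (l := co 2 w) fw fv); rewrite /pl; ring.
rewrite /om_e /om_h /om_f {1 2 4 5 7}/pl v0 w0 v1 w1 => e h o.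
have e23 : pl 2 3 v w = 0 by apply: (@mulfI0 2); rewrite -[RHS]oppr0 -[in RHS]e; ring.
have e24 : pl 2 4 v w = 0 by rewrite -[RHS]h; ring.
have e25 : pl 2 5 v w = 0 by apply: (@mulfI0 9); rewrite p25 e23 e24; ring.
by split=> //; apply: (@mulfI0 2); rewrite -[RHS]o e25; ring.
Qed.

Lemma co5_zero v : v \in U -> co 1 v = 0 -> co 2 v = 0 -> co 3 v = 0 -> co 4 v = 0 -> co 5 v = 0.
Proof.
move=> /fU; rewrite apolar_f => fv v1 v2 v3 v4; apply: (@mulfI0 9).
by rewrite -[RHS]oppr0 -[in RHS]fv v1 v2 v3 v4; ring.
Qed.

(** Apolarity leaves only a multiple of z_2^6. If U contained z_2^6, isotropy would make coordinates
    0 and 1 vanish on U, and then too many minors would be zero. *)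
Lemma zero_of_coords v : v \in U -> co 0 v = 0 -> co 1 v = 0 -> co 2 v = 0 -> co 3 v = 0 ->
  co 4 v = 0 -> v = 0.
Proof.
move=> vU v0 v1 v2 v3 v4; have v5 := co5_zero vU v1 v2 v3 v4.
have [v6|v6] := eqVneq (co 6 v) 0; first by apply: v7_ext; rewrite co0.
have U01 w : w \in U -> co 0 w = 0 /\ co 1 w = 0.
  move=> wU; have [_] := oU vU wU; rewrite /om_h /om_f /pl v0 v1 v2 v3 v4 v5 => h o.
  split; apply: (mulfI v6); rewrite mulr0; [apply: (@mulfI0 44)|apply: (@mulfI0 14)].
    by rewrite -[RHS]oppr0 -[in RHS]h; ring.
  by rewrite -[RHS]oppr0 -[in RHS]o; ring.
exfalso; apply: (@not_all_minors_zero U 6 dU) => [x y xU yU _ _|x xU x6 x2 x3 x4].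
  by have [? ?] := U01 x xU; have [? ?] := U01 y yU; exact: minors_zero.
have [x0 x1] := U01 x xU; have x5 := co5_zero xU x1 x2 x3 x4.
by apply: v7_ext; rewrite co0.
Qed.

(** The derivation z_2 d/dz_1 maps [base s] to f, its kernel z_2^6 accounting for the free s, and
    [om_e (base s) w] is a quarter of [apolar f w], hence zero for w in U. Since U and z_2^6 span a
    maximal isotropic space of [om_e], some [base s] lies in U; the proof carries this out in
    coordinates. *)
Lemma basis_shape b : b \in U -> b != 0 -> co 0 b = 0 -> co 1 b = 0 ->
  exists a s, [/\ a \in U, co 0 a = 0, co 1 a = 1 & base s \in U].
Proof.
move=> bU bn0 b0 b1.
have [a [aU a0 a1]] : exists a, [/\ a \in U, co 0 a = 0 & co 1 a = 1].
  have [[a [aU a0 a1]]|no] := pselect (exists a, [/\ a \in U, co 0 a = 0 & co 1 a != 0]).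
    exists ((co 1 a)^-1 *: a); rewrite rpredZ //; split=> //; rewrite coZ ?a0 ?mulr0 //.
    by rewrite mulVf.
  have no1 x : x \in U -> co 0 x = 0 -> co 1 x = 0.
    by move=> xU x0; apply/eqP/negPn/negP => x1; apply: no; exists x.
  exfalso; apply: (@not_all_minors_zero U 0 dU) => [x y xU yU x0 y0|x xU x0].
    by apply: minors_zero => //; exact: no1.
  by apply: zero_of_coords => //; exact: no1.
have [e [eU e0 e1]] : exists e, [/\ e \in U, co 0 e = 1 / 6 & co 1 e = u2 / 5].
  have [[e [eU e0]]|no] := pselect (exists e, e \in U /\ co 0 e != 0).
    pose e' := (6 * co 0 e)^-1 *: e; exists (e' + (u2 / 5 - co 1 e') *: a).
    rewrite rpredD ?rpredZ //; split=> //; rewrite coD coZ ?a0 ?a1; last by ring.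
    by rewrite /e' coZ; field.
  have no0 x : x \in U -> co 0 x = 0.
    by move=> xU; apply/eqP/negPn/negP => x0; apply: no; exists x.
  exfalso; apply: (@not_all_minors_zero U 1 dU) => [x y xU yU x1 y1|x xU x1].
    by apply: minors_zero => //; exact: no0.
  by apply: zero_of_coords => //; exact: no0.
have ab4 : 5 * co 4 b = 3 * pl 2 3 a b.
  have [e' _ _] := oU aU bU; apply/eqP; rewrite -subr_eq0 -e' /om_e /pl a0 a1 b0 b1.
  by apply/eqP; ring.
have d23 : (co 2 e - u3 / 4) * co 3 b = (co 3 e - u4 / 3) * co 2 b.
  have [e' _ _] := oU eU bU; have := fU bU; rewrite apolar_f b1 => fb.
  have e'' : om_e e b - 4^-1 * (- 10 * co 5 b + 4 * u2 * co 4 b - 3 * u3 * co 3 b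
    + 4 * u4 * co 2 b - 10 * u5 * 0) = 0 by rewrite fb e'; ring.
  apply/eqP; rewrite -subr_eq0; apply/eqP/(@mulfI0 2).
  by rewrite -[RHS]oppr0 -[in RHS]e'' /om_e /pl e0 e1 b0 b1; field.
have [k [k2 k3]] : exists k, co 2 e - u3 / 4 = k * co 2 b /\ co 3 e - u4 / 3 = k * co 3 b.
  apply: proportional2; last by rewrite d23 subrr.
  case=> b2 b3; move/eqP: bn0; apply; apply: zero_of_coords => //.
  by apply: (@mulfI0 4); rewrite ab4 /pl b2 b3; ring.
(* With coordinates 2 and 3 corrected, coordinate 4 follows from orthogonality to a, coordinate 5
   from apolarity, and coordinate 6 is the parameter s. *)
pose e' := e - k *: b; have e'U : e' \in U by rewrite rpredB ?rpredZ.
have [e'0 e'1] : co 0 e' = 1 / 6 /\ co 1 e' = u2 / 5.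
  by rewrite !(coD, coN, coZ) b0 b1 e0 e1; split; ring.
have [e'2 e'3] : co 2 e' = u3 / 4 /\ co 3 e' = u4 / 3.
  rewrite !(coD, coN, coZ) -k2 -k3; split; ring.
have e'4 : co 4 e' = u5 / 2.
  have [e'' _ _] := oU e'U aU; have := fU aU; rewrite apolar_f a1 => fa.
  have e3 : om_e e' a - 4^-1 * (- 10 * co 5 a + 4 * u2 * co 4 a - 3 * u3 * co 3 a
    + 4 * u4 * co 2 a - 10 * u5 * 1) = 0 by rewrite fa e''; ring.
  apply/eqP; rewrite -subr_eq0; apply/eqP/(@mulfI0 4).
  by rewrite -[RHS]oppr0 -[in RHS]e3 /om_e /pl e'0 e'1 e'2 e'3 a0 a1; field.
have e'5 : co 5 e' = 0.
  have := fU e'U; rewrite apolar_f e'1 e'2 e'3 e'4 => fe; apply: (@mulfI0 9).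
  by rewrite -[RHS]oppr0 -[in RHS]fe; field.
exists a, (co 6 e'); split=> //.
suff <- : e' = base (co 6 e') by [].
by apply: v7_ext; rewrite co_v7.
Qed.

End Fixed.

(** For b nonzero, the cross products with b fill the plane orthogonal to b; the second hypothesis
    is this orthogonality. *)
Lemma cross_product (b2 b3 b4 c23 c24 c34 : C) : ~ [/\ b2 = 0, b3 = 0 & b4 = 0] ->
  b2 * c34 - b3 * c24 + b4 * c23 = 0 ->
  exists a2 a3 a4 : C,
    [/\ a2 * b3 - a3 * b2 = c23, a2 * b4 - a4 * b2 = c24 & a3 * b4 - a4 * b3 = c34].
Proof.
move=> nz e; have [b20|b20] := eqVneq b2 0; last first.
  exists 0, (- c23 / b2), (- c24 / b2); split; [by field|by field|].
  by apply: (lincomb (k := - b2^-1) e); field.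
have [b30|b30] := eqVneq b3 0; last first.
  exists (c23 / b3), 0, (- c34 / b3); split; [by rewrite b20; field| |by field].
  by rewrite b20 in e *; apply: (lincomb (k := b3^-1) e); field.
have [b40|b40] := eqVneq b4 0; first by case: nz.
exists (c24 / b4), (c34 / b4), 0; rewrite b20 b30 in e *; split; [|by field|by field].
by apply: (lincomb (k := - b4^-1) e); field.
Qed.

Lemma indep_basis_shape s a b : b != 0 -> co 0 a = 0 -> co 1 a = 1 -> co 0 b = 0 -> co 1 b = 0 ->
  indep3 (base s) a b.
Proof.
move=> bn0 a0 a1 b0 b1 x y z e.
have := congr1 (co 0) e; have := congr1 (co 1) e.
rewrite !(coD, coZ) !co_v7 a0 a1 b0 b1 !co0 => e1 e0.
have x0 : x = 0 by apply: (lincomb (k := 6) e0); field.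
have y0 : y = 0 by rewrite -[RHS]e1 x0; ring.
split=> //; move/eqP: e; rewrite x0 y0 !scale0r !add0r scaler_eq0 (negPf bn0) orbF.
by move/eqP.
Qed.

Lemma conic_line_of_apolar_isotropics U : apolar_isotropics f U -> exists2 b, b \in U & conic_line b.
Proof.
move=> ZU; have [[dU oU] fU] := ZU.
have [b [bU bn0 b0 b1]] := exists_zero_coords 0 1 dU.
have [a [s [aU a0 a1 eU]]] := basis_shape ZU bU bn0 b0 b1.
exists b => //.
have [_ he oe] := oU _ _ eU bU; have [ea ha oa] := oU _ _ aU bU.
have hb : weight0 b = 0.
  by rewrite -[RHS]he /om_h /pl !co_v7 ?b0 ?b1 /weight0; field.
have e23 : m23 b = pl 2 3 a b.
  rewrite /m23; apply: (mulfI (natr_neq0 2)); apply/eqP; rewrite -subr_eq0; apply/eqP.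
  by rewrite -[RHS]ea /om_e /pl ?a0 ?a1 ?b0 ?b1; field.
have e24 : m24 b = pl 2 4 a b.
  apply/eqP; rewrite -subr_eq0 -oppr_eq0 -ha /m24 /om_h /pl ?a0 ?a1 ?b0 ?b1.
  by apply/eqP; ring.
have := fU _ aU; have := fU _ bU; rewrite !apolar_f a1 b1 => fb fa.
have e25 : pl 2 5 a b = (4 * u2 * pl 2 4 a b - 3 * u3 * pl 2 3 a b + 10 * u5 * co 2 b) / 10.
  by apply: (lincomb2 (k := - (co 2 a / 10)) (l := co 2 b / 10) fb fa); rewrite /pl; field.
have e34 : m34 b = pl 3 4 a b.
  have oa' : 15 * co 6 b - 5 * pl 2 5 a b + 3 * pl 3 4 a b = 0.
    by rewrite -[RHS]oa /om_f /pl ?a1 ?b1; ring.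
  by rewrite /m34 e23 e24 -e25; apply: (lincomb (k := - 3^-1) oa'); field.
split=> //.
- by split=> //; exact: fU.
- by rewrite -[RHS]oe /om_f /pl !co_v7 ?b0 ?b1 /line; field.
- by rewrite /conic e23 e24 e34 /pl; ring.
Qed.

Lemma apolar_isotropics_of_conic_line b : conic_line b -> exists2 U, apolar_isotropics f U & b \in U.
Proof.
move=> [bn0 [b0 b1] [fb hb] lb cb].
have nz : ~ [/\ co 2 b = 0, co 3 b = 0 & co 4 b = 0].
  move=> [b2 b3 b4]; move/eqP: bn0; apply; rewrite (point_eta b0 b1 fb hb) b2 b3 b4.
  by apply: v7_ext; rewrite co_v7 co0 //; ring.
have [a2 [a3 [a4 [c23 c24 c34]]]] := cross_product nz cb.
(* [a5] makes a apolar to f; [a6] and [s] solve [om_h (base s) a = 0] and [om_f (base s) a = 0]. *)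
pose a5 := (4 * u2 * a4 - 3 * u3 * a3 + 4 * u4 * a2 - 10 * u5) / 10.
pose a6 := 2 / 15 * (u2 * a5 - u3 / 4 * a4 + u5 / 2 * a2).
pose s := (3 * u2 * a6 - 5 / 4 * u3 * a5 + u4 * a4 - 3 / 2 * u5 * a3) / 15.
pose a := v7 0 1 a2 a3 a4 a5 a6.
have := fb; rewrite apolar_f b1 => fb'.
have b5 : co 5 b = (4 * u2 * co 4 b - 3 * u3 * co 3 b + 4 * u4 * co 2 b) / 10.
  by rewrite (point_eta b0 b1 fb hb) !co_v7.
have b6 : co 6 b = 2 / 15 * (u2 * co 5 b - u3 / 4 * co 4 b + u5 / 2 * co 2 b).
  by rewrite (point_eta b0 b1 fb hb) !co_v7.
exists <<[:: base s; a; b]>>%VS; last by apply/span3P; exists 0, 0, 1; rewrite !scale0r scale1r !add0r.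
apply: apolar_isotropics_span3.
- by apply: indep_basis_shape; rewrite ?co_v7.
- split; rewrite /om_e /om_h /om_f /pl !co_v7 /s /a6 /a5; by field.
- split.
  + by rewrite /om_e /pl !co_v7 ?b0 ?b1 b5; field.
  + by rewrite -[RHS]hb /om_h /pl !co_v7 ?b0 ?b1 /weight0; field.
  + by rewrite -[RHS]lb /om_f /pl !co_v7 ?b0 ?b1 /line; field.
- have e25 : pl 2 5 a b = (4 * u2 * m24 b - 3 * u3 * m23 b + 10 * u5 * co 2 b) / 10.
    by rewrite -c23 -c24 /pl !co_v7 /a5 b5; field.
  split.
  + rewrite /om_e /pl !co_v7 ?b0 ?b1 c23 /m23; by field.
  + rewrite /om_h /pl !co_v7 ?b0 ?b1 c24 /m24; by ring.
  + rewrite /om_f e25 /pl !co_v7 ?b0 ?b1 c34 /m34; by field.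
- by rewrite apolar_f !co_v7; field.
- by rewrite apolar_f !co_v7 /a5; field.
- exact: fb.
Qed.

(** The vectors a and a' of the two spaces differ by some d with zero coordinates 0 and 1, apolar to
    f, orthogonal to b and with [weight0 d] zero. Its minors with b vanish, so d = k b, and
    [line b = 0] then yields s' = s. *)
Lemma apolar_isotropics_unique U U' b : apolar_isotropics f U -> apolar_isotropics f U' -> b \in U -> b \in U' -> conic_line b -> U = U'.
Proof.
move=> ZU ZU' bU bU' [bn0 [b0 b1] [fb hb] lb cb].
have [a [s [aU a0 a1 eU]]] := basis_shape ZU bU bn0 b0 b1.
have [a' [s' [aU' a0' a1' eU']]] := basis_shape ZU' bU' bn0 b0 b1.
have [[dU oU] fU] := ZU; have [[dU' oU'] fU'] := ZU'.
pose d := a' - a.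
have [d0 d1] : co 0 d = 0 /\ co 1 d = 0 by rewrite !(coD, coN) a0 a1 a0' a1' !subrr.
have fd : apolar f d = 0.
  have -> : apolar f d = apolar f a' - apolar f a by rewrite !apolar_f !(coD, coN); ring.
  by rewrite (fU a) // (fU' a') // subrr.
have hd : weight0 d = 0.
  have [_ h _] := oU _ _ eU aU; have [_ h' _] := oU' _ _ eU' aU'.
  have : om_h (base s') a' - om_h (base s) a = 0 by rewrite h h' subrr.
  move=> <-; rewrite /om_h /pl !co_v7 /weight0 !(coD, coN) ?a0 ?a1 ?a0' ?a1'; by field.
have odb : ortho d b.
  have [e1 h1 o1] := oU _ _ aU bU; have [e2 h2 o2] := oU' _ _ aU' bU'.
  split.
  - have -> : om_e d b = om_e a' b - om_e a b by rewrite /om_e /pl !(coD, coN); ring.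
    by rewrite e1 e2 subrr.
  - have -> : om_h d b = om_h a' b - om_h a b by rewrite /om_h /pl !(coD, coN); ring.
    by rewrite h1 h2 subrr.
  - have -> : om_f d b = om_f a' b - om_f a b by rewrite /om_f /pl !(coD, coN); ring.
    by rewrite o1 o2 subrr.
have [d23 d24 d34] : [/\ pl 2 3 d b = 0, pl 2 4 d b = 0 & pl 3 4 d b = 0].
  have [ed h o] := odb.
  have e23 : pl 2 3 d b = 0.
    by apply: (@mulfI0 2); rewrite -[RHS]oppr0 -[in RHS]ed /om_e /pl ?d0 ?d1 ?b0 ?b1; ring.
  have e24 : pl 2 4 d b = 0 by rewrite -[RHS]h /om_h /pl ?d0 ?d1 ?b0 ?b1; ring.
  have e25 : pl 2 5 d b = 0.
    have dE := point_eta d0 d1 fd hd; have bE := point_eta b0 b1 fb hb.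
    have -> : pl 2 5 d b = (4 * u2 * pl 2 4 d b - 3 * u3 * pl 2 3 d b) / 10.
      have d5 : co 5 d = (4 * u2 * co 4 d - 3 * u3 * co 3 d + 4 * u4 * co 2 d) / 10.
        by rewrite {1}dE !co_v7.
      have b5 : co 5 b = (4 * u2 * co 4 b - 3 * u3 * co 3 b + 4 * u4 * co 2 b) / 10.
        by rewrite {1}bE !co_v7.
      by rewrite /pl d5 b5; field.
    by rewrite e23 e24 !mulr0 subr0 mul0r.
  split=> //; apply: (@mulfI0 2); rewrite -[RHS]o /om_f e25 /pl ?d0 ?d1 ?b0 ?b1; ring.
have bE := point_eta b0 b1 fb hb.
have nz : ~ [/\ co 2 b = 0, co 3 b = 0 & co 4 b = 0].
  move=> [b2 b3 b4]; move/eqP: bn0; apply; rewrite bE b2 b3 b4.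
  by apply: v7_ext; rewrite co_v7 co0 //; ring.
have [k [k2 k3 k4]] : exists k, [/\ co 2 d = k * co 2 b, co 3 d = k * co 3 b & co 4 d = k * co 4 b].
  exact: proportional3 nz d23 d24 d34.
have dk : d = k *: b.
  by rewrite (point_eta d0 d1 fd hd) k2 k3 k4 [in RHS]bE pointZ.
have ss : s' = s.
  have [_ _ o] := oU _ _ eU aU; have [_ _ o'] := oU' _ _ eU' aU'.
  have a'E : a' = a + k *: b by rewrite -dk addrC subrK.
  have : om_f (base s') a' - om_f (base s) a - k * line b = 0 by rewrite o o' lb; ring.
  move=> e; apply/eqP; rewrite -subr_eq0; apply/eqP/(@mulfI0 14).
  rewrite -[RHS]oppr0 -[in RHS]e a'E /om_f /pl !co_v7 !(coD, coZ) /line ?a0 ?a1 ?b0 ?b1; by field.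
have aE : a = a' - d by rewrite /d opprB addrC subrK.
have aU2 : a \in U' by rewrite aE dk rpredB ?rpredZ.
have ind := @indep_basis_shape s a b bn0 a0 a1 b0 b1.
rewrite (eq_span3 dU eU aU bU ind); apply/esym/eq_span3 => //.
by rewrite -ss.
Qed.

Lemma proportional_in_apolar_isotropics U b b' : apolar_isotropics f U -> b \in U -> b' \in U ->
  conic_line b -> conic_line b' -> exists k, b = k *: b'.
Proof.
move=> ZU bU b'U [bn0 [b0 b1] [fb hb] _ _] [b'n0 [b'0 b'1] [fb' hb'] _ _].
have [d23 d24 d34] := minors_zero ZU bU b'U b0 b'0 b1 b'1.
have bE := point_eta b0 b1 fb hb; have b'E := point_eta b'0 b'1 fb' hb'.
have nz : ~ [/\ co 2 b' = 0, co 3 b' = 0 & co 4 b' = 0].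
  move=> [b2 b3 b4]; move/eqP: b'n0; apply; rewrite b'E b2 b3 b4.
  by apply: v7_ext; rewrite co_v7 co0 //; ring.
have [k [k2 k3 k4]] : exists k, [/\ co 2 b = k * co 2 b', co 3 b = k * co 3 b' & co 4 b = k * co 4 b'].
  exact: proportional3 nz d23 d24 d34.
by exists k; rewrite [in RHS]b'E pointZ -k2 -k3 -k4.
Qed.

Lemma dichotomy_simple_root : dichotomy f.
Proof.
have Jd : 16 * J f = discr u2 u3 u4 u5 := J_simple_root _ _ _ _.
have scaleP k b U : k != 0 -> k *: b \in U -> b \in U.
  by move=> k0 kb; rewrite -[b](scalerK k0) rpredZ.
have [two one] := count_conic_line; split=> J0.
  have [|b1 [b2 [c1 c2 ne all]]] := two; first by rewrite -Jd mulf_neq0 ?pnatr_eq0.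
  have [U1 Z1 bU1] := apolar_isotropics_of_conic_line c1; have [U2 Z2 bU2] := apolar_isotropics_of_conic_line c2.
  exists U1, U2; split.
    move=> e; rewrite -e in bU2; have [k] := proportional_in_apolar_isotropics Z1 bU1 bU2 c1 c2.
    exact: ne.
  apply/seteqP; split=> [U ZU|U [] -> //].
  have [b bU cb] := conic_line_of_apolar_isotropics ZU; have [k k0 [eb|eb]] := all _ cb.
    by left; apply: (apolar_isotropics_unique ZU Z1 _ bU1 c1); apply: scaleP k0 _; rewrite -eb.
  by right; apply: (apolar_isotropics_unique ZU Z2 _ bU2 c2); apply: scaleP k0 _; rewrite -eb.
have [|[b1 c1 all]|[F [cF F_inj]]] := one; first by rewrite -Jd J0 mulr0.
  have [U1 Z1 bU1] := apolar_isotropics_of_conic_line c1; left; exists U1.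
  apply/seteqP; split=> [U ZU|U -> //].
  have [b bU cb] := conic_line_of_apolar_isotropics ZU; have [k k0 eb] := all _ cb.
  by apply: (apolar_isotropics_unique ZU Z1 _ bU1 c1); apply: scaleP k0 _; rewrite -eb.
right; pose G n := cid2 (apolar_isotropics_of_conic_line (cF n)).
apply: (@infinite_family _ _ (fun n => s2val (G n))) => [i j e|n]; last exact: s2valP (G n).
have bi := s2valP' (G i); have bj := s2valP' (G j); rewrite -e in bj.
by have [k] := proportional_in_apolar_isotropics (s2valP (G i)) bi bj (cF i) (cF j); exact: F_inj.
Qed.

End SimpleRoot.

(** * Sextics without simple roots *)

Section MultipleRoots.
Variable C : numClosedFieldType.
Local Notation sxt := 'rV[C]_7.
Implicit Types (v w x y : sxt) (U : {vspace sxt}).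

Lemma indep_echelon i j k v w x :
  co i v = 1 -> co j v = 0 -> co k v = 0 -> co i w = 0 -> co j w = 1 -> co k w = 0 ->
  co i x = 0 -> co j x = 0 -> co k x = 1 -> indep3 v w x.
Proof.
move=> vi vj vk wi wj wk xi xj xk a b c e.
have := congr1 (co i) e; have := congr1 (co j) e; have := congr1 (co k) e.
rewrite !(coD, coZ) vi vj vk wi wj wk xi xj xk !co0.
by rewrite !(mulr0, mulr1, addr0, add0r).
Qed.

Let e0 : sxt := v7 1 0 0 0 0 0 0.
Let e1 : sxt := v7 0 1 0 0 0 0 0.
Let e2 : sxt := v7 0 0 1 0 0 0 0.
Let e3 : sxt := v7 0 0 0 1 0 0 0.
Let e4 : sxt := v7 0 0 0 0 1 0 0.
Let e5 : sxt := v7 0 0 0 0 0 1 0.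
Let e6 : sxt := v7 0 0 0 0 0 0 1.

Ltac iso_compute :=
  split; rewrite /om_e /om_h /om_f /pl ?(coD, coZ) !co_v7; by field.

(** Every sextic divisible by z_2^3 is apolar to f. The spaces are the translates of the span of
    z_1^3 z_2^3, z_1 z_2^5 and z_2^6. *)
Lemma dichotomy_quadruple_root (a b c : C) : dichotomy (v7 0 0 0 0 a b c).
Proof.
have J0 := J_quadruple_root a b c; split=> [|_]; first by rewrite J0 eqxx.
right; pose z (n : nat) : sxt := v7 0 0 0 1 n%:R 0 0.
have ind n : indep3 (z n) e5 e6.
  by apply: (@indep_echelon 3 5 6); rewrite !co_v7.
apply: (@infinite_family _ _ (fun n => <<[:: z n; e5; e6]>>%VS)) => [m n e|n].
  have : z m \in <<[:: z n; e5; e6]>>%VS by rewrite -e memv_span ?inE ?eqxx.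
  move=> /span3P[p [q [r E]]].
  have E3 := congr1 (co 3) E; have := congr1 (co 4) E; move: E3.
  rewrite !(coD, coZ) !co_v7 !(mulr0, mulr1, addr0) => <- /eqP.
  by rewrite mul1r eqr_nat => /eqP.
apply: apolar_isotropics_span3 (ind n) _ _ _ _ _ _.
- iso_compute.
- iso_compute.
- iso_compute.
- rewrite /apolar !co_v7; ring.
- rewrite /apolar !co_v7; ring.
- rewrite /apolar !co_v7; ring.
Qed.

(** The derivation z_2 d/dz_1 maps [e t] to f, as it does [base s] for a simple root. Each space
    projects isomorphically to coordinates 0, 1, 2, so it determines [b t] and with it t. *)
Lemma dichotomy_three_double_roots (r : C) : r != 0 ->
  dichotomy (v7 0 0 1 (-2 * r) (r ^+ 2) 0 0).
Proof.
move=> r0; have J0 := J_three_double_roots r; split=> [|_]; first by rewrite J0 eqxx.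
right; pose a (t : C) := v7 1 0 0 (- (5 / 2) * r ^+ 3 * t) (15 / 4 * r ^+ 4 * t)
  (- (3 / 2) * r ^+ 5 * t) 0.
pose b (t : C) := v7 0 0 1 (- (2 / 3) * r * (t + 1)) (r ^+ 2 * t) (- r ^+ 3 * t / 2)
  (r ^+ 4 * t / 12).
pose e (t : C) := v7 0 (1 / 5) (- r / 2) (r ^+ 2 / 3) 0 0 (- r ^+ 5 * t / 120).
have ind t : indep3 (a t) (e t) (b t).
  move=> x y z E; have := congr1 (co 0) E; have := congr1 (co 1) E; have := congr1 (co 2) E.
  rewrite !(coD, coZ) !co_v7 !co0 => E2 E1 E0.
  have x0 : x = 0 by rewrite -[RHS]E0; ring.
  have y0 : y = 0 by apply: (lincomb (k := 5) E1); field.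
  by split=> //; rewrite -[RHS]E2 y0; ring.
apply: (@infinite_family _ _ (fun n => <<[:: a n%:R; e n%:R; b n%:R]>>%VS)) => [m n E|n].
  have : b m%:R \in <<[:: a n%:R; e n%:R; b n%:R]>>%VS.
    by rewrite -E memv_span ?inE ?eqxx ?orbT.
  move=> /span3P[p [q [s F]]].
  have := congr1 (co 0) F; have := congr1 (co 1) F; have := congr1 (co 2) F.
  have := congr1 (co 4) F; rewrite !(coD, coZ) !co_v7 => F4 F2 F1 F0.
  have p0 : p = 0 by rewrite [RHS]F0; ring.
  have q0 : q = 0 by apply: (lincomb (k := 5) (esym F1)); rewrite p0; field.
  have s1 : s = 1 by rewrite F2 p0 q0; ring.
  move: F4; rewrite p0 q0 s1 mul0r mul0r !add0r mul1r.
  by move=> /(mulfI (expf_neq0 2 r0)) /eqP; rewrite eqr_nat => /eqP.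
apply: apolar_isotropics_span3 (ind n%:R) _ _ _ _ _ _.
- iso_compute.
- iso_compute.
- iso_compute.
- rewrite /apolar !co_v7; by field.
- rewrite /apolar !co_v7; by field.
- rewrite /apolar !co_v7; by field.
Qed.

(** Apolarity kills coordinate 3. An element e of U with only coordinates 2 and 6 is found: a
    multiple of z_2^6 forces the second space. Otherwise e ties the coordinates 4, 5 of U to 0, 1,
    and isotropy leaves only the first space. *)
Lemma apolar_isotropics_two_triple_roots U : apolar_isotropics e3 U ->
  U = <<[:: e0; e1; e2]>>%VS \/ U = <<[:: e4; e5; e6]>>%VS.
Proof.
move=> [[dU oU] fU].
have U3 w : w \in U -> co 3 w = 0.
  by move=> /fU; rewrite /apolar !co_v7 => h; apply: (@mulfI0 C 2); rewrite -[RHS]oppr0 -[in RHS]h; ring.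
have EU v w : v \in U -> w \in U ->
    - 3 * (co 0 v * co 5 w - co 5 v * co 0 w) + (co 1 v * co 4 w - co 4 v * co 1 w) = 0.
  move=> vU wU; have [h _ _] := oU _ _ vU wU; apply: (@mulfI0 C 4).
  by rewrite -[RHS]h /om_e /pl (U3 _ vU) (U3 _ wU); ring.
have HU v w : v \in U -> w \in U -> 45 * (co 0 v * co 6 w - co 6 v * co 0 w)
    - 5 * (co 1 v * co 5 w - co 5 v * co 1 w) + (co 2 v * co 4 w - co 4 v * co 2 w) = 0.
  by move=> vU wU; have [_ h _] := oU _ _ vU wU; rewrite -[RHS]h.
have FU v w : v \in U -> w \in U ->
    3 * (co 1 v * co 6 w - co 6 v * co 1 w) - (co 2 v * co 5 w - co 5 v * co 2 w) = 0.
  move=> vU wU; have [_ _ h] := oU _ _ vU wU; apply: (@mulfI0 C 4).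
  by rewrite -[RHS]h /om_f /pl (U3 _ vU) (U3 _ wU); ring.
have eq0 w : w \in U -> w != 0 -> co 0 w = 0 -> co 1 w = 0 -> co 2 w = 0 -> co 4 w = 0 ->
    co 5 w = 0 -> co 6 w = 0 -> False.
  move=> wU /eqP w0 *; apply: w0; apply: v7_ext; rewrite co0 //; exact: U3.
(* This part uses [om_e] alone, which couples coordinate 0 with 5 and 1 with 4. If coordinates 0 and
   1 vanish on all of U, e is found at once; every branch that fails to give e leads to that
   case. *)
have [e [eU en0 [c0 c1 c4 c5]]] : exists e, [/\ e \in U, e != 0 &
    [/\ co 0 e = 0, co 1 e = 0, co 4 e = 0 & co 5 e = 0]].
  have [all01|] := pselect (forall w, w \in U -> co 0 w = 0 /\ co 1 w = 0).
    have [e [eU en0 c4 c5]] := exists_zero_coords 4 5 dU.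
    by have [c0 c1] := all01 _ eU; exists e.
  move=> no; have [w [wU wn0 w0 w1]] := exists_zero_coords 0 1 dU.
  have [w5|w5] := eqVneq (co 5 w) 0.
    have [w4|w4] := eqVneq (co 4 w) 0; first by exists w.
    have U1 v : v \in U -> co 1 v = 0.
      by move=> vU; apply: (mulfI w4); have := EU _ _ wU vU;
        rewrite w0 w1 w5 => h; rewrite mulr0 -[RHS]oppr0 -[in RHS]h; ring.
    have [x [xU xn0 x0 x4]] := exists_zero_coords 0 4 dU.
    have [x5|x5] := eqVneq (co 5 x) 0; first by exists x; split=> //; split=> //; exact: U1.
    case: no => v vU; split; last exact: U1.
    apply: (mulfI x5); rewrite mulr0; apply: (@mulfI0 C 2); have := EU _ _ xU vU.
    by rewrite x0 x4 (U1 _ xU) (U1 _ vU) => h; rewrite -[RHS]h; ring.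
  have [w4|w4] := eqVneq (co 4 w) 0.
    have U0 v : v \in U -> co 0 v = 0.
      move=> vU; apply: (mulfI w5); rewrite mulr0; apply: (@mulfI0 C 2); have := EU _ _ wU vU.
      by rewrite w0 w1 w4 => h; rewrite -[RHS]h; ring.
    have [x [xU xn0 x1 x5]] := exists_zero_coords 1 5 dU.
    have [x4|x4] := eqVneq (co 4 x) 0; first by exists x; split=> //; split=> //; exact: U0.
    case: no => v vU; split; first exact: U0.
    apply: (mulfI x4); have := EU _ _ xU vU.
    by rewrite x1 x5 (U0 _ xU) (U0 _ vU) => h; rewrite mulr0 -[RHS]oppr0 -[in RHS]h; ring.
  have [x [xU xn0 x0 x4]] := exists_zero_coords 0 4 dU.
  have x1 : co 1 x = 0.
    apply: (mulfI w4); have := EU _ _ wU xU.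
    by rewrite w0 w1 x0 x4 => h; rewrite mulr0 -[RHS]oppr0 -[in RHS]h; ring.
  have [x5|x5] := eqVneq (co 5 x) 0; first by exists x.
  have U0 v : v \in U -> co 0 v = 0.
    move=> vU; apply: (mulfI x5); rewrite mulr0; apply: (@mulfI0 C 2); have := EU _ _ xU vU.
    by rewrite x0 x1 x4 => h; rewrite -[RHS]h; ring.
  case: no => v vU; split; first exact: U0.
  apply: (mulfI w4); have := EU _ _ wU vU.
  by rewrite w0 w1 (U0 _ vU) => h; rewrite mulr0 -[RHS]oppr0 -[in RHS]h; ring.
have caseE6 : e6 \in U -> U = <<[:: e4; e5; e6]>>%VS.
  move=> e6U.
  have U0 v : v \in U -> co 0 v = 0.
    move=> vU; apply: (@mulfI0 C 44); have := HU _ _ e6U vU; rewrite !co_v7 => h.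
    by rewrite -[RHS]oppr0 -[in RHS]h; ring.
  have U1 v : v \in U -> co 1 v = 0.
    move=> vU; apply: (@mulfI0 C 2); have := FU _ _ e6U vU; rewrite !co_v7 => h.
    by rewrite -[RHS]oppr0 -[in RHS]h; ring.
  have [y [yU yn0 y2 y6]] := exists_zero_coords 2 6 dU.
  have U2 v : v \in U -> co 2 v = 0.
    move=> vU; have := HU _ _ vU yU; have := FU _ _ vU yU.
    rewrite (U0 _ yU) (U0 _ vU) (U1 _ yU) (U1 _ vU) y2 y6 => h5 h4.
    have [y4|y4] := eqVneq (co 4 y) 0; last first.
      by apply: (mulIf y4); rewrite mul0r -[RHS]h4; ring.
    have [y5|y5] := eqVneq (co 5 y) 0.
      by case: (eq0 y); rewrite // ?U0 ?U1.
    by apply: (mulIf y5); rewrite mul0r -[RHS]oppr0 -[in RHS]h5; ring.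
  have ind : indep3 e4 e5 e6 by apply: (@indep_echelon 4 5 6); rewrite !co_v7.
  apply/eqP; rewrite eqEdim dim_span3 // dU leqnn andbT.
  apply/subvP => w wU; apply/span3P; exists (co 4 w), (co 5 w), (co 6 w).
  by apply: v7_ext; rewrite !(coD, coZ) !co_v7 ?U0 ?U1 ?U2 ?U3 //; ring.
have [e20|e20] := eqVneq (co 2 e) 0.
  right; apply: caseE6.
  have e6n : co 6 e != 0 by apply/eqP => c6; exact: (eq0 e).
  have -> : e6 = (co 6 e)^-1 *: e.
    by apply: v7_ext; rewrite coZ co_v7 ?c0 ?c1 ?e20 ?(U3 _ eU) ?c4 ?c5 ?mulr0 ?mulVf.
  by rewrite rpredZ.
have [e6U|e6U] := boolP (e6 \in U); [by right; exact: caseE6|left].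
have ne6 w : w \in U -> co 0 w = 0 -> co 1 w = 0 -> co 2 w = 0 -> co 4 w = 0 ->
    co 5 w = 0 -> w = 0.
  move=> wU w0 w1 w2 w4 w5; have [w6|w6] := eqVneq (co 6 w) 0.
    by apply: v7_ext; rewrite co0 //; exact: U3.
  case/negP: e6U; have -> : e6 = (co 6 w)^-1 *: w.
    by apply: v7_ext; rewrite coZ co_v7 ?w0 ?w1 ?w2 ?(U3 _ wU) ?w4 ?w5 ?mulr0 ?mulVf.
  by rewrite rpredZ.
(* Orthogonality to e makes [co 4] and [co 5] multiples of s [co 0] and s [co 1] on U; [om_e] then
   forces s = 0. *)
pose s := co 6 e / co 2 e.
have U4 v : v \in U -> co 4 v = 45 * s * co 0 v.
  move=> vU; apply: (mulfI e20); have := HU _ _ eU vU; rewrite c0 c1 c4 c5 => h.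
  by apply: (lincomb (k := 1) h); rewrite /s; field.
have U5 v : v \in U -> co 5 v = - 3 * s * co 1 v.
  move=> vU; apply: (mulfI e20); have := FU _ _ eU vU; rewrite c1 c5 => h.
  by apply: (lincomb (k := -1) h); rewrite /s; field.
have [v [vU vn0 v0 v2]] := exists_zero_coords 0 2 dU.
have [x [xU xn0 x1 x2]] := exists_zero_coords 1 2 dU.
have v1 : co 1 v != 0.
  apply: contraNneq vn0 => v1; apply/eqP/ne6; rewrite ?U4 ?U5 // ?v0 ?v1 ?mulr0 //.
have x0 : co 0 x != 0.
  apply: contraNneq xn0 => x0; apply/eqP/ne6; rewrite ?U4 ?U5 // ?x0 ?x1 ?mulr0 //.
have s0 : s = 0.
  have := EU _ _ xU vU; rewrite !(U5 _ vU) !(U4 _ xU) !(U5 _ xU) !(U4 _ vU) v0 x1 => h.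
  apply/eqP; rewrite -(mulrI_eq0 _ (mulfI (mulf_neq0 x0 v1))); apply/eqP; apply: (@mulfI0 C 35).
  by rewrite -[RHS]oppr0 -[in RHS]h; ring.
have c6 : co 6 e = 0 by apply/eqP; rewrite -(mulfK e20 (co 6 e)) mulrAC -/s s0 mul0r.
have [v4 v5] : co 4 v = 0 /\ co 5 v = 0 by rewrite U4 // U5 // s0; split; ring.
have [x4 x5] : co 4 x = 0 /\ co 5 x = 0 by rewrite U4 // U5 // s0; split; ring.
have v6 : co 6 v = 0.
  have := HU _ _ xU vU; rewrite v0 x1 v2 x2 v5 x5 => h.
  apply: (mulfI x0); rewrite mulr0; apply: (@mulfI0 C 44); rewrite -[RHS]h; ring.
have x6 : co 6 x = 0.
  have := FU _ _ xU vU; rewrite x1 v2 x2 v5 x5 => h.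
  by apply: (mulfI v1); rewrite mulr0; apply: (@mulfI0 C 2); rewrite -[RHS]oppr0 -[in RHS]h; ring.
apply: eq_span3 => //.
- have -> : e0 = (co 0 x)^-1 *: x; last by rewrite rpredZ.
  by apply: v7_ext; rewrite coZ co_v7 ?x1 ?x2 ?(U3 _ xU) ?x4 ?x5 ?x6 ?mulr0 ?mulVf.
- have -> : e1 = (co 1 v)^-1 *: v; last by rewrite rpredZ.
  by apply: v7_ext; rewrite coZ co_v7 ?v0 ?v2 ?(U3 _ vU) ?v4 ?v5 ?v6 ?mulr0 ?mulVf.
- have -> : e2 = (co 2 e)^-1 *: e; last by rewrite rpredZ.
  by apply: v7_ext; rewrite coZ co_v7 ?c0 ?c1 ?(U3 _ eU) ?c4 ?c5 ?c6 ?mulr0 ?mulVf.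
- by apply: (@indep_echelon 0 1 2); rewrite !co_v7.
Qed.

Lemma dichotomy_two_triple_roots : dichotomy e3.
Proof.
have := J_two_triple_roots C; rewrite -/e3 => J0; split=> [_|e]; last by rewrite e eqxx in J0.
exists <<[:: e0; e1; e2]>>%VS, <<[:: e4; e5; e6]>>%VS; split.
  move=> e; have : e0 \in <<[:: e4; e5; e6]>>%VS by rewrite -e memv_span ?inE ?eqxx.
  move=> /span3P[p [q [r F]]]; have := congr1 (co 0) F.
  rewrite !(coD, coZ) !co_v7 => /eqP; rewrite !mulr0 !addr0; exact/negP/oner_neq0.
apply/seteqP; split=> [U /apolar_isotropics_two_triple_roots //|U [] ->].
  have ind : indep3 e0 e1 e2 by apply: (@indep_echelon 0 1 2); rewrite !co_v7.
  apply: apolar_isotropics_span3 ind _ _ _ _ _ _; try iso_compute; rewrite /apolar !co_v7; ring.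
have ind : indep3 e4 e5 e6 by apply: (@indep_echelon 4 5 6); rewrite !co_v7.
apply: apolar_isotropics_span3 ind _ _ _ _ _ _; try iso_compute; rewrite /apolar !co_v7; ring.
Qed.

Theorem dichotomy_nonzero (f : sxt) : f != 0 -> dichotomy f.
Proof.
apply: dichotomy_reduction.
- exact: dichotomy_simple_root.
- exact: dichotomy_quadruple_root.
- exact: dichotomy_two_triple_roots.
- exact: dichotomy_three_double_roots.
Qed.

End MultipleRoots.

(** * Normal forms of isotropic spaces *)

Section Classification.
Variable C : numClosedFieldType.
Local Notation sxt := 'rV[C]_7.
Implicit Types (v w x y : sxt) (U V : {vspace sxt}).

(* The substitution (z_1, z_2) := (r z_1, z_2 / r). *)
Definition torus (r : C) w : sxt :=
  v7 (r ^+ 6 * co 0 w) (r ^+ 4 * co 1 w) (r ^+ 2 * co 2 w) (co 3 w)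
     (r ^- 2 * co 4 w) (r ^- 4 * co 5 w) (r ^- 6 * co 6 w).

Lemma torus_linear r : linear (torus r).
Proof. by move=> c v w; apply: v7_ext; rewrite !(co_v7, coD, coZ); ring. Qed.
HB.instance Definition _ r := GRing.isLinear.Build C sxt sxt _ (torus r) (torus_linear r).

Lemma torusK r : r != 0 -> cancel (torus r) (torus r^-1).
Proof. by move=> r0 w; apply: v7_ext; rewrite !co_v7; field. Qed.

Lemma torusVK r : r != 0 -> cancel (torus r^-1) (torus r).
Proof. by move=> r0 w; apply: v7_ext; rewrite !co_v7; field. Qed.

(** A chain of generators of SL(2) leading from one space to another, so that properties pass along
    it by induction. *)
Inductive equiv : {vspace sxt} -> {vspace sxt} -> Prop :=
| equiv_refl U : equiv U U
| equiv_shift s U V : equiv (image_by (@shift C s) U) V -> equiv U V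
| equiv_swap U V : equiv (image_by (@swap C) U) V -> equiv U V
| equiv_torus r U V : r != 0 -> equiv (image_by (torus r) U) V -> equiv U V.

Let b0 : sxt := v7 1 0 0 0 0 0 0.
Let b1 : sxt := v7 0 1 0 0 0 0 0.
Let b3 : sxt := v7 0 0 0 1 0 0 0.
Let b4 : sxt := v7 0 0 0 0 1 0 0.
Let b5 : sxt := v7 0 0 0 0 0 1 0.
Let b6 : sxt := v7 0 0 0 0 0 0 1.

Definition normal1 := <<[:: b3; b5; b6]>>%VS.
Definition normal2 := <<[:: b4; b5; b6]>>%VS.
(** The spaces with fivefold symmetry about the axis z_1 z_2: t = 0 is degenerate of type 1, and the
    torus rescales t. *)
Definition normal3 (t : C) := <<[:: b3; v7 1 0 0 0 0 t 0; v7 0 1 0 0 0 0 (- t / 9)]>>%VS.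

Lemma sub_span_eq U a b c : \dim U = 3%N -> indep3 a b c ->
  (forall w, w \in U -> w \in <<[:: a; b; c]>>%VS) -> U = <<[:: a; b; c]>>%VS.
Proof.
by move=> dU ind sub; apply/eqP; rewrite eqEdim dim_span3 // dU leqnn andbT; apply/subvP.
Qed.

(** Orthogonality to e gives the linear relations [U2], [U1] and [U4] on U. Either U has an element
    supported on coordinates 5 and 6, which forces [co 0] and [co 1] to vanish on U, or al = be = 0
    and isotropy leaves t as the only freedom. *)
Lemma normal_of_e3 U e : isotropic U -> e \in U -> co 0 e = 0 -> co 1 e = 0 -> co 2 e = 0 ->
  co 3 e = 1 -> co 4 e = 0 -> U = normal1 \/ exists t, U = normal3 t.
Proof.
move=> [dU oU] eU c0 c1 c2 c3 c4; set al := co 5 e; set be := co 6 e.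
have U2 w : w \in U -> co 2 w = - 5 * al * co 0 w.
  move=> wU; have [h _ _] := oU _ _ eU wU; apply: (lincomb (k := 3^-1) h).
  by rewrite /om_e /pl c0 c1 c2 c3 c4 -/al; field.
have U1 w : w \in U -> al * co 1 w = 9 * be * co 0 w.
  move=> wU; have [_ h _] := oU _ _ eU wU; apply: (lincomb (k := 5^-1) h).
  by rewrite /om_h /pl c0 c1 c2 c4 -/al -/be; field.
have U4 w : w \in U -> co 4 w = 5 * be * co 1 w - 5 / 3 * al * co 2 w.
  move=> wU; have [_ _ h] := oU _ _ eU wU; apply: (lincomb (k := 3^-1) h).
  by rewrite /om_f /pl c1 c2 c3 c4 -/al -/be; field.
have zcase z : z \in U -> z != 0 -> co 0 z = 0 -> co 1 z = 0 -> co 2 z = 0 -> co 3 z = 0 ->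
    co 4 z = 0 -> U = normal1.
  move=> zU zn z0 z1 z2 z3 z4.
  have z56 : co 5 z = 0 -> co 6 z != 0.
    by move=> z5; apply: contraNneq zn => z6; apply/eqP; apply: v7_ext; rewrite co0.
  have U0 w : w \in U -> co 0 w = 0.
    move=> wU; have [h1 h2 _] := oU _ _ zU wU.
    have [z5|z5] := eqVneq (co 5 z) 0.
      apply: (mulfI (z56 z5)); apply: (lincomb (k := - 45^-1) h2).
      by rewrite /om_h /pl z0 z1 z2 z4 z5; field.
    apply: (mulfI z5); apply: (lincomb (k := 15^-1) h1).
    by rewrite /om_e /pl z0 z1 z2 z3 z4; field.
  have U1' w : w \in U -> co 1 w = 0.
    move=> wU; have [_ h2 h3] := oU _ _ zU wU.
    have [z5|z5] := eqVneq (co 5 z) 0.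
      apply: (mulfI (z56 z5)); apply: (lincomb (k := - 15^-1) h3).
      by rewrite /om_f /pl z1 z2 z3 z4 z5; field.
    apply: (mulfI z5); apply: (lincomb (k := 5^-1) h2).
    by rewrite /om_h /pl z0 z1 z2 z4 (U0 _ wU); field.
  apply: sub_span_eq => //; first by apply: (@indep_echelon _ 3 5 6); rewrite !co_v7.
  move=> w wU; apply/span3P; exists (co 3 w), (co 5 w), (co 6 w).
  have w2 : co 2 w = 0 by rewrite U2 // U0 // mulr0.
  have w4 : co 4 w = 0 by rewrite U4 // w2 U1' //; ring.
  by apply: v7_ext; rewrite !(coD, coZ) !co_v7 ?U0 ?U1' ?w2 ?w4 //; ring.
have [a [aU an a3 a0]] := exists_zero_coords 3 0 dU.
have [b [bU bn h3 h1]] := exists_zero_coords 3 1 dU.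
have a2 : co 2 a = 0 by rewrite U2 // a0; ring.
have [a1|a1] := eqVneq (co 1 a) 0.
  left; apply: (zcase a) => //; rewrite U4 // a1 a2; ring.
have [h0|h0] := eqVneq (co 0 b) 0.
  have h2 : co 2 b = 0 by rewrite U2 // h0; ring.
  left; apply: (zcase b) => //; rewrite U4 // h1 h2; ring.
have al0 : al = 0 by apply: (mulIf a1); rewrite U1 // a0; ring.
have be0 : be = 0.
  have /esym/eqP := U1 _ bU; rewrite al0 mul0r !mulf_eq0 (negPf h0) orbF pnatr_eq0 /=.
  by move/eqP.
right; pose a' := (co 1 a)^-1 *: a; pose b' := (co 0 b)^-1 *: b.
have [a'U b'U] : a' \in U /\ b' \in U by rewrite !rpredZ.
have [a'0 a'1 a'3] : [/\ co 0 a' = 0, co 1 a' = 1 & co 3 a' = 0].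
  by rewrite !coZ a0 a3 !mulr0 mulVf.
have [b'0 b'1 b'3] : [/\ co 0 b' = 1, co 1 b' = 0 & co 3 b' = 0].
  by rewrite !coZ h1 h3 !mulr0 mulVf.
have [a'2 a'4] : co 2 a' = 0 /\ co 4 a' = 0.
  have a'2 : co 2 a' = 0 by rewrite U2 // al0; ring.
  by rewrite U4 // a'2 be0; split=> //; ring.
have [b'2 b'4] : co 2 b' = 0 /\ co 4 b' = 0.
  have b'2 : co 2 b' = 0 by rewrite U2 // al0; ring.
  by rewrite U4 // b'2 be0; split=> //; ring.
have [oe oh of_] := oU _ _ b'U a'U.
have a'5 : co 5 a' = 0.
  apply: (lincomb (k := - 15^-1) oe).
  by rewrite /om_e /pl a'0 a'1 a'2 a'3 a'4 b'0 b'1 b'2 b'3 b'4; field.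
have b'6 : co 6 b' = 0.
  apply: (lincomb (k := - 15^-1) of_).
  by rewrite /om_f /pl a'1 a'2 a'3 a'4 b'1 b'2 b'3 b'4; field.
have a'6 : co 6 a' = - co 5 b' / 9.
  apply: (lincomb (k := 45^-1) oh).
  by rewrite /om_h /pl a'0 a'1 a'2 a'4 b'0 b'1 b'2 b'4; field.
have aE : a' = v7 0 1 0 0 0 0 (- co 5 b' / 9) by apply: v7_ext; rewrite co_v7.
have bE : b' = v7 1 0 0 0 0 (co 5 b') 0 by apply: v7_ext; rewrite co_v7.
have eE : e = b3 by apply: v7_ext; rewrite co_v7.
exists (co 5 b'); apply: eq_span3 => //.
- by rewrite -eE.
- by rewrite -bE.
- by rewrite -aE.
- by apply: (@indep_echelon _ 3 0 1); rewrite !co_v7.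
Qed.

Lemma normal_of_e4 U e : isotropic U -> e \in U -> co 0 e = 0 -> co 1 e = 0 -> co 2 e = 0 ->
  co 3 e = 0 -> co 4 e = 1 -> co 5 e = 0 -> U = normal2.
Proof.
move=> [dU oU] eU c0 c1 c2 c3 c4 c5.
have U1 w : w \in U -> co 1 w = 0.
  move=> wU; have [h _ _] := oU _ _ eU wU; apply: (lincomb (k := - 5^-1) h).
  by rewrite /om_e /pl c0 c1 c2 c3 c4 c5; field.
have U2 w : w \in U -> co 2 w = - 45 * co 6 e * co 0 w.
  move=> wU; have [_ h _] := oU _ _ eU wU; apply: (lincomb (k := -1) h).
  by rewrite /om_h /pl c0 c1 c2 c4 c5; field.
have U3 w : w \in U -> co 3 w = 0.
  move=> wU; have [_ _ h] := oU _ _ eU wU; apply: (lincomb (k := - 3^-1) h).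
  by rewrite /om_f /pl c1 c2 c3 c4 c5 (U1 _ wU); field.
have [z [zU zn z4 z0]] := exists_zero_coords 4 0 dU.
have z2 : co 2 z = 0 by rewrite U2 // z0 mulr0.
have z56 : co 5 z = 0 -> co 6 z != 0.
  move=> z5; apply: contraNneq zn => z6; apply/eqP; apply: v7_ext; rewrite co0 //.
    exact: U1.
  exact: U3.
have U0 w : w \in U -> co 0 w = 0.
  move=> wU; have [h1 h2 _] := oU _ _ zU wU.
  have [z5|z5] := eqVneq (co 5 z) 0.
    apply: (mulfI (z56 z5)); apply: (lincomb (k := - 45^-1) h2).
    by rewrite /om_h /pl z0 z2 z4 z5 (U1 _ zU); field.
  apply: (mulfI z5); apply: (lincomb (k := 15^-1) h1).
  by rewrite /om_e /pl z0 z2 z4 (U1 _ zU) (U3 _ zU); field.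
apply: sub_span_eq => //; first by apply: (@indep_echelon _ 4 5 6); rewrite !co_v7.
move=> w wU; apply/span3P; exists (co 4 w), (co 5 w), (co 6 w).
have w2 : co 2 w = 0 by rewrite U2 // U0 // mulr0.
by apply: v7_ext; rewrite !(coD, coZ) !co_v7 ?U0 ?U1 ?w2 ?U3 //; ring.
Qed.

Definition normal V := [\/ V = normal1, V = normal2 | exists t, V = normal3 t].

Lemma iso_shift s U : isotropic U -> isotropic (image_by (@shift C s) U).
Proof. exact: (iso_image_by (shiftK s) (shiftNK s) (@ortho_shift C s)). Qed.

Lemma iso_swap U : isotropic U -> isotropic (image_by (@swap C) U).
Proof. exact: (iso_image_by (@swapK C) (@swapK C) (@ortho_swap C)). Qed.

(** A translation removes the coefficient next to the leading one. Were all elements with a triple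
    root at infinity divisible by z_2^5, orthogonality to one of them would confine U to a space of
    dimension less than three. *)
Lemma equiv_normal_triple U e : isotropic U -> e \in U -> e != 0 ->
  co 0 e = 0 -> co 1 e = 0 -> co 2 e = 0 -> exists2 V, normal V & equiv U V.
Proof.
move=> isoU; have [dU oU] := isoU.
have case3 x : x \in U -> co 0 x = 0 -> co 1 x = 0 -> co 2 x = 0 -> co 3 x != 0 ->
    exists2 V, normal V & equiv U V.
  move=> xU x0 x1 x2 x3; pose s := - co 4 x / (3 * co 3 x).
  pose y := shift s ((co 3 x)^-1 *: x).
  have yU : y \in image_by (@shift C s) U.
    by rewrite (mem_image_by (shiftK s) (shiftNK s)) /y /= shiftK rpredZ.
  exists (image_by (@shift C s) U); last by apply: equiv_shift (equiv_refl _).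
  have [] := @normal_of_e3 _ y (iso_shift s isoU) yU.
  - by rewrite !co_v7 coZ x0; ring.
  - by rewrite !co_v7 !coZ x0 x1; ring.
  - by rewrite !co_v7 !coZ x0 x1 x2; ring.
  - by rewrite !co_v7 !coZ x0 x1 x2; field.
  - by rewrite !co_v7 !coZ x0 x1 x2 /s; field.
  - by move=> ->; constructor 1.
  - by move=> h; constructor 3.
have case4 x : x \in U -> co 0 x = 0 -> co 1 x = 0 -> co 2 x = 0 -> co 4 x != 0 ->
    exists2 V, normal V & equiv U V.
  move=> xU x0 x1 x2 x4; have [x3|x3] := eqVneq (co 3 x) 0; last exact: case3 x3.
  pose s := - co 5 x / (2 * co 4 x).
  pose y := shift s ((co 4 x)^-1 *: x).
  have yU : y \in image_by (@shift C s) U.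
    by rewrite (mem_image_by (shiftK s) (shiftNK s)) /y /= shiftK rpredZ.
  exists (image_by (@shift C s) U); last by apply: equiv_shift (equiv_refl _).
  constructor 2; apply: (@normal_of_e4 _ y (iso_shift s isoU) yU).
  - by rewrite !co_v7 coZ x0; ring.
  - by rewrite !co_v7 !coZ x0 x1; ring.
  - by rewrite !co_v7 !coZ x0 x1 x2; ring.
  - by rewrite !co_v7 !coZ x0 x1 x2 x3; ring.
  - by rewrite !co_v7 !coZ x0 x1 x2 x3; field.
  - by rewrite !co_v7 !coZ x0 x1 x2 x3 /s; field.
move=> eU en c0 c1 c2.
have [[x [xU [x0 x1 x2] x34]]|no] := pselect (exists x, [/\ x \in U,
    [/\ co 0 x = 0, co 1 x = 0 & co 2 x = 0] & co 3 x != 0 \/ co 4 x != 0]).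
  by case: x34; [exact: case3 x2|exact: case4 x2].
have U34 x : x \in U -> co 0 x = 0 -> co 1 x = 0 -> co 2 x = 0 -> co 3 x = 0 /\ co 4 x = 0.
  move=> xU x0 x1 x2; split; apply/eqP/negPn/negP => n; apply: no; exists x; split=> //.
    by left.
  by right.
have z5case z : z \in U -> co 0 z = 0 -> co 1 z = 0 -> co 2 z = 0 -> co 5 z != 0 -> False.
  move=> zU z0 z1 z2 z5; have [z3 z4] := U34 _ zU z0 z1 z2.
  have U0 w : w \in U -> co 0 w = 0.
    move=> wU; have [h _ _] := oU _ _ zU wU; apply: (mulfI z5).
    by apply: (lincomb (k := 15^-1) h); rewrite /om_e /pl z0 z1 z2 z3 z4; field.
  have U1 w : w \in U -> co 1 w = 0.
    move=> wU; have [_ h _] := oU _ _ zU wU; apply: (mulfI z5).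
    by apply: (lincomb (k := 5^-1) h); rewrite /om_h /pl z0 z1 z2 z4 (U0 _ wU); field.
  have U2 w : w \in U -> co 2 w = 0.
    move=> wU; have [_ _ h] := oU _ _ zU wU; apply: (mulfI z5).
    by apply: (lincomb (k := 5^-1) h); rewrite /om_f /pl z1 z2 z3 z4 (U1 _ wU); field.
  have [w [wU wn w5 w6]] := exists_zero_coords 5 6 dU.
  have [w3 w4] := U34 _ wU (U0 _ wU) (U1 _ wU) (U2 _ wU).
  by move/eqP: wn; apply; apply: v7_ext; rewrite co0 // ?U0 ?U1 ?U2.
exfalso; have [c3 c4] := U34 _ eU c0 c1 c2.
have [c5|] := eqVneq (co 5 e) 0; last exact: z5case.
have c6 : co 6 e != 0 by apply: contraNneq en => c6; apply/eqP; apply: v7_ext; rewrite co0.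
have U0 w : w \in U -> co 0 w = 0.
  move=> wU; have [_ h _] := oU _ _ eU wU; apply: (mulfI c6).
  by apply: (lincomb (k := - 45^-1) h); rewrite /om_h /pl c0 c1 c2 c4 c5; field.
have U1 w : w \in U -> co 1 w = 0.
  move=> wU; have [_ _ h] := oU _ _ eU wU; apply: (mulfI c6).
  by apply: (lincomb (k := - 15^-1) h); rewrite /om_f /pl c1 c2 c3 c4 c5; field.
have [w [wU wn w2 w6]] := exists_zero_coords 2 6 dU.
have [w3 w4] := U34 _ wU (U0 _ wU) (U1 _ wU) w2.
apply: (z5case w wU (U0 _ wU) (U1 _ wU) w2).
by apply: contraNneq wn => w5; apply/eqP; apply: v7_ext; rewrite co0 // ?U0 ?U1.
Qed.

Lemma echelon_basis U : \dim U = 3%N ->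
  (forall w, w \in U -> co 0 w = 0 -> co 1 w = 0 -> co 2 w = 0 -> w = 0) ->
  exists a b c, [/\ a \in U, b \in U & c \in U] /\
    [/\ [/\ co 0 a = 1, co 1 a = 0 & co 2 a = 0], [/\ co 0 b = 0, co 1 b = 1 & co 2 b = 0] &
        [/\ co 0 c = 0, co 1 c = 0 & co 2 c = 1]].
Proof.
move=> dU inj.
have [a [aU an a1 a2]] := exists_zero_coords 1 2 dU.
have [b [bU bn h0 h2]] := exists_zero_coords 0 2 dU.
have [c [cU cn c0 c1]] := exists_zero_coords 0 1 dU.
have a0 : co 0 a != 0 by apply: contraNneq an => a0; apply/eqP/inj.
have h1 : co 1 b != 0 by apply: contraNneq bn => h1; apply/eqP/inj.
have c2 : co 2 c != 0 by apply: contraNneq cn => c2; apply/eqP/inj.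
exists ((co 0 a)^-1 *: a), ((co 1 b)^-1 *: b), ((co 2 c)^-1 *: c); rewrite !rpredZ //.
by split=> //; split; rewrite !coZ ?a1 ?a2 ?h0 ?h2 ?c0 ?c1 ?mulr0 mulVf.
Qed.

(* The left-hand side of the equation below is, up to a constant, the Wronskian at s of
   the three dehomogenized sextics a, b, c: its roots are the triple zeros of elements of U. *)
Lemma wronskian_root (p q : C) : exists s : C,
  s ^+ 12 + 11 * p * s ^+ 10 + 55 * q * s ^+ 9 - 165 / 4 * p ^+ 2 * s ^+ 8 - 66 * p * q * s ^+ 7
  - (55 / 2 * p ^+ 3 + 165 * q ^+ 2) * s ^+ 6 + 33 / 2 * p ^+ 2 * q * s ^+ 5
  - (825 / 16 * p ^+ 4 + 165 * p * q ^+ 2) * s ^+ 4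
  - (165 / 2 * p ^+ 3 * q + 275 * q ^+ 3) * s ^+ 3
  + (231 / 4 * p ^+ 2 * q ^+ 2 + 275 / 16 * p ^+ 5) * s ^+ 2
  + (95 / 16 * p ^+ 4 * q + 20 * p * q ^+ 3) * s
  + (125 / 64 * p ^+ 6 + 14 * p ^+ 3 * q ^+ 2 + 25 * q ^+ 4) = 0.
Proof.
have [s e] := @solve_monicpoly C 12 (fun i => nth 0
  [:: - (125 / 64 * p ^+ 6 + 14 * p ^+ 3 * q ^+ 2 + 25 * q ^+ 4);
     - (95 / 16 * p ^+ 4 * q + 20 * p * q ^+ 3);
     - (231 / 4 * p ^+ 2 * q ^+ 2 + 275 / 16 * p ^+ 5);
     165 / 2 * p ^+ 3 * q + 275 * q ^+ 3;
     825 / 16 * p ^+ 4 + 165 * p * q ^+ 2;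
     - (33 / 2 * p ^+ 2 * q);
     55 / 2 * p ^+ 3 + 165 * q ^+ 2;
     66 * p * q;
     165 / 4 * p ^+ 2;
     - (55 * q);
     - (11 * p)] i) isT.
by exists s; rewrite e !big_ord_recl big_ord0 /= /bump /=; ring.
Qed.

Lemma equiv_normal U : isotropic U -> exists2 V, normal V & equiv U V.
Proof.
move=> isoU; have [dU oU] := isoU.
have [[e [eU en [c0 c1 c2]]]|no] := pselect (exists e, [/\ e \in U, e != 0 &
    [/\ co 0 e = 0, co 1 e = 0 & co 2 e = 0]]).
  exact: equiv_normal_triple eU en c0 c1 c2.
have inj w : w \in U -> co 0 w = 0 -> co 1 w = 0 -> co 2 w = 0 -> w = 0.
  by move=> wU w0 w1 w2; apply/eqP/negPn/negP => wn; apply: no; exists w.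
(* An element with a triple root at s suffices: [shift] moves this root to 0 and [swap] moves it to
   infinity. *)
suff [s [e [eU en [c4 c5 c6]]]] : exists s e, [/\ e \in U, e != 0 &
    [/\ co 4 (shift s e) = 0, co 5 (shift s e) = 0 & co 6 (shift s e) = 0]].
  pose e' := swap (shift s e).
  have e'U : e' \in image_by (@swap C) (image_by (@shift C s) U).
    by rewrite (mem_image_by (@swapK C) (@swapK C)) /e' /= swapK (mem_image_by (shiftK s) (shiftNK s)) /= shiftK.
  have e'n : e' != 0.
    apply: contraNneq en => e0; rewrite -(shiftK s e) -(swapK (shift s e)) -/e' e0.
    by rewrite !linear0.
  have [] := equiv_normal_triple (iso_swap (iso_shift s isoU)) e'U e'n.
  - by rewrite co_v7.
  - by rewrite co_v7 c5 oppr0.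
  - by rewrite co_v7.
  move=> V nV eV; exists V => //.
  exact/(equiv_shift (s := s))/equiv_swap.
have [a0 [b0' [c' [[_ _ cU'] [_ _ [c'0 c'1 c'2]]]]]] := echelon_basis dU inj.
(* This translation makes coordinate 3 of the third echelon vector vanish; the isotropy equations
   then express all three vectors through p and q. *)
pose s0 := - co 3 c' / 4; pose U' := image_by (@shift C s0) U.
have mU' w : (w \in U') = (shift (- s0) w \in U).
  by rewrite (mem_image_by (shiftK s0) (shiftNK s0)).
have isoU' : isotropic U' := iso_shift s0 isoU.
have [dU' oU'] := isoU'.
have inj' w : w \in U' -> co 0 w = 0 -> co 1 w = 0 -> co 2 w = 0 -> w = 0.
  rewrite mU' => wU w0 w1 w2; rewrite -[w](shiftNK s0) (inj _ wU) ?linear0 // co_v7 w0 ?w1 ?w2; ring.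
have [a [b [c [[aU bU cU] [[a_0 a_1 a_2] [b_0 b_1 b_2] [c_0 c_1 c_2]]]]]] := echelon_basis dU' inj'.
have c3 : co 3 c = 0.
  have dU'' : c - shift s0 c' \in U' by rewrite rpredB // mU' shiftK.
  have d0 : c - shift s0 c' = 0.
    apply: inj' => //; rewrite coD coN co_v7 c'0 ?c'1 ?c'2 ?c_0 ?c_1 ?c_2; ring.
  have := congr1 (co 3) d0; rewrite coD coN co_v7 c'0 c'1 c'2 co0 /s0 => h.
  by rewrite -[RHS]h; field.
set p := co 4 c; set q := co 5 c.
have [ab_e ab_h ab_f] := oU' _ _ aU bU.
have [ac_e ac_h ac_f] := oU' _ _ aU cU.
have [bc_e bc_h bc_f] := oU' _ _ bU cU.
have a3 : co 3 a = 5 * q.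
  apply: (lincomb (k := 3^-1) ac_e); rewrite /om_e /pl a_0 a_1 a_2 c_0 c_1 c_2 -/q; by field.
have h3 : co 3 b = - (5 / 3) * p.
  apply: (lincomb (k := 3^-1) bc_e); rewrite /om_e /pl b_0 b_1 b_2 c_0 c_1 c_2 -/p; by field.
have h4 : co 4 b = - 5 * q.
  apply: (lincomb (k := - 1) bc_h); rewrite /om_h /pl b_0 b_1 b_2 c_0 c_1 c_2 -/q; by field.
have a4 : co 4 a = - 3 * co 5 b.
  apply: (lincomb (k := - 5^-1) ab_e); rewrite /om_e /pl a_0 a_1 a_2 b_0 b_1 b_2; by field.
have c6 : co 6 c = co 4 a / 45.
  apply: (lincomb (k := 45^-1) ac_h); rewrite /om_h /pl a_0 a_1 a_2 c_0 c_1 c_2; by field.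
have h5 : co 5 b = 5 / 4 * p ^+ 2.
  apply: (lincomb (k := 4^-1) bc_f); rewrite /om_f /pl b_1 b_2 c_1 c_2 c3 c6 a4 h3 -/p; by field.
have a5 : co 5 a = - 3 * p * q.
  apply: (lincomb (k := 5^-1) ac_f); rewrite /om_f /pl a_1 a_2 c_1 c_2 a3 c3 -/p; by field.
have h6 : co 6 b = p * q / 3.
  apply: (lincomb (k := 45^-1) ab_h); rewrite /om_h /pl a_0 a_1 a_2 b_0 b_1 b_2 a5; by field.
have a6 : co 6 a = - 5 * q ^+ 2 - 5 / 4 * p ^+ 3.
  apply: (lincomb (k := - 15^-1) ab_f).
  rewrite /om_f /pl a_1 a_2 b_1 b_2 a3 h4 a4 h5 h3; by field.
have [s rs] := wronskian_root p q.
(* The determinant of coordinates 4, 5, 6 of the translated basis is the polynomial whose root is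
   s. *)
have [|x [y [z [nz e4 e5 e6]]]] := @kernel3 C
   (co 4 (shift s a)) (co 4 (shift s b)) (co 4 (shift s c))
   (co 5 (shift s a)) (co 5 (shift s b)) (co 5 (shift s c))
   (co 6 (shift s a)) (co 6 (shift s b)) (co 6 (shift s c)).
  rewrite -[RHS]rs !co_v7 a_0 a_1 a_2 b_0 b_1 b_2 c_0 c_1 c_2 c3 c6 a3 a5 a6 a4 h6 h5 h4 h3 -/p -/q.
  by field.
pose e := x *: a + y *: b + z *: c.
have eU' : e \in U' by rewrite !rpredD ?rpredZ.
exists (s + s0), (shift (- s0) e); split; first by rewrite -mU'.
- apply/eqP => e0; apply: nz.
  have e0' : e = 0 by rewrite -[e](shiftNK s0) e0 linear0.
  have := congr1 (co 0) e0'; have := congr1 (co 1) e0'; have := congr1 (co 2) e0'.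
  rewrite !(coD, coZ) a_0 a_1 a_2 b_0 b_1 b_2 c_0 c_1 c_2 !co0.
  by rewrite !(mulr0, mulr1, addr0, add0r).
- have -> : shift (s + s0) (shift (- s0) e) = shift s e.
    by apply: v7_ext; rewrite !co_v7; ring.
  by rewrite /e !linearD !linearZ /= !(coD, coZ).
Qed.

End Classification.

(** * Icosahedral sets *)

Section Quadratics.
Variable C : numClosedFieldType.
Local Notation sxt := 'rV[C]_7.
Local Notation vec := 'rV[C]_3.
Implicit Types (a b c r s t : vec).

(* (x, a) restricted to the conic is q0 a z_1^2 + q1 a z_1 z_2 + q2 a z_2^2. *)
Definition cr k a : C := a 0 (inord k).
Definition q0 a := cr 0 a + 'i * cr 1 a.
Definition q1 a := 2 * cr 2 a.
Definition q2 a := - cr 0 a + 'i * cr 1 a.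
Definition of_q x y z : vec := vec3 ((x - z) / 2) ((x + z) / (2 * 'i)) (y / 2).

Lemma cr_vec3 (x y z : C) : (cr 0 (vec3 x y z) = x) * (cr 1 (vec3 x y z) = y) * (cr 2 (vec3 x y z) = z).
Proof. by rewrite /cr /vec3 !mxE !inordK. Qed.

Lemma cr_ext a b : cr 0 a = cr 0 b -> cr 1 a = cr 1 b -> cr 2 a = cr 2 b -> a = b.
Proof.
move=> e0 e1 e2; apply/rowP => i; rewrite -(inord_val i).
by case: i => [[|[|[|]]] li].
Qed.

Lemma dot_cr a b : dot a b = cr 0 a * cr 0 b + cr 1 a * cr 1 b + cr 2 a * cr 2 b.
Proof.
rewrite /dot !big_ord_recl big_ord0 addr0 addrA /cr.
by congr (a _ _ * b _ _ + a _ _ * b _ _ + a _ _ * b _ _); apply/val_inj; rewrite /= inordK.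
Qed.

Lemma i_sqr : ('i : C) ^+ 2 = -1. Proof. exact: sqrCi. Qed.
Lemma i_neq0 : ('i : C) != 0. Proof. exact: neq0Ci. Qed.

Lemma dot_q a b : dot a b = q1 a * q1 b / 4 - (q0 a * q2 b + q2 a * q0 b) / 2.
Proof. by rewrite dot_cr /q0 /q1 /q2; have i2 := i_sqr; field: i2. Qed.

Lemma of_qK x y z : (q0 (of_q x y z) = x) * (q1 (of_q x y z) = y) * (q2 (of_q x y z) = z).
Proof.
have i0 := i_neq0.
by rewrite /q0 /q1 /q2 /of_q !cr_vec3; do !split; field.
Qed.

Lemma q_ext a b : q0 a = q0 b -> q1 a = q1 b -> q2 a = q2 b -> a = b.
Proof.
move=> /eqP; rewrite -subr_eq0 => /eqP e0 e1 /eqP; rewrite -subr_eq0 => /eqP e2.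
apply: cr_ext.
- apply: (mulfI (natr_neq0 C 1)).
  by apply: (lincomb2 (k := 1) (l := -1) e0 e2); rewrite /q0 /q2; ring.
- apply: (mulfI i_neq0); apply: (mulfI (natr_neq0 C 1)).
  by apply: (lincomb2 (k := 1) (l := 1) e0 e2); rewrite /q0 /q2; ring.
- exact: (mulfI (natr_neq0 C 1)).
Qed.

Lemma crD k a b : cr k (a + b) = cr k a + cr k b. Proof. by rewrite /cr mxE. Qed.
Lemma crZ k x a : cr k (x *: a) = x * cr k a. Proof. by rewrite /cr mxE. Qed.
Lemma cr0 k : cr k 0 = 0. Proof. by rewrite /cr mxE. Qed.

Lemma qD a b : (q0 (a + b) = q0 a + q0 b) * (q1 (a + b) = q1 a + q1 b) * (q2 (a + b) = q2 a + q2 b).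
Proof. by rewrite /q0 /q1 /q2 !crD; do !split; ring. Qed.
Lemma qZ x a : (q0 (x *: a) = x * q0 a) * (q1 (x *: a) = x * q1 a) * (q2 (x *: a) = x * q2 a).
Proof. by rewrite /q0 /q1 /q2 !crZ; do !split; ring. Qed.

(* The sextic of the cubic (x, a)(x, b)(x, c). *)
Definition T3 a b c : sxt := v7
  (q0 a * q0 b * q0 c)
  (q1 a * q0 b * q0 c + q0 a * q1 b * q0 c + q0 a * q0 b * q1 c)
  (q2 a * q0 b * q0 c + q0 a * q2 b * q0 c + q0 a * q0 b * q2 c
   + q1 a * q1 b * q0 c + q1 a * q0 b * q1 c + q0 a * q1 b * q1 c)
  (q0 a * q1 b * q2 c + q0 a * q2 b * q1 c + q1 a * q0 b * q2 c
   + q1 a * q2 b * q0 c + q2 a * q0 b * q1 c + q2 a * q1 b * q0 c + q1 a * q1 b * q1 c)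
  (q0 a * q2 b * q2 c + q2 a * q0 b * q2 c + q2 a * q2 b * q0 c
   + q1 a * q1 b * q2 c + q1 a * q2 b * q1 c + q2 a * q1 b * q1 c)
  (q1 a * q2 b * q2 c + q2 a * q1 b * q2 c + q2 a * q2 b * q1 c)
  (q2 a * q2 b * q2 c).

(** This makes apolarity a matter of dot products only. For the cubes of null vectors r and a just
    the last sum survives, giving -480 (r, a)^3, the constant by which the apolar form and the
    pairing differ. *)
Lemma apolar_T3 r s t a b c : apolar (T3 r s t) (T3 a b c) =
  32 * ((dot r s * dot t a + dot r t * dot s a + dot s t * dot r a) * dot b c
      + (dot r s * dot t b + dot r t * dot s b + dot s t * dot r b) * dot a c
      + (dot r s * dot t c + dot r t * dot s c + dot s t * dot r c) * dot a b)
  - 80 * (dot r a * dot s b * dot t c + dot r a * dot s c * dot t b + dot r b * dot s a * dot t c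
      + dot r b * dot s c * dot t a + dot r c * dot s a * dot t b + dot r c * dot s b * dot t a).
Proof.
rewrite /apolar !co_v7 !dot_q.
move: (q0 r) (q1 r) (q2 r) (q0 s) (q1 s) (q2 s) (q0 t) (q1 t) (q2 t) => r0 r1 r2 s0 s1 s2 t0 t1 t2.
move: (q0 a) (q1 a) (q2 a) (q0 b) (q1 b) (q2 b) (q0 c) (q1 c) (q2 c) => a0 a1 a2 b0 b1 b2 c0 c1 c2.
by field.
Qed.

(** The hypothesis says that the squared cosine of the angle is 1/5, as for two axes of an
    icosahedron. Each skew form on the two cubes is this relation times a minor of the coordinates
    of a and b. *)
Lemma ortho_T3 a b : 5 * dot a b ^+ 2 = dot a a * dot b b ->
  ortho (T3 a a a) (T3 b b b).
Proof.
rewrite !dot_q => h.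
have {}h : 5 * (q1 a * q1 b / 4 - (q0 a * q2 b + q2 a * q0 b) / 2) ^+ 2 -
  (q1 a * q1 a / 4 - (q0 a * q2 a + q2 a * q0 a) / 2) *
  (q1 b * q1 b / 4 - (q0 b * q2 b + q2 b * q0 b) / 2) = 0 by rewrite h subrr.
split.
- apply: (lincomb (k := -36 * (q0 a * q1 b - q1 a * q0 b)) h); rewrite /om_e /pl !co_v7; by field.
- apply: (lincomb (k := 36 * (q0 a * q2 b - q2 a * q0 b)) h); rewrite /om_h /pl !co_v7; by field.
- apply: (lincomb (k := 36 * (q1 a * q2 b - q2 a * q1 b)) h); rewrite /om_f /pl !co_v7; by field.
Qed.

Section Action.
Variables (phi : {linear vec -> vec}).
Hypothesis phi_dot : forall a b, dot (phi a) (phi b) = dot a b.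

Lemma orthogonal_matrix : exists2 G : 'M[C]_3, G *m G^T = 1%:M & forall a, a *m G = phi a.
Proof.
exists (lin1_mx phi); last by move=> a; rewrite mul_rV_lin1.
apply/matrixP => i j; transitivity (dot (phi (delta_mx 0 i)) (phi (delta_mx 0 j))).
  by rewrite mxE /dot; apply: eq_bigr => k _; rewrite !mxE.
rewrite phi_dot /dot mxE; rewrite (bigD1 i) //= big1 ?addr0 => [|k ki]; last first.
  by rewrite !mxE (negPf ki) mul0r.
by rewrite !mxE !eqxx mul1r.
Qed.
End Action.

Definition shiftq x a := of_q (q0 a) (q1 a + 2 * x * q0 a) (q2 a + x * q1 a + x ^+ 2 * q0 a).
Definition swapq a := of_q (q2 a) (- q1 a) (q0 a).
Definition torusq x a := of_q (x ^+ 2 * q0 a) (q1 a) (x ^- 2 * q2 a).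

Lemma shiftq_linear x : linear (shiftq x).
Proof. by move=> k a b; apply: q_ext; rewrite !(of_qK, qD, qZ); ring. Qed.
Lemma swapq_linear : linear swapq.
Proof. by move=> k a b; apply: q_ext; rewrite !(of_qK, qD, qZ); ring. Qed.
Lemma torusq_linear x : linear (torusq x).
Proof. by move=> k a b; apply: q_ext; rewrite !(of_qK, qD, qZ); ring. Qed.
HB.instance Definition _ x := GRing.isLinear.Build C vec vec _ (shiftq x) (shiftq_linear x).
HB.instance Definition _ := GRing.isLinear.Build C vec vec _ swapq swapq_linear.
HB.instance Definition _ x := GRing.isLinear.Build C vec vec _ (torusq x) (torusq_linear x).

Lemma dot_shiftq x a b : dot (shiftq x a) (shiftq x b) = dot a b.
Proof. by rewrite !dot_q !of_qK; field. Qed.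
Lemma dot_swapq a b : dot (swapq a) (swapq b) = dot a b.
Proof. by rewrite !dot_q !of_qK; field. Qed.
Lemma dot_torusq x a b : x != 0 -> dot (torusq x a) (torusq x b) = dot a b.
Proof. by move=> x0; rewrite !dot_q !of_qK; field. Qed.

Lemma shift_T3 x a b c : shift x (T3 a b c) = T3 (shiftq x a) (shiftq x b) (shiftq x c).
Proof. by apply: v7_ext; rewrite !co_v7 !of_qK; ring. Qed.
Lemma swap_T3 a b c : swap (T3 a b c) = T3 (swapq a) (swapq b) (swapq c).
Proof. by apply: v7_ext; rewrite !co_v7 !of_qK; ring. Qed.
Lemma torus_T3 x a b c : x != 0 -> torus x (T3 a b c) = T3 (torusq x a) (torusq x b) (torusq x c).
Proof. by move=> x0; apply: v7_ext; rewrite !co_v7 !of_qK; field. Qed.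

End Quadratics.

Section Icosahedral.
Variable C : numClosedFieldType.
Local Notation sxt := 'rV[C]_7.
Local Notation vec := 'rV[C]_3.
Implicit Types (a b c : vec) (v w : sxt) (U V : {vspace sxt}).

Definition cube a : sxt := T3 a a a.

(** The subspaces alone, without the points. On the conic the terms divisible by (x, x) drop out of
    the generators. *)
Inductive ico : {vspace sxt} -> Prop :=
| ico_nondegenerate (g : 'M[C]_3) of g *m g^T = 1%:M :
    ico <<[seq cube (a *m g) | a <- axes C]>>%VS
| ico_degenerate1 a b of a != 0 & dot a a = 0 & dot a b = 0 & dot b b != 0 :
    ico <<[:: cube b; T3 a a b; cube a]>>%VS
| ico_degenerate2 a b of a != 0 & dot a a = 0 & dot a b = 0 & dot b b != 0 :
    ico <<[:: T3 a b b; T3 a a b; cube a]>>%VS.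

Lemma apolarDl v v' w : apolar (v + v') w = apolar v w + apolar v' w.
Proof. by rewrite /apolar !coD; ring. Qed.
Lemma apolarZl k v w : apolar (k *: v) w = k * apolar v w.
Proof. by rewrite /apolar !coZ; ring. Qed.
Lemma apolarDr v w w' : apolar v (w + w') = apolar v w + apolar v w'.
Proof. by rewrite /apolar !coD; ring. Qed.
Lemma apolarZr k v w : apolar v (k *: w) = k * apolar v w.
Proof. by rewrite /apolar !coZ; ring. Qed.
Lemma apolar0 v : apolar v 0 = 0.
Proof. by rewrite /apolar !co0; ring. Qed.

Lemma apolar_span v (s : seq sxt) : (forall w, w \in s -> apolar v w = 0) ->
  forall w, w \in <<s>>%VS -> apolar v w = 0.
Proof.
elim: s => [|x s IH] h w; first by rewrite span_nil memv0 => /eqP ->; exact: apolar0.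
rewrite span_cons => /memv_addP[_ /vlineP[k ->] [y ys ->]].
rewrite apolarDr apolarZr h ?mem_head // mulr0 add0r; apply: IH => // z zs.
by apply: h; rewrite inE zs orbT.
Qed.

Lemma ortho_refl v : ortho v v.
Proof. by split; rewrite /om_e /om_h /om_f /pl; ring. Qed.

Lemma ortho_sym v w : ortho v w -> ortho w v.
Proof.
move=> [e h f]; split.
- by apply: (lincomb (k := -1) e); rewrite /om_e /pl; ring.
- by apply: (lincomb (k := -1) h); rewrite /om_h /pl; ring.
- by apply: (lincomb (k := -1) f); rewrite /om_f /pl; ring.
Qed.

Lemma ortho_spanr v (s : seq sxt) : (forall w, w \in s -> ortho v w) ->
  forall w, w \in <<s>>%VS -> ortho v w.
Proof.
elim: s => [|x s IH] h w.
  by rewrite span_nil memv0 => /eqP ->; split; rewrite /om_e /om_h /om_f /pl !co0; ring.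
rewrite span_cons => /memv_addP[_ /vlineP[k ->] [y ys ->]].
have [e1 h1 f1] := h x (mem_head _ _).
have [|e2 h2 f2] := IH _ y ys; first by move=> z zs; apply: h; rewrite inE zs orbT.
split.
- by apply: (lincomb2 (k := k) (l := 1) e1 e2); rewrite /om_e /pl !(coD, coZ); ring.
- by apply: (lincomb2 (k := k) (l := 1) h1 h2); rewrite /om_h /pl !(coD, coZ); ring.
- by apply: (lincomb2 (k := k) (l := 1) f1 f2); rewrite /om_f /pl !(coD, coZ); ring.
Qed.

Lemma ortho_span (s : seq sxt) : (forall v w, v \in s -> w \in s -> ortho v w) ->
  forall v w, v \in <<s>>%VS -> w \in <<s>>%VS -> ortho v w.
Proof.
move=> h v w vs ws; apply: ortho_spanr ws => w' w's; apply: ortho_sym.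
by apply: ortho_spanr vs => v' v's; apply: h.
Qed.

Lemma cubeZ k a : cube (k *: a) = k ^+ 3 *: cube a.
Proof. by apply: v7_ext; rewrite coZ !co_v7 !qZ; ring. Qed.

Local Notation phi := (golden C).

Lemma golden_sqr : phi ^+ 2 = phi + 1.
Proof.
have s5 : sqrtC (5 : C) ^+ 2 = 5 by rewrite sqrtCK.
by rewrite /golden; field: s5.
Qed.

Lemma golden_neq0 : phi != 0.
Proof.
apply/eqP => h; have := golden_sqr; rewrite h expr0n /= add0r => /eqP.
by rewrite eq_sym oner_eq0.
Qed.

Lemma vec3_mul (x y z : C) (g : 'M[C]_3) :
  vec3 x y z *m g = x *: row (inord 0) g + y *: row (inord 1) g + z *: row (inord 2) g.
Proof.
apply/rowP => j; rewrite !mxE !big_ord_recl big_ord0 addr0 addrA !mxE /=.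
by congr (_ * g _ _ + _ * g _ _ + _ * g _ _); apply/val_inj; rewrite /= inordK.
Qed.

Lemma dot_tr a b : dot a b = (a *m b^T) 0 0.
Proof. by rewrite mxE; apply: eq_bigr => i _; rewrite mxE. Qed.

Lemma dot_orthogonal (g : 'M[C]_3) a b : g *m g^T = 1%:M -> dot (a *m g) (b *m g) = dot a b.
Proof. by move=> gg; rewrite !dot_tr trmx_mul mulmxA -(mulmxA a) gg mulmx1. Qed.

Lemma dot_vec3 (x y z x' y' z' : C) : dot (vec3 x y z) (vec3 x' y' z') = x * x' + y * y' + z * z'.
Proof. by rewrite dot_cr !cr_vec3. Qed.

Lemma dotDr a b c : dot a (b + c) = dot a b + dot a c.
Proof. by rewrite !dot_cr !crD; ring. Qed.
Lemma dotZr k a b : dot a (k *: b) = k * dot a b.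
Proof. by rewrite !dot_cr !crZ; ring. Qed.
Lemma dotC a b : dot a b = dot b a.
Proof. by rewrite !dot_cr; ring. Qed.

Section Orthonormal.
Variable g : 'M[C]_3.
Hypothesis gg : g *m g^T = 1%:M.
Let r0 := row (inord 0) g.
Let r1 := row (inord 1) g.
Let r2 := row (inord 2) g.

Lemma dot_rows : [/\ dot r0 r0 = 1, dot r1 r1 = 1 & dot r2 r2 = 1] /\
  [/\ dot r0 r1 = 0, dot r0 r2 = 0 & dot r1 r2 = 0].
Proof.
have h i j : dot (row i g) (row j g) = (i == j)%:R.
  have := congr1 (fun A : 'M_3 => A i j) gg; rewrite !mxE => <-.
  by apply: eq_bigr => k _; rewrite !mxE.
by split; rewrite !h -!val_eqE /= !inordK.
Qed.

(* As (x, x) vanishes on the conic, the squares of the q's of an orthonormal basis add up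
   to zero. *)
Lemma sum_squares a : T3 a r0 r0 + T3 a r1 r1 + T3 a r2 r2 = 0.
Proof.
have gg' : g^T *m g = 1%:M by apply: mulmx1C.
pose A j k := cr j r0 * cr k r0 + cr j r1 * cr k r1 + cr j r2 * cr k r2.
have h j k : A j k = (inord j == inord k :> 'I_3)%:R.
  have := congr1 (fun A : 'M_3 => A (inord j) (inord k)) gg'; rewrite !mxE => <-.
  rewrite !big_ord_recl big_ord0 addr0 addrA /A /cr !mxE.
  by congr (g _ _ * g _ _ + g _ _ * g _ _ + g _ _ * g _ _); apply/val_inj; rewrite /= inordK.
have [h00 h11 h22] : [/\ A 0 0 = 1, A 1 1 = 1 & A 2 2 = 1] by rewrite !h !eqxx.
have [h01 h02 h12] : [/\ A 0 1 = 0, A 0 2 = 0 & A 1 2 = 0].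
  by rewrite !h -!val_eqE /= !inordK.
have i2 := i_sqr C.
pose s (u v : vec -> C) := u r0 * v r0 + u r1 * v r1 + u r2 * v r2.
have s00 : s (@q0 C) (@q0 C) = 0.
  have -> : s (@q0 C) (@q0 C) = A 0 0 + 2 * 'i * A 0 1 + 'i ^+ 2 * A 1 1.
    by rewrite /s /A /q0; ring.
  by rewrite h00 h01 h11 i2; ring.
have s01 : s (@q0 C) (@q1 C) = 0.
  have -> : s (@q0 C) (@q1 C) = 2 * A 0 2 + 2 * 'i * A 1 2.
    by rewrite /s /A /q0 /q1; ring.
  by rewrite h02 h12; ring.
have s02 : s (@q1 C) (@q1 C) + 2 * s (@q0 C) (@q2 C) = 0.
  have -> : s (@q1 C) (@q1 C) + 2 * s (@q0 C) (@q2 C) = 4 * A 2 2 - 2 * A 0 0 + 2 * 'i ^+ 2 * A 1 1.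
    by rewrite /s /A /q0 /q1 /q2; ring.
  by rewrite h00 h11 h22 i2; ring.
have s12 : s (@q1 C) (@q2 C) = 0.
  have -> : s (@q1 C) (@q2 C) = - 2 * A 0 2 + 2 * 'i * A 1 2.
    by rewrite /s /A /q1 /q2; ring.
  by rewrite h02 h12; ring.
have s22 : s (@q2 C) (@q2 C) = 0.
  have -> : s (@q2 C) (@q2 C) = A 0 0 - 2 * 'i * A 0 1 + 'i ^+ 2 * A 1 1.
    by rewrite /s /A /q2; ring.
  by rewrite h00 h01 h11 i2; ring.
pose t1 := 2 * s (@q0 C) (@q1 C); pose t2 := s (@q1 C) (@q1 C) + 2 * s (@q0 C) (@q2 C).
pose t3 := 2 * s (@q1 C) (@q2 C).
have -> : T3 a r0 r0 + T3 a r1 r1 + T3 a r2 r2 =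
  v7 (q0 a * s (@q0 C) (@q0 C)) (q1 a * s (@q0 C) (@q0 C) + q0 a * t1)
     (q2 a * s (@q0 C) (@q0 C) + q1 a * t1 + q0 a * t2)
     (q2 a * t1 + q1 a * t2 + q0 a * t3)
     (q2 a * t2 + q1 a * t3 + q0 a * s (@q2 C) (@q2 C))
     (q2 a * t3 + q1 a * s (@q2 C) (@q2 C)) (q2 a * s (@q2 C) (@q2 C)).
  by apply: v7_ext; rewrite !coD !co_v7 /t1 /t2 /t3 /s; ring.
by rewrite /t1 /t2 /t3 s00 s01 s02 s12 s22; apply: v7_ext; rewrite co_v7 co0; ring.
Qed.

(* The six cubes are the combinations - phi^2 h_i +- phi h_j with (i, j) = (1, 2), (2, 0), (0, 1). *)
Let half a c := 3 *: T3 a c c + (phi + 1) *: cube a.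
Let h0 := half r0 r2.
Let h1 := half r1 r0.
Let h2 := half r2 r1.

Lemma cube_halves a b c p : T3 b a a + cube b + T3 b c c = 0 -> p ^+ 2 = phi + 1 ->
  cube (b + p *: c) = - (phi + 1) *: half b a + p *: half c b.
Proof.
move=> s0 p2; have p3 := golden_sqr.
transitivity (- (phi + 1) *: half b a + p *: half c b + (3 * (phi + 1)) *: (T3 b a a + cube b + T3 b c c)).
  by apply: v7_ext; rewrite !(coD, coZ) !co_v7 !(qD, qZ); ring: p2 p3.
by rewrite s0 scaler0 addr0.
Qed.

Lemma cubes_axes : [seq cube (a *m g) | a <- axes C] =
  [:: - (phi + 1) *: h1 + phi *: h2; - (phi + 1) *: h2 + phi *: h0; - (phi + 1) *: h0 + phi *: h1;
      - (phi + 1) *: h1 - phi *: h2; - (phi + 1) *: h2 - phi *: h0; - (phi + 1) *: h0 - phi *: h1].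
Proof.
have p2 := golden_sqr; have np2 : (- phi) ^+ 2 = phi + 1 by rewrite sqrrN.
have S0 : T3 r0 r2 r2 + cube r0 + T3 r0 r1 r1 = 0.
  by rewrite -[RHS](sum_squares r0) -addrA addrC.
have S1 : T3 r1 r0 r0 + cube r1 + T3 r1 r2 r2 = 0 := sum_squares r1.
have S2 : T3 r2 r1 r1 + cube r2 + T3 r2 r0 r0 = 0.
  by rewrite -[RHS](sum_squares r2) addrC addrA.
rewrite /axes /= !vec3_mul -/r0 -/r1 -/r2 !scale0r !scale1r !add0r !addr0.
rewrite (addrC (phi *: r0)) (addrC (- phi *: r0)).
by rewrite !(cube_halves S0 p2, cube_halves S1 p2, cube_halves S2 p2,
  cube_halves S0 np2, cube_halves S1 np2, cube_halves S2 np2) !(scaleNr phi).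
Qed.

Lemma span_cubes : <<[seq cube (a *m g) | a <- axes C]>>%VS = <<[:: h0; h1; h2]>>%VS.
Proof.
rewrite cubes_axes; have p0 := golden_neq0; move: h0 h1 h2 => x0 x1 x2.
have half_diff (s : seq sxt) x y (U := <<s>>%VS) :
    - (phi + 1) *: x + phi *: y \in s -> - (phi + 1) *: x - phi *: y \in s -> y \in U.
  move=> s1 s2; have -> : y = (2 * phi)^-1 *: ((- (phi + 1) *: x + phi *: y) - (- (phi + 1) *: x - phi *: y)).
    by apply: v7_ext; rewrite !(coD, coN, coZ); field.
  by rewrite rpredZ // rpredB // memv_span.
apply/eqP; rewrite eqEsubv; apply/andP; split; apply/span_subvP => v.
- rewrite !inE => /or4P[||| /or3P[]] /eqP ->.
  + by apply/span3P; exists 0, (- (phi + 1)), phi; apply: v7_ext; rewrite !(coD, coN, coZ); ring.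
  + by apply/span3P; exists phi, 0, (- (phi + 1)); apply: v7_ext; rewrite !(coD, coN, coZ); ring.
  + by apply/span3P; exists (- (phi + 1)), phi, 0; apply: v7_ext; rewrite !(coD, coN, coZ); ring.
  + by apply/span3P; exists 0, (- (phi + 1)), (- phi); apply: v7_ext; rewrite !(coD, coN, coZ); ring.
  + by apply/span3P; exists (- phi), 0, (- (phi + 1)); apply: v7_ext; rewrite !(coD, coN, coZ); ring.
  + by apply/span3P; exists (- (phi + 1)), (- phi), 0; apply: v7_ext; rewrite !(coD, coN, coZ); ring.
- rewrite !inE => /or3P[] /eqP ->.
  + by apply: (half_diff _ x2); rewrite !inE eqxx ?orbT.
  + by apply: (half_diff _ x0); rewrite !inE eqxx ?orbT.
  + by apply: (half_diff _ x1); rewrite !inE eqxx ?orbT.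
Qed.

(** The three vectors are pairwise apolar, with [apolar] equal to -960 on the diagonal, so pairing
    reads off the coefficients. *)
Lemma indep_halves : indep3 h0 h1 h2.
Proof.
have [[d00 d11 d22] [d01 d02 d12]] := dot_rows.
have d10 : dot r1 r0 = 0 by rewrite dotC.
have d20 : dot r2 r0 = 0 by rewrite dotC.
have d21 : dot r2 r1 = 0 by rewrite dotC.
have p2 := golden_sqr.
have key (x y z : C) : [/\ apolar h0 (x *: h0 + y *: h1 + z *: h2) = - 960 * x,
   apolar h1 (x *: h0 + y *: h1 + z *: h2) = - 960 * y &
   apolar h2 (x *: h0 + y *: h1 + z *: h2) = - 960 * z].
  rewrite /h0 /h1 /h2 /half /cube !(apolarDl, apolarZl, apolarDr, apolarZr) !apolar_T3.
  rewrite ?d00 ?d11 ?d22 ?d01 ?d02 ?d12 ?d10 ?d20 ?d21.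
  by split; ring: p2.
move=> x y z e; have [k0 k1 k2] := key x y z.
rewrite e !apolar0 in k0 k1 k2.
by split; apply: (@mulfI0 C 959); [rewrite -[RHS]oppr0 [in RHS]k0|rewrite -[RHS]oppr0 [in RHS]k1|
  rewrite -[RHS]oppr0 [in RHS]k2]; ring.
Qed.

Lemma iso_nondegenerate : isotropic <<[seq cube (a *m g) | a <- axes C]>>%VS.
Proof.
split; first by rewrite span_cubes dim_span3 //; exact: indep_halves.
apply: ortho_span => _ _ /mapP[a aa ->] /mapP[b ab ->].
have [->|ne] := eqVneq a b; first exact: ortho_refl.
apply: ortho_T3; rewrite !dot_orthogonal //; have p2 := golden_sqr.
move: aa ab ne; rewrite !inE => /or4P[||| /or3P[]] /eqP -> /or4P[||| /or3P[]] /eqP ->;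
  rewrite ?eqxx // !dot_vec3 => _; ring: p2.
Qed.

(** Four elements apolar to the span give cubic equations for c, whose only nonzero solutions are
    the multiples of the six axes. *)
Lemma nondegenerate_axis c : c != 0 ->
  cube c \in <<[seq cube (a *m g) | a <- axes C]>>%VS ->
  exists2 a, a \in axes C & exists2 k, k != 0 & c = k *: (a *m g).
Proof.
move=> cn cU; have p2 := golden_sqr; have p0 := golden_neq0.
have [[d00 d11 d22] [d01 d02 d12]] := dot_rows.
have d10 : dot r1 r0 = 0 by rewrite dotC.
have d20 : dot r2 r0 = 0 by rewrite dotC.
have d21 : dot r2 r1 = 0 by rewrite dotC.
pose X := dot r0 c; pose Y := dot r1 c; pose Z := dot r2 c.
have cE : c = vec3 X Y Z *m g.
  have gg' : g^T *m g = 1%:M by apply: mulmx1C.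
  rewrite -[LHS](mulmx1 c) -gg' mulmxA; congr (_ *m _).
  apply: cr_ext; rewrite !cr_vec3 /cr /X /Y /Z /dot !mxE;
    by apply: eq_bigr => i _; rewrite !mxE mulrC.
have all_axes F : (forall a, a \in axes C -> apolar F (cube (a *m g)) = 0) ->
    apolar F (cube c) = 0.
  by move=> FU; apply: apolar_span cU => _ /mapP[a aa ->]; exact: FU.
have dots x y z : [/\ dot r0 (vec3 x y z *m g) = x, dot r1 (vec3 x y z *m g) = y &
    dot r2 (vec3 x y z *m g) = z].
  rewrite vec3_mul -/r0 -/r1 -/r2 !(dotDr, dotZr) d00 d11 d22 d01 d02 d12 d10 d20 d21.
  by split; ring.
have dX x y z : dot r0 (vec3 x y z *m g) = x by case: (dots x y z).
have dY x y z : dot r1 (vec3 x y z *m g) = y by case: (dots x y z).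
have dZ x y z : dot r2 (vec3 x y z *m g) = z by case: (dots x y z).
(* In the orthonormal coordinates X, Y, Z these are the harmonic cubics through the six axes: XYZ
   and the cyclic images of X (X^2 - (2 - phi) Y^2 - (phi + 1) Z^2). *)
pose F0 := T3 r0 r1 r2.
pose G a b b' := T3 a a a - (2 - phi) *: T3 a b b - (phi + 1) *: T3 a b' b'.
have apN v w : apolar (- v) w = - apolar v w by rewrite /apolar !coN; ring.
have F0E x : apolar F0 (cube x) = - 480 * (dot r0 x * dot r1 x * dot r2 x).
  by rewrite /F0 /cube apolar_T3 d01 d02 d12; ring.
have GE a b b' x : dot a a = 1 -> dot b b = 1 -> dot b' b' = 1 -> dot a b = 0 -> dot a b' = 0 ->
    apolar (G a b b') (cube x) = - 480 * (dot a x * (dot a x ^+ 2 - (2 - phi) * dot b x ^+ 2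
      - (phi + 1) * dot b' x ^+ 2)).
  move=> aa bb bb' ab ab'.
  rewrite /G /cube !(apolarDl, apN, apolarZl) !apolar_T3 aa bb bb' ab ab'; ring.
have XYZ : X * Y * Z = 0.
  apply: (@mulfI0 C 479); rewrite -[RHS]oppr0 -[in RHS](all_axes F0); first by rewrite F0E -/X -/Y -/Z; ring.
  by move=> a; rewrite !inE => /or4P[||| /or3P[]] /eqP ->; rewrite F0E;
    rewrite dX dY dZ; ring.
have eX : X * (X ^+ 2 - (2 - phi) * Y ^+ 2 - (phi + 1) * Z ^+ 2) = 0.
  apply: (@mulfI0 C 479); rewrite -[RHS]oppr0 -[in RHS](all_axes (G r0 r1 r2)).
    by rewrite GE // -/X -/Y -/Z; ring.
  by move=> a; rewrite !inE => /or4P[||| /or3P[]] /eqP ->; rewrite GE //;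
    rewrite dX dY dZ; ring: p2.
have eY : Y * (Y ^+ 2 - (2 - phi) * Z ^+ 2 - (phi + 1) * X ^+ 2) = 0.
  apply: (@mulfI0 C 479); rewrite -[RHS]oppr0 -[in RHS](all_axes (G r1 r2 r0)).
    by rewrite GE // -/X -/Y -/Z; ring.
  by move=> a; rewrite !inE => /or4P[||| /or3P[]] /eqP ->; rewrite GE //;
    rewrite dX dY dZ; ring: p2.
have eZ : Z * (Z ^+ 2 - (2 - phi) * X ^+ 2 - (phi + 1) * Y ^+ 2) = 0.
  apply: (@mulfI0 C 479); rewrite -[RHS]oppr0 -[in RHS](all_axes (G r2 r0 r1)).
    by rewrite GE // -/X -/Y -/Z; ring.
  by move=> a; rewrite !inE => /or4P[||| /or3P[]] /eqP ->; rewrite GE //;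
    rewrite dX dY dZ; ring: p2.
have key (x y : C) : x * (x ^+ 2 - (2 - phi) * y ^+ 2) = 0 -> y * (y ^+ 2 - (phi + 1) * x ^+ 2) = 0 ->
    ~ (x = 0 /\ y = 0) -> x != 0 /\ (y = phi * x \/ y = - phi * x).
  move=> ex ey nz; have x0 : x != 0.
    apply/eqP => x0; apply: nz; split=> //; move/eqP: ey; rewrite x0 expr0n /= mulr0 subr0.
    by rewrite mulf_eq0 expf_eq0 orbb => /eqP.
  split=> //; have y0 : y != 0.
    apply/eqP => y0; move/eqP: ex; rewrite y0 expr0n /= mulr0 subr0.
    by rewrite mulf_eq0 expf_eq0 orbb (negPf x0).
  have /eqP : y * ((y - phi * x) * (y + phi * x)) = 0 by rewrite -[RHS]ey; ring: p2.
  rewrite mulf_eq0 (negPf y0) /= mulf_eq0 subr_eq0 addr_eq0 -mulNr.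
  by move=> /orP[/eqP|/eqP]; [left|right].
have nz : ~ [/\ X = 0, Y = 0 & Z = 0].
  move=> [x0 y0 z0]; move/eqP: cn; apply; by rewrite cE x0 y0 z0 vec3_mul !scale0r !addr0.
have fin (x y z k x' y' z' : C) : k != 0 -> vec3 x y z \in axes C -> X = k * x -> Y = k * y -> Z = k * z ->
    exists2 a, a \in axes C & exists2 k, k != 0 & c = k *: (a *m g).
  move=> k0 aa ex ey ez; exists (vec3 x y z) => //; exists k => //.
  rewrite [LHS]cE scalemxAl; congr (_ *m _).
  by apply: cr_ext; rewrite crZ !cr_vec3.
move/eqP: XYZ; rewrite !mulf_eq0 -orbA => /or3P[] /eqP h; rewrite h in eX eY eZ.
- have [||| Y0 [eZY|eZY]] := key Y Z.
  + by rewrite -[RHS]eY; ring.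
  + by rewrite -[RHS]eZ; ring.
  + by case=> y0 z0; apply: nz.
  + by apply: (fin 0 1 phi Y); rewrite ?inE ?eqxx ?orbT // ?h ?eZY; ring.
  + by apply: (fin 0 1 (- phi) Y); rewrite ?inE ?eqxx ?orbT // ?h ?eZY; ring.
- have [||| Z0 [eXZ|eXZ]] := key Z X.
  + by rewrite -[RHS]eZ; ring.
  + by rewrite -[RHS]eX; ring.
  + by case=> z0 x0; apply: nz.
  + by apply: (fin phi 0 1 Z); rewrite ?inE ?eqxx ?orbT // ?h ?eXZ; ring.
  + by apply: (fin (- phi) 0 1 Z); rewrite ?inE ?eqxx ?orbT // ?h ?eXZ; ring.
- have [||| X0 [eYX|eYX]] := key X Y.
  + by rewrite -[RHS]eX; ring.
  + by rewrite -[RHS]eY; ring.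
  + by case=> x0 y0; apply: nz.
  + by apply: (fin 1 phi 0 X); rewrite ?inE ?eqxx ?orbT // ?h ?eYX; ring.
  + by apply: (fin 1 (- phi) 0 X); rewrite ?inE ?eqxx ?orbT // ?h ?eYX; ring.
Qed.

End Orthonormal.

Lemma axis_nonnull (g : 'M[C]_3) a : g *m g^T = 1%:M -> a \in axes C -> dot (a *m g) (a *m g) != 0.
Proof.
move=> gg aa; rewrite dot_orthogonal //.
have -> : dot a a = phi + 2.
  by have p2 := golden_sqr; move: aa; rewrite !inE => /or4P[||| /or3P[]] /eqP ->; rewrite dot_vec3; ring: p2.
apply/eqP => h; have p2 := golden_sqr; have e : phi = - 2 by apply/eqP; rewrite -addr_eq0 h.
have : (5 : C) == 0 by rewrite -(subr_eq0 _ 0) subr0 -(subrr (phi ^+ 2)) {2}p2 e; apply/eqP; ring.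
by rewrite pnatr_eq0.
Qed.

End Icosahedral.

(** * Degenerate sets, and the identification of isotropic with icosahedral spaces *)

Section Degenerate.
Variable C : numClosedFieldType.
Local Notation sxt := 'rV[C]_7.
Local Notation vec := 'rV[C]_3.
Implicit Types (a b c : vec) (v w : sxt) (U V : {vspace sxt}).

(** Up to a factor, (a, a) is the discriminant of the restriction of (x, a) to the conic, which is
    therefore the square of l z_1 + m z_2. *)
Lemma null_square a : a != 0 -> dot a a = 0 -> exists l m : C,
  [/\ ~ (l = 0 /\ m = 0), q0 a = l ^+ 2, q1 a = 2 * l * m & q2 a = m ^+ 2].
Proof.
move=> an aa; have {}aa : q1 a ^+ 2 = 4 * q0 a * q2 a.
  by apply: (lincomb (k := 4) aa); rewrite dot_q; field.
have [a0|a0] := eqVneq (q0 a) 0.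
  have a1 : q1 a = 0 by apply/eqP; rewrite -[_ == 0](expf_eq0 (q1 a) 2) aa a0 mulr0 mul0r.
  exists 0, (sqrtC (q2 a)); rewrite a0 a1; split; [|by rewrite expr0n|by ring|by rewrite sqrtCK].
  case=> _ /eqP; rewrite sqrtC_eq0 => /eqP a2; move/eqP: an; apply.
  by apply: q_ext; rewrite ?a0 ?a1 ?a2 /q0 /q1 /q2 !cr0; ring.
have l0 : sqrtC (q0 a) != 0 by rewrite sqrtC_eq0.
exists (sqrtC (q0 a)), (q1 a / (2 * sqrtC (q0 a))); split; rewrite ?sqrtCK //.
- by case=> l00; rewrite l00 eqxx in l0.
- by field; rewrite l0.
- by rewrite expr_div_n aa exprMn sqrtCK; field.
Qed.

(** For null a, the condition (a, b) = 0 says that the quadratic of b vanishes at the root of l z_1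
    + m z_2; the cofactor is p z_1 + r z_2. *)
Lemma orthogonal_factor a b (l m : C) : ~ (l = 0 /\ m = 0) ->
  q0 a = l ^+ 2 -> q1 a = 2 * l * m -> q2 a = m ^+ 2 -> dot a b = 0 ->
  exists p r, [/\ q0 b = l * p, q1 b = l * r + m * p & q2 b = m * r].
Proof.
move=> lm a0 a1 a2; rewrite dot_q a0 a1 a2 => ab.
have {}ab : q0 b * m ^+ 2 - q1 b * l * m + q2 b * l ^+ 2 = 0.
  by apply: (lincomb (k := -2) ab); field.
have [l0|l0] := eqVneq l 0.
  have m0 : m != 0 by apply/eqP => m0; apply: lm.
  have b0 : q0 b = 0.
    apply: (mulIf (expf_neq0 2 m0)); apply: (lincomb (k := 1) ab); rewrite l0; ring.
  by exists (q1 b / m), (q2 b / m); rewrite b0 l0; split; field.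
exists (q0 b / l), ((q1 b - m * (q0 b / l)) / l); split; [by field|by field|].
by apply: (lincomb (k := l ^- 2) ab); field.
Qed.

Section Pair.
Variables a b : vec.
Hypotheses (an : a != 0) (aa : dot a a = 0) (ab : dot a b = 0) (bb : dot b b != 0).

Lemma ortho_degenerate : [/\ ortho (cube b) (T3 a a b), ortho (cube b) (cube a),
  ortho (T3 a a b) (cube a), ortho (T3 a b b) (T3 a a b) & ortho (T3 a b b) (cube a)].
Proof.
have [l [m [lm a0 a1 a2]]] := null_square an aa.
have [p [r [h0 h1 h2]]] := orthogonal_factor lm a0 a1 a2 ab.
by split; split; rewrite /om_e /om_h /om_f /pl !co_v7 a0 a1 a2 h0 h1 h2; ring.
Qed.

(** The vector with quadratic (p z_1 + r z_2)^2, where p z_1 + r z_2 is the second factor of the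
    quadratic of b. *)
Lemma third_vector : exists c, [/\ dot c c = 0, dot c b = 0 & dot c a != 0].
Proof.
have [l [m [lm a0 a1 a2]]] := null_square an aa.
have [p [r [h0 h1 h2]]] := orthogonal_factor lm a0 a1 a2 ab.
have bE : dot b b = (l * r - m * p) ^+ 2 / 4 by rewrite dot_q h0 h1 h2; field.
exists (of_q (p ^+ 2) (2 * p * r) (r ^+ 2)); rewrite !dot_q !of_qK a0 a1 a2 h0 h1 h2; split.
- by field.
- by field.
- have -> : 2 * p * r * (2 * l * m) / 4 - (p ^+ 2 * m ^+ 2 + r ^+ 2 * l ^+ 2) / 2 =
    - 2 * dot b b by rewrite bE; field.
  by rewrite mulf_neq0 // oppr_eq0 pnatr_eq0.
Qed.

(** With c the opposite null vector, pairing with the sextics of c^3, c^2 b, c b^2 and b^3 isolates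
    the four coefficients. *)
Lemma indep_degenerate (x y z w : C) :
  x *: cube a + y *: T3 a a b + z *: T3 a b b + w *: cube b = 0 ->
  [/\ x = 0, y = 0, z = 0 & w = 0].
Proof.
have [c [cc cb ca]] := third_vector.
have ba : dot b a = 0 by rewrite dotC.
have bc : dot b c = 0 by rewrite dotC.
set v := (X in X = 0) => v0.
have E s : apolar s v = 0 by rewrite v0 apolar0.
have E0 := E (cube c); have E1 := E (T3 c c b); have E2 := E (T3 c b b); have E3 := E (cube b).
rewrite /v !(apolarDr, apolarZr) !apolar_T3 ?cc ?cb ?aa ?ab ?ba ?bc in E0 E1 E2 E3.
split.
- by apply: (mulIf (expf_neq0 3 ca)); apply: (lincomb (k := - 480^-1) E0); field.
- apply: (mulIf (mulf_neq0 bb (expf_neq0 2 ca))); apply: (lincomb (k := - 160^-1) E1); by field.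
- apply: (mulIf (mulf_neq0 ca (expf_neq0 2 bb))); apply: (lincomb (k := - 128^-1) E2); by field.
- by apply: (mulIf (expf_neq0 3 bb)); apply: (lincomb (k := - 192^-1) E3); field.
Qed.

Lemma iso_degenerate1 : isotropic <<[:: cube b; T3 a a b; cube a]>>%VS.
Proof.
have [o1 o2 o3 _ _] := ortho_degenerate; apply: iso_span3 => // x y z e.
have [|-> -> _ ->] := @indep_degenerate z y 0 x; last by [].
by rewrite -[RHS]e scale0r addr0 addrC [z *: _ + _]addrC addrA.
Qed.

Lemma iso_degenerate2 : isotropic <<[:: T3 a b b; T3 a a b; cube a]>>%VS.
Proof.
have [_ _ o3 o4 o5] := ortho_degenerate; apply: iso_span3 => // x y z e.
have [|-> -> -> _] := @indep_degenerate z y x 0; last by [].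
by rewrite -[RHS]e scale0r addr0 addrC [z *: _ + _]addrC addrA.
Qed.

Lemma orthogonal_combination c : dot a c = 0 -> exists x y, c = x *: a + y *: b.
Proof.
move=> ac; have [l [m [lm a0 a1 a2]]] := null_square an aa.
have [p [r [h0 h1 h2]]] := orthogonal_factor lm a0 a1 a2 ab.
have [p' [r' [c0 c1 c2]]] := orthogonal_factor lm a0 a1 a2 ac.
have det : l * r - m * p != 0.
  have bE : dot b b = (l * r - m * p) ^+ 2 / 4 by rewrite dot_q h0 h1 h2; field.
  by apply: contraNneq bb => d0; rewrite bE d0 expr0n /= mul0r.
exists ((p' * r - r' * p) / (l * r - m * p)), ((l * r' - m * p') / (l * r - m * p)).
by apply: q_ext; rewrite !(qD, qZ) ?a0 ?a1 ?a2 ?h0 ?h1 ?h2 ?c0 ?c1 ?c2; field.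
Qed.

(** The cube of a null a pairs with the cube of c to -480 (a, c)^3. *)
Lemma orthogonal_of_axis c U : (forall w, w \in U -> apolar (cube a) w = 0) -> cube c \in U ->
  exists x y, c = x *: a + y *: b.
Proof.
move=> Ua cU; apply: orthogonal_combination.
apply/eqP; rewrite -[_ == 0](expf_eq0 (dot a c) 3); apply/eqP.
have := Ua _ cU; rewrite apolar_T3 aa => h.
by apply: (lincomb (k := - 480^-1) h); field.
Qed.

Lemma cube_combination x y : cube (x *: a + y *: b) =
  x ^+ 3 *: cube a + (3 * x ^+ 2 * y) *: T3 a a b + (3 * x * y ^+ 2) *: T3 a b b + y ^+ 3 *: cube b.
Proof. by apply: v7_ext; rewrite !(coD, coZ) !co_v7 !(qD, qZ); ring. Qed.

Lemma apolar_null_axis : [/\ apolar (cube a) (cube a) = 0, apolar (cube a) (T3 a a b) = 0,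
  apolar (cube a) (T3 a b b) = 0 & apolar (cube a) (cube b) = 0].
Proof.
have ba : dot b a = 0 by rewrite dotC.
by rewrite !apolar_T3 aa ab; split; ring.
Qed.

(** Here c = x a + y b, and the cube of c has coefficient 3 x y^2 at [T3 a b b], which is
    independent of the space. *)
Lemma degenerate1_axis c : c != 0 -> cube c \in <<[:: cube b; T3 a a b; cube a]>>%VS ->
  (exists2 k, k != 0 & c = k *: a) \/ (exists2 k, k != 0 & c = k *: b).
Proof.
move=> cn cU; have [oa oab _ ob] := apolar_null_axis.
have [x [y cE]] := orthogonal_of_axis (apolar_span3 ob oab oa) cU.
move/span3P: cU => [p [q [r]]]; rewrite cE cube_combination => e.
have [|_ _ /eqP xy _] := @indep_degenerate (x ^+ 3 - r) (3 * x ^+ 2 * y - q) (3 * x * y ^+ 2) (y ^+ 3 - p).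
  rewrite -(subrr (p *: cube b + q *: T3 a a b + r *: cube a)) -{1}e.
  by apply: v7_ext; rewrite !(coD, coN, coZ); ring.
move: xy; rewrite 2!mulf_eq0 expf_eq0 pnatr_eq0 /= => /orP[] /eqP e0; [right; exists y|left; exists x].
- by apply: contraNneq cn => y0; rewrite cE e0 y0 !scale0r addr0.
- by rewrite e0 scale0r add0r.
- by apply: contraNneq cn => x0; rewrite cE e0 x0 !scale0r addr0.
- by rewrite e0 scale0r addr0.
Qed.

Lemma degenerate2_axis c : c != 0 -> cube c \in <<[:: T3 a b b; T3 a a b; cube a]>>%VS ->
  exists2 k, k != 0 & c = k *: a.
Proof.
move=> cn cU; have [oa oab oabb _] := apolar_null_axis.
have [x [y cE]] := orthogonal_of_axis (apolar_span3 oabb oab oa) cU.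
move/span3P: cU => [p [q [r]]]; rewrite cE cube_combination => e.
have [|_ _ _ /eqP] := @indep_degenerate (x ^+ 3 - r) (3 * x ^+ 2 * y - q) (3 * x * y ^+ 2 - p) (y ^+ 3).
  rewrite -(subrr (p *: T3 a b b + q *: T3 a a b + r *: cube a)) -{1}e.
  by apply: v7_ext; rewrite !(coD, coN, coZ); ring.
rewrite expf_eq0 /= => /eqP y0; exists x; last by rewrite y0 scale0r addr0.
by apply: contraNneq cn => x0; rewrite cE y0 x0 !scale0r addr0.
Qed.

End Pair.

Lemma ico_iso U : ico U -> isotropic U.
Proof.
by case=> *; [exact: iso_nondegenerate|exact: iso_degenerate1|exact: iso_degenerate2].
Qed.

Section Action.
Variables (T T' : {linear sxt -> sxt}) (f f' : {linear vec -> vec}).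
Hypotheses (TK : cancel T T') (T'K : cancel T' T).
Hypotheses (TT3 : forall a b c, T (T3 a b c) = T3 (f a) (f b) (f c))
  (T'T3 : forall a b c, T' (T3 a b c) = T3 (f' a) (f' b) (f' c)).
Hypotheses (f_dot : forall a b, dot (f a) (f b) = dot a b) (f'_dot : forall a b, dot (f' a) (f' b) = dot a b).

Lemma dot_preserving_neq0 (h : {linear vec -> vec}) a :
  (forall a b, dot (h a) (h b) = dot a b) -> a != 0 -> h a != 0.
Proof.
move=> h_dot; have [G GG GE] := orthogonal_matrix h_dot; apply: contraNneq => ha0.
by rewrite -[a]mulmx1 -GG mulmxA GE ha0 mul0mx.
Qed.

Lemma ico_image_by U : ico U -> ico (image_by T U).
Proof.
have [G GG GE] := orthogonal_matrix f_dot.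
case=> [g gg|a b an aa ab bb|a b an aa ab bb].
- rewrite /image_by limg_span -map_comp.
  have -> : [seq (linfun T \o (fun a => cube (a *m g))) a | a <- axes C] =
      [seq cube (a *m (g *m G)) | a <- axes C].
    by apply: eq_map => a; rewrite /= lfunE /= TT3 -!GE mulmxA.
  by apply: ico_nondegenerate; rewrite trmx_mul mulmxA -(mulmxA g) GG mulmx1.
- rewrite image_by_span3 !TT3; apply: ico_degenerate1; rewrite ?f_dot //.
  exact: dot_preserving_neq0.
- rewrite image_by_span3 !TT3; apply: ico_degenerate2; rewrite ?f_dot //.
  exact: dot_preserving_neq0.
Qed.

(** This separates the degenerate spaces from those of icosahedra, whose axes are not null. *)
Definition has_null U := exists a, [/\ a != 0, dot a a = 0 & cube a \in U].

Lemma has_null_image_by U : has_null (image_by T U) -> has_null U.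
Proof.
move=> [a [an aa]]; rewrite (mem_image_by TK T'K) T'T3 => aU.
by exists (f' a); rewrite f'_dot dot_preserving_neq0.
Qed.

End Action.

Lemma ico_shift s U : ico U -> ico (image_by (@shift C s) U).
Proof. exact: (ico_image_by (@shift_T3 C s) (@dot_shiftq C s)). Qed.
Lemma ico_swap U : ico U -> ico (image_by (@swap C) U).
Proof. exact: (ico_image_by (@swap_T3 C) (@dot_swapq C)). Qed.
Lemma ico_torus r U : r != 0 -> ico U -> ico (image_by (torus r) U).
Proof.
move=> r0; apply: (@ico_image_by (torus r) (torusq r)) => [a b c|a b]; first exact: torus_T3.
exact: dot_torusq.
Qed.

Lemma equiv_ico U V : equiv U V -> (ico U -> ico V) /\ (ico V -> ico U).
Proof.
elim=> {U V} [U //|s U V _ [h1 h2]|U V _ [h1 h2]|r U V r0 _ [h1 h2]].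
- split=> [/(ico_shift s)/h1 //|/h2/(ico_shift (- s))].
  by rewrite (image_byK (shiftK s) (shiftNK s)).
- split=> [/ico_swap/h1 //|/h2/ico_swap].
  by rewrite (image_byK (@swapK C) (@swapK C)).
- split=> [/(ico_torus r0)/h1 //|/h2].
  have r'0 : r^-1 != 0 by rewrite invr_eq0.
  by move=> /(ico_torus r'0); rewrite (image_byK (torusK r0) (torusVK r0)).
Qed.

Lemma equiv_has_null U V : equiv U V -> has_null V -> has_null U.
Proof.
elim=> {U V} [U //|s U V _ IH|U V _ IH|r U V r0 _ IH] /IH.
- exact: (has_null_image_by (shiftK s) (shiftNK s) (@shift_T3 C (- s)) (@dot_shiftq C (- s))).
- exact: (has_null_image_by (@swapK C) (@swapK C) (@swap_T3 C) (@dot_swapq C)).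
- have r'0 : r^-1 != 0 by rewrite invr_eq0.
  apply: (@has_null_image_by (torus r) (torus r^-1) (torusq r^-1) (torusK r0) (torusVK r0)).
    by move=> a b c; exact: torus_T3.
  by move=> a b; exact: dot_torusq.
Qed.

(** Vectors whose linear forms restrict to z_1^2, z_1 z_2 and z_2^2. *)
Let x2 : vec := of_q 1 0 0.
Let xy : vec := of_q 0 1 0.
Let y2 : vec := of_q 0 0 1.

Lemma of_q_neq0 (x y z : C) : [|| x != 0, y != 0 | z != 0] -> of_q x y z != 0.
Proof.
apply: contraTneq => e.
have := of_qK x y z; rewrite e /q0 /q1 /q2 !cr0 !(mulr0, oppr0, addr0) => -[[<- <-] <-].
by rewrite eqxx.
Qed.

Lemma normal1_degenerate : normal1 C = <<[:: cube xy; T3 y2 y2 xy; cube y2]>>%VS.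
Proof. by congr <<[:: _; _; _]>>%VS; apply: v7_ext; rewrite !co_v7 !of_qK; ring. Qed.

Lemma normal2_degenerate : normal2 C = <<[:: T3 y2 xy xy; T3 y2 y2 xy; cube y2]>>%VS.
Proof. by congr <<[:: _; _; _]>>%VS; apply: v7_ext; rewrite !co_v7 !of_qK; ring. Qed.

Lemma normal3_degenerate : normal3 (0 : C) = <<[:: cube xy; cube x2; T3 x2 x2 xy]>>%VS.
Proof. by congr <<[:: _; _; _]>>%VS; apply: v7_ext; rewrite !co_v7 !of_qK; field. Qed.

Lemma y2_facts : [/\ y2 != 0, dot y2 y2 = 0, dot y2 xy = 0 & dot xy xy != 0].
Proof.
split; rewrite ?of_q_neq0 ?oner_neq0 ?orbT // dot_q !of_qK; try by ring.
have -> : 1 * 1 / 4 - (0 * 0 + 0 * 0) / 2 = (4^-1 : C) by field.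
by rewrite invr_eq0 pnatr_eq0.
Qed.

Lemma x2_facts : [/\ x2 != 0, dot x2 x2 = 0 & dot x2 xy = 0].
Proof. split; rewrite ?of_q_neq0 ?oner_neq0 ?orbT // dot_q !of_qK; by ring. Qed.

Lemma has_null_normal V : normal V -> has_null V \/ exists2 t, t != 0 & V = normal3 t.
Proof.
have [y2n yy yx xx] := y2_facts; have [x2n xx0 xxy] := x2_facts.
case=> [->|->|[t ->]].
- by left; exists y2; split=> //; rewrite normal1_degenerate memv_span // !inE eqxx ?orbT.
- by left; exists y2; split=> //; rewrite normal2_degenerate memv_span // !inE eqxx ?orbT.
have [->|t0] := eqVneq t 0; last by right; exists t.
by left; exists x2; split=> //; rewrite normal3_degenerate memv_span // !inE eqxx ?orbT.
Qed.

(** Coordinates 0 and 5 have weights 6 and -4, coordinates 1 and 6 have weights 4 and -6, so t is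
    multiplied by r^-10 in both generators. *)
Lemma torus_normal3 (r t : C) : r != 0 -> image_by (torus r) (normal3 t) = normal3 (r ^- 10 * t).
Proof.
move=> r0; rewrite /normal3 image_by_span3 /=.
have r60 : r ^+ 6 != 0 by rewrite expf_neq0.
have r40 : r ^+ 4 != 0 by rewrite expf_neq0.
have e0 : torus r (v7 0 0 0 1 0 0 0) = v7 0 0 0 1 0 0 0.
  by apply: v7_ext; rewrite !co_v7; ring.
have e1 : torus r (v7 1 0 0 0 0 t 0) = r ^+ 6 *: v7 1 0 0 0 0 (r ^- 10 * t) 0.
  by apply: v7_ext; rewrite coZ !co_v7; field.
have e2 : torus r (v7 0 1 0 0 0 0 (- t / 9)) = r ^+ 4 *: v7 0 1 0 0 0 0 (- (r ^- 10 * t) / 9).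
  by apply: v7_ext; rewrite coZ !co_v7; field.
rewrite ?e0 ?e1 ?e2; apply/vspaceP => w; apply/span3P/span3P => -[x [y [z ->]]].
  by exists x, (y * r ^+ 6), (z * r ^+ 4); rewrite !scalerA.
by exists x, (y / r ^+ 6), (z / r ^+ 4); rewrite !scalerA !divfK.
Qed.

(* As all these spaces are equivalent, it is enough to find one that comes from an
   icosahedron; the icosahedra fall in this case because they have no null axis. *)
Lemma ico_normal3 (t : C) : t != 0 -> ico (normal3 t).
Proof.
move=> t0; have gg : (1%:M : 'M[C]_3) *m 1%:M^T = 1%:M by rewrite trmx1 mulmx1.
have icoI := ico_nondegenerate gg.
have [V nV eV] := equiv_normal (ico_iso icoI).
have [/(equiv_has_null eV)[a [an aa aU]]|[t1 t10 VE]] := has_null_normal nV.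
  have [b bb [k k0 aE]] := nondegenerate_axis gg an aU.
  have := mulf_neq0 (expf_neq0 2 k0) (axis_nonnull gg bb).
  have -> : k ^+ 2 * dot (b *m 1%:M) (b *m 1%:M) = dot a a.
    by rewrite aE dotZr dotC dotZr mulrA.
  by rewrite aa eqxx.
have icoV : ico (normal3 t1) by rewrite -VE; case: (equiv_ico eV) => h _; exact: h.
pose r := 10.-root (t1 / t).
have r10 : r ^+ 10 = t1 / t by rewrite rootCK.
have r0 : r != 0 by rewrite rootC_eq0 // mulf_neq0 ?invr_eq0.
have := ico_torus r0 icoV; rewrite torus_normal3 // r10.
by have -> : (t1 / t)^-1 * t1 = t by field; rewrite t0 t10.
Qed.

Lemma iso_ico U : isotropic U -> ico U.
Proof.
move=> isoU; have [V nV eV] := equiv_normal isoU.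
have [_ h] := equiv_ico eV; apply: h.
have [y2n yy yx xx] := y2_facts; have [x2n xx0 xxy] := x2_facts.
case: nV => [->|->|[t ->]].
- by rewrite normal1_degenerate; exact: ico_degenerate1 y2n yy yx xx.
- by rewrite normal2_degenerate; exact: ico_degenerate2 y2n yy yx xx.
have [->|t0] := eqVneq t 0; last exact: ico_normal3.
rewrite normal3_degenerate.
have -> : <<[:: cube xy; cube x2; T3 x2 x2 xy]>>%VS = <<[:: cube xy; T3 x2 x2 xy; cube x2]>>%VS.
  by apply: eq_span => w; rewrite !inE; congr (_ || _); exact: orbC.
exact: ico_degenerate1 x2n xx0 xxy xx.
Qed.

End Degenerate.

(** * Cubics and sextics *)

Section Restriction.
Variable C : numClosedFieldType.
Local Notation sxt := 'rV[C]_7.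
Local Notation vec := 'rV[C]_3.
Implicit Types (a b c : vec) (v w : sxt) (f : cubic C).

Definition sextic_row f : sxt := \row_k sextic f k.

Lemma sextic_row_is_linear : linear sextic_row.
Proof.
move=> k f g; apply/rowP => i; rewrite !mxE /sextic /=.
by rewrite comp_mpolyD comp_mpolyZ mcoeffD mcoeffZ.
Qed.
HB.instance Definition _ := GRing.isLinear.Build C (cubic C) sxt _ sextic_row sextic_row_is_linear.

Definition form w : {mpoly C[2]} :=
  \sum_(k < 7) co k w *: ('X_0 ^+ (6 - k) * 'X_1 ^+ k).

Lemma coeff_form w (k : 'I_7) : (form w)@_(U_(0) *+ (6 - k) + U_(1) *+ k) = co k w.
Proof.
rewrite /form raddf_sum /= (bigD1 k) //= big1 => [|i ik].
  by rewrite !mpolyXn -mpolyXD mcoeffZ mcoeffX eqxx mulr1 addr0.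
rewrite !mpolyXn -mpolyXD mcoeffZ mcoeffX; case: eqP => [|_]; last by rewrite mulr0.
move=> /(congr1 (fun m : 'X_{1..2} => m 1)); rewrite !mnmDE !mulmnE !mnm1E /=.
by rewrite !mul0n !mul1n => /val_inj e; rewrite e eqxx in ik.
Qed.

Lemma sextic_row_form f w : val f \mPo conic C = form w -> sextic_row f = w.
Proof.
move=> e; apply: v7_ext; rewrite ?co_v7.
all: by rewrite /co /sextic_row mxE /sextic e coeff_form inordK.
Qed.

Lemma lin_conic a : lin a \mPo conic C =
  q0 a *: 'X_0 ^+ 2 + q1 a *: ('X_0 * 'X_1) + q2 a *: 'X_1 ^+ 2.
Proof.
rewrite /lin !big_ord_recl big_ord0 !(comp_mpolyD, comp_mpolyZ, comp_mpolyXU) /=.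
rewrite (_ : a 0 ord0 = cr 0 a); last by congr (a _ _); apply/val_inj; rewrite /= inordK.
rewrite (_ : a 0 (lift ord0 ord0) = cr 1 a); last by congr (a _ _); apply/val_inj; rewrite /= inordK.
rewrite (_ : a 0 (lift ord0 (lift ord0 ord0)) = cr 2 a); last by congr (a _ _); apply/val_inj; rewrite /= inordK.
rewrite comp_mpoly0 /= /q0 /q1 /q2 -!mul_mpolyC; ring.
Qed.

Lemma norm2_conic : norm2 C \mPo conic C = 0.
Proof.
rewrite /norm2 !big_ord_recl big_ord0 !(comp_mpolyD, rmorphXn) /= !comp_mpolyXU comp_mpoly0 /=.
rewrite -!mul_mpolyC; have i2 := congr1 (@mpolyC 2 C) (i_sqr C).
rewrite rmorphXn rmorphN rmorph1 /= in i2; ring: i2.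
Qed.

Lemma sextic_row_lin3 a b c : sextic_row (lin3 a b c) = T3 a b c.
Proof.
apply: sextic_row_form; rewrite /= !rmorphM /= !lin_conic /form !big_ord_recl big_ord0 /=.
rewrite !co_v7 -!mul_mpolyC; ring.
Qed.

Lemma sextic_row_linn a : sextic_row (linn a) = 0.
Proof.
apply: sextic_row_form; rewrite /= rmorphM /= norm2_conic mulr0 /form big1 // => i _.
by rewrite co0 scale0r.
Qed.

Lemma sextic_row_fcub a : sextic_row (fcub a) = cube a.
Proof. by rewrite /fcub linearB linearZ /= sextic_row_lin3 sextic_row_linn scaler0 subr0. Qed.

End Restriction.

Section Harmonic.
Variable C : numClosedFieldType.
Local Notation sxt := 'rV[C]_7.
Local Notation vec := 'rV[C]_3.
Implicit Types (a b c : vec) (v w : sxt) (f h : cubic C).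

Lemma mderiv_lin a i : (lin a)^`M(i) = (a 0 i)%:MP.
Proof.
rewrite /lin raddf_sum /= (bigD1 i) //= big1 ?addr0 => [|j ji].
  by rewrite mderivZ mderivXU eqxx -mul_mpolyC mulr1.
by rewrite mderivZ mderivXU (negPf ji) scaler0.
Qed.

Lemma mderiv_norm2 i : (norm2 C)^`M(i) = 2 * 'X_i.
Proof.
rewrite /norm2 raddf_sum /= (bigD1 i) //= big1 ?addr0 => [|j ji].
  by rewrite expr2 mderivM mderivXU eqxx mulr1 mul1r mulr_natl.
by rewrite expr2 mderivM mderivXU (negPf ji) mulr0 mul0r addr0.
Qed.

Lemma lap_lin3 a b c : laplacian (lin3 a b c) =
  2 *: (dot a b *: lin c + dot a c *: lin b + dot b c *: lin a).
Proof.
rewrite /laplacian /= /dot !scaler_suml -!big_split /= scaler_sumr; apply: eq_bigr => i _.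
by rewrite !(mderivM, mderivD, mderiv_lin, mderivC) -!mul_mpolyC; ring.
Qed.

Lemma lap_linn a : laplacian (linn a) = 10 *: lin a.
Proof.
have e i : ((lin a * norm2 C)^`M(i))^`M(i) = 4 *: (a 0 i *: 'X_i) + 2 *: lin a.
  rewrite !(mderivM, mderivD, mderiv_lin, mderivC, mderiv_norm2, mderiv_nat, mderivXU) eqxx /=.
  by rewrite -!mul_mpolyC; ring.
rewrite /laplacian /=; under eq_bigr => i _ do rewrite e.
rewrite big_split /= -scaler_sumr sumr_const card_ord -/(lin a) -!mul_mpolyC; ring.
Qed.

Lemma harmonic_lap f : (f \in harmonic C) = (lap f == 0).
Proof. by rewrite memv_ker lfunE. Qed.

(** The Laplacian of (x, a)(x, x) is 10 (x, a); this is where the coefficients 3/5 = 6/10 and 1/5 =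
    2/10 come from. *)
Lemma harmonic_combination f h k (p : {mpoly C[3]}) :
  laplacian f = k *: p -> laplacian h = 10 *: p -> f - (k / 10) *: h \in harmonic C.
Proof.
move=> ef eh; rewrite harmonic_lap linearB linearZ; apply/eqP/val_inj => /=.
by rewrite ef eh scalerA divfK ?subrr // pnatr_eq0.
Qed.

Lemma harmonic_fcub a : fcub a \in harmonic C.
Proof.
have -> : fcub a = lin3 a a a - (6 * dot a a / 10) *: linn a.
  by congr (_ - _ *: _); field.
apply: harmonic_combination (lap_linn a).
by rewrite lap_lin3 -!scalerDl scalerA; congr (_ *: _); ring.
Qed.

Lemma harmonic_degenerate2 a b : dot a b = 0 ->
  lin3 a b b - (5^-1 * dot b b) *: linn a \in harmonic C.
Proof.
move=> ab; have -> : 5^-1 * dot b b = 2 * dot b b / 10 by field.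
apply: harmonic_combination (lap_linn a).
by rewrite lap_lin3 ab !scale0r !add0r scalerA.
Qed.

Lemma harmonic_lin3 a b : dot a a = 0 -> dot a b = 0 -> lin3 a a b \in harmonic C.
Proof.
by move=> aa ab; rewrite mem_harmonic lap_lin3 aa ab !scale0r !addr0 scaler0.
Qed.

(* The cubes of these null linear forms restrict to the sextics (z_1 + i z_2)^6, whose
   independence is a Vandermonde determinant. *)
Let nv (i : 'I_7) : vec := of_q 1 (2 * (i : nat)%:R) ((i : nat)%:R ^+ 2).
Let N i := lin3 (nv i) (nv i) (nv i).

Lemma nv_null i : dot (nv i) (nv i) = 0.
Proof. by rewrite dot_q !of_qK; field. Qed.

Lemma N_harmonic i : N i \in harmonic C.
Proof. by apply: harmonic_lin3; exact: nv_null. Qed.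

Let M := \matrix_i sextic_row (N i).

Lemma M_unit : M \in unitmx.
Proof.
pose x : sxt := \row_i (i : nat)%:R.
have -> : M = (Vandermonde 7 x)^T *m diag_mx (v7 1 6 15 20 15 6 1).
  apply/row_matrixP => i; rewrite rowK sextic_row_lin3.
  apply: v7_ext; rewrite !co_v7 /co mul_mx_diag !mxE !inordK //= !of_qK; ring.
rewrite unitmx_mul unitmx_tr !unitmxE det_Vandermonde det_diag !unitfE.
apply/andP; split; last first.
  apply/prodf_neq0 => i _; rewrite mxE.
  by case: i => [[|[|[|[|[|[|[|]]]]]]]] //= _; rewrite ?oner_neq0 ?pnatr_eq0.
apply/prodf_neq0 => i _; apply/prodf_neq0 => j ij.
by rewrite !mxE subr_eq0 eqr_nat gtn_eqF.
Qed.

Lemma sextic_row_combination w : sextic_row (\sum_i (w *m invmx M) 0 i *: N i) = w.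
Proof.
rewrite linear_sum /= -[RHS](mulmxKV M_unit) [RHS]mulmx_sum_row; apply: eq_bigr => i _.
by rewrite linearZ /= rowK.
Qed.

Lemma harmonic_combinationP w : \sum_i (w *m invmx M) 0 i *: N i \in harmonic C.
Proof. by rewrite rpred_sum // => i _; rewrite rpredZ // N_harmonic. Qed.

(** Restriction maps the harmonic cubics onto the sextics, and both spaces have dimension seven. *)
Lemma sextic_row_inj f h : f \in harmonic C -> h \in harmonic C -> sextic_row f = sextic_row h -> f = h.
Proof.
have img : (linfun (@sextic_row C) @: harmonic C)%VS = fullv.
  apply/eqP; rewrite eqEsubv subvf /=; apply/subvP => w _.
  apply/memv_imgP; exists (\sum_i (w *m invmx M) 0 i *: N i); first exact: harmonic_combinationP.
  by rewrite lfunE /= sextic_row_combination.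
have := limg_ker_dim (linfun (@sextic_row C)) (harmonic C).
rewrite img dim_harmonic dimvf /= => dk.
have {dk} : \dim (harmonic C :&: lker (linfun (@sextic_row C))) = 0%N.
  have : (\dim (harmonic C :&: lker (linfun (@sextic_row C))) + 7 = 7)%N by exact: dk.
  by lia.
move=> /eqP; rewrite dimv_eq0 => /eqP k0 fH hH e; apply/eqP; rewrite -subr_eq0 -memv0 -k0.
by rewrite memv_cap rpredB //= memv_ker lfunE /= linearB /= e subrr.
Qed.

Lemma harmonic_sum f : f \in harmonic C -> f = \sum_i (sextic_row f *m invmx M) 0 i *: N i.
Proof.
by move=> fH; apply: sextic_row_inj => //; rewrite ?harmonic_combinationP ?sextic_row_combination.
Qed.

Lemma sextic_row_surj w : exists2 f, f \in harmonic C & sextic_row f = w.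
Proof. by eexists; [exact: harmonic_combinationP|exact: sextic_row_combination]. Qed.

Lemma pairingC f h : pairing f h = pairing h f.
Proof. by apply: eq_bigr => m _; rewrite mulrAC. Qed.

Lemma pairing_is_linear f : linear (pairing f : cubic C -> C^o).
Proof.
move=> k h h'; rewrite /pairing /= scaler_sumr -big_split /=; apply: eq_bigr => m _.
by rewrite mcoeffD mcoeffZ /GRing.scale /=; ring.
Qed.
HB.instance Definition _ f := GRing.isLinear.Build C (cubic C) C^o _ (pairing f) (pairing_is_linear f).

Lemma apolarC v w : apolar v w = apolar w v.
Proof. by rewrite /apolar; ring. Qed.

Lemma apolar_is_linear v : linear (apolar v : sxt -> C^o).
Proof. by move=> k w w'; rewrite apolarDr apolarZr. Qed.
HB.instance Definition _ v := GRing.isLinear.Build C sxt C^o _ (apolar v) (apolar_is_linear v).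

Lemma meval_lin a b : (lin a).@[b 0] = dot a b.
Proof. by rewrite /lin raddf_sum; apply: eq_bigr => i _; rewrite /= mevalZ mevalXU. Qed.

Lemma pairing_null_cubes a b : dot a a = 0 -> dot b b = 0 ->
  apolar (sextic_row (lin3 a a a)) (sextic_row (lin3 b b b)) = -480 * pairing (lin3 a a a) (lin3 b b b).
Proof.
move=> aa bb; rewrite pairing_lin3 /= !mevalM !meval_lin !sextic_row_lin3 apolar_T3 aa bb; ring.
Qed.

(** Both sides are bilinear and the cubes [N i] of null forms span the harmonic cubics, so it
    suffices to compare pairs of such cubes. *)
Lemma apolar_sextic_row f h : f \in harmonic C -> h \in harmonic C ->
  apolar (sextic_row f) (sextic_row h) = - 480 * pairing f h.
Proof.
have half i g : g \in harmonic C -> apolar (sextic_row (N i)) (sextic_row g) = - 480 * pairing (N i) g.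
  move=> /harmonic_sum ->; move: (sextic_row g *m _) => x.
  rewrite !linear_sum mulr_sumr; apply: eq_bigr => j _.
  by rewrite !linearZ /= /GRing.scale /= pairing_null_cubes ?nv_null //; ring.
move=> /harmonic_sum -> hH; move: (sextic_row f *m _) => x.
rewrite apolarC pairingC !linear_sum mulr_sumr; apply: eq_bigr => j _.
by rewrite !linearZ /= /GRing.scale /= apolarC pairingC half //; ring.
Qed.

End Harmonic.

(** * The bijection between icosahedral sets and isotropic spaces *)

Section Correspondence.
Variable C : numClosedFieldType.
Local Notation sxt := 'rV[C]_7.
Local Notation vec := 'rV[C]_3.
Implicit Types (a b c : vec) (v w : sxt) (U V : {vspace sxt}) (X Y : icosahedral_data C).

(* The restriction to the conic of [icosahedral]. It suffices that g is orthogonal, since g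
   and - g give the same data. *)
Inductive icoX : icosahedral_data C -> {vspace sxt} -> Prop :=
| icoX_nondegenerate (g : 'M[C]_3) of g *m g^T = 1%:M :
    icoX (Nondegenerate [fset <[a *m g]>%VS | a in axes C]%fset)
      <<[seq cube (a *m g) | a <- axes C]>>%VS
| icoX_degenerate1 a b of a != 0 & dot a a = 0 & dot a b = 0 & dot b b != 0 :
    icoX (Degenerate1 <[a]>%VS <[b]>%VS) <<[:: cube b; T3 a a b; cube a]>>%VS
| icoX_degenerate2 a b of a != 0 & dot a a = 0 & dot a b = 0 & dot b b != 0 :
    icoX (Degenerate2 <[a]>%VS) <<[:: T3 a b b; T3 a a b; cube a]>>%VS.

Lemma icoX_ico X U : icoX X U -> ico U.
Proof.
by case=> *; [exact: ico_nondegenerate|exact: ico_degenerate1|exact: ico_degenerate2].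
Qed.

Lemma ico_icoX U : ico U -> exists X, icoX X U.
Proof.
case=> [g gg|a b an aa ab bb|a b an aa ab bb]; eexists.
- exact: icoX_nondegenerate gg.
- exact: icoX_degenerate1 an aa ab bb.
- exact: icoX_degenerate2 an aa ab bb.
Qed.

Lemma eq_line (vT : vectType C) (u v : vT) k : k != 0 -> u = k *: v -> <[u]>%VS = <[v]>%VS.
Proof.
move=> k0 ->; apply/eqP; rewrite eqEsubv -!memvE memvZ ?memv_line //=.
by apply/vlineP; exists k^-1; rewrite scalerA mulVf // scale1r.
Qed.

Lemma lineP (vT : vectType C) (u v : vT) : <[u]>%VS = <[v]>%VS -> exists k, u = k *: v.
Proof. by move=> e; apply/vlineP; rewrite -e memv_line. Qed.

Section NondegenerateLines.
Variables g h : 'M[C]_3.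

Lemma sub_span_cubes :
  ([fset <[a *m g]>%VS | a in axes C] `<=` [fset <[a *m h]>%VS | a in axes C])%fset ->
  (<<[seq cube (a *m g) | a <- axes C]>> <= <<[seq cube (a *m h) | a <- axes C]>>)%VS.
Proof.
move=> /fsubsetP sub; apply/span_subvP => _ /mapP[a aa ->].
have /sub/imfsetP[b /= ba /lineP[k ->]] : <[a *m g]>%VS \in [fset <[a *m g]>%VS | a in axes C]%fset.
  by apply/imfsetP; exists a.
by rewrite cubeZ memvZ // memv_span //; exact: (map_f (fun a => cube (a *m h)) ba).
Qed.

Lemma sub_axes : g *m g^T = 1%:M -> h *m h^T = 1%:M ->
  (<<[seq cube (a *m g) | a <- axes C]>> <= <<[seq cube (a *m h) | a <- axes C]>>)%VS ->
  ([fset <[a *m g]>%VS | a in axes C] `<=` [fset <[a *m h]>%VS | a in axes C])%fset.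
Proof.
move=> gg hh /subvP sub; apply/fsubsetP => _ /imfsetP[a /= aa ->].
have an : a *m g != 0.
  by apply: contraNneq (axis_nonnull gg aa) => ->; rewrite dot_cr !cr0 !mul0r !addr0.
have [|b ba [k k0 e]] := nondegenerate_axis hh an.
  by apply: sub; apply: memv_span; exact: (map_f (fun a => cube (a *m g)) aa).
by apply/imfsetP; exists b => //; exact: eq_line k0 e.
Qed.
End NondegenerateLines.

Lemma sub_degenerate1 a b (k l : C) :
  (<<[:: cube (l *: b); T3 (k *: a) (k *: a) (l *: b); cube (k *: a)]>> <=
   <<[:: cube b; T3 a a b; cube a]>>)%VS.
Proof.
apply/span_subvP => w; rewrite !inE => /or3P[] /eqP ->; apply/span3P.
- by exists (l ^+ 3), 0, 0; apply: v7_ext; rewrite !(coD, coZ) !co_v7 !qZ; ring.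
- by exists 0, (k ^+ 2 * l), 0; apply: v7_ext; rewrite !(coD, coZ) !co_v7 !qZ; ring.
- by exists 0, 0, (k ^+ 3); apply: v7_ext; rewrite !(coD, coZ) !co_v7 !qZ; ring.
Qed.

(** Replacing b by another vector orthogonal to a adds a multiple of a, so a space of type 2 depends
    on the line of a only. *)
Lemma sub_degenerate2 a b (k x y : C) (b' := x *: a + y *: b) :
  (<<[:: T3 (k *: a) b' b'; T3 (k *: a) (k *: a) b'; cube (k *: a)]>> <=
   <<[:: T3 a b b; T3 a a b; cube a]>>)%VS.
Proof.
apply/span_subvP => w; rewrite !inE => /or3P[] /eqP ->; apply/span3P.
- exists (k * y ^+ 2), (2 * k * x * y), (k * x ^+ 2).
  by apply: v7_ext; rewrite !(coD, coZ) !co_v7 !(qD, qZ); ring.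
- exists 0, (k ^+ 2 * y), (k ^+ 2 * x).
  by apply: v7_ext; rewrite !(coD, coZ) !co_v7 !(qD, qZ); ring.
- by exists 0, 0, (k ^+ 3); apply: v7_ext; rewrite !(coD, coZ) !co_v7 !qZ; ring.
Qed.

(** The separate equation X = Y lets both derivations be analysed; the default values in the
    projections are never reached. *)
Lemma icoX_sub X Y U V : X = Y -> icoX X U -> icoX Y V -> (U <= V)%VS.
Proof.
move=> e hU hV; case: hU e => [g gg|a b an aa ab bb|a b an aa ab bb];
  case: hV => [h hh|a' b' an' aa' ab' bb'|a' b' an' aa' ab' bb'] //.
- move=> /(congr1 (fun X => if X is Nondegenerate s then s else fset0)) /= e.
  by apply: sub_span_cubes; rewrite e fsubset_refl.
- move=> /(congr1 (fun X => if X is Degenerate1 p q then (p, q) else (0, 0)%VS)) /= e.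
  have [k ->] := lineP (congr1 fst e).
  by have [l ->] := lineP (congr1 snd e); exact: sub_degenerate1.
- move=> /(congr1 (fun X => if X is Degenerate2 p then p else 0%VS)) /= e; have [k ka] := lineP e.
  have [|x [y ->]] := orthogonal_combination an' aa' ab' bb' (c := b).
    have : k * dot a' b = 0 by rewrite dotC -dotZr -ka dotC.
    by move/eqP; rewrite mulf_eq0 => /orP[/eqP k0|/eqP //]; rewrite ka k0 scale0r eqxx in an.
  by rewrite ka; exact: sub_degenerate2.
Qed.

Lemma icoX_fun X U V : icoX X U -> icoX X V -> U = V.
Proof.
by move=> hU hV; apply/eqP; rewrite eqEsubv (icoX_sub erefl hU hV) (icoX_sub erefl hV hU).
Qed.

Lemma nondegenerate_no_null (g : 'M[C]_3) : g *m g^T = 1%:M ->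
  ~ has_null <<[seq cube (a *m g) | a <- axes C]>>%VS.
Proof.
move=> gg [a [an aa /(nondegenerate_axis gg an)[b ba [k k0 e]]]].
have /eqP := mulf_neq0 (expf_neq0 2 k0) (axis_nonnull gg ba); apply.
by rewrite -[RHS]aa e dotZr dotC dotZr mulrA.
Qed.

Lemma degenerate1_has_null a b : a != 0 -> dot a a = 0 ->
  has_null <<[:: cube b; T3 a a b; cube a]>>%VS.
Proof. by move=> an aa; exists a; split=> //; rewrite memv_span // !inE eqxx ?orbT. Qed.

Lemma degenerate2_has_null a b : a != 0 -> dot a a = 0 ->
  has_null <<[:: T3 a b b; T3 a a b; cube a]>>%VS.
Proof. by move=> an aa; exists a; split=> //; rewrite memv_span // !inE eqxx ?orbT. Qed.

Lemma nonnull_neq0 b : dot b b != 0 -> b != 0.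
Proof. by apply: contraNneq => ->; rewrite dot_cr !cr0 !mul0r !addr0. Qed.

Lemma null_scale k b : dot (k *: b) (k *: b) = k ^+ 2 * dot b b.
Proof. by rewrite dotZr dotC dotZr mulrA. Qed.

(** The first space contains the cube of b, which is not null, whereas cubes of nonzero vectors in
    the second come from multiples of the null a'. *)
Lemma degenerate1_neq_degenerate2 a b a' b' : dot b b != 0 ->
  a' != 0 -> dot a' a' = 0 -> dot a' b' = 0 -> dot b' b' != 0 ->
  <<[:: cube b; T3 a a b; cube a]>>%VS <> <<[:: T3 a' b' b'; T3 a' a' b'; cube a']>>%VS.
Proof.
move=> bb an' aa' ab' bb' e.
have [|k _ bE] := degenerate2_axis an' aa' ab' bb' (nonnull_neq0 bb).
  by rewrite -e memv_span // !inE eqxx.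
by move/eqP: bb; apply; rewrite bE null_scale aa' mulr0.
Qed.

Lemma icoX_inj X Y U : icoX X U -> icoX Y U -> X = Y.
Proof.
suff main V : U = V -> icoX X U -> icoX Y V -> X = Y by exact: main.
move=> e hU hV; case: hU e => [g gg|a b an aa ab bb|a b an aa ab bb];
  case: hV => [h hh|a' b' an' aa' ab' bb'|a' b' an' aa' ab' bb'] e.
- congr Nondegenerate; apply/eqP; rewrite eqEfsubset !sub_axes //; by rewrite e.
- by case: (nondegenerate_no_null gg); rewrite e; exact: degenerate1_has_null.
- by case: (nondegenerate_no_null gg); rewrite e; exact: degenerate2_has_null.
- by case: (nondegenerate_no_null hh); rewrite -e; exact: degenerate1_has_null.
- have aU : cube a \in <<[:: cube b'; T3 a' a' b'; cube a']>>%VS.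
    by rewrite -e memv_span // !inE eqxx ?orbT.
  have bU : cube b \in <<[:: cube b'; T3 a' a' b'; cube a']>>%VS.
    by rewrite -e memv_span // !inE eqxx ?orbT.
  congr Degenerate1.
  + have [] := degenerate1_axis an' aa' ab' bb' an aU => -[k k0 aE]; first exact: eq_line k0 aE.
    by case/eqP: (mulf_neq0 (expf_neq0 2 k0) bb'); rewrite -null_scale -aE.
  + have [] := degenerate1_axis an' aa' ab' bb' (nonnull_neq0 bb) bU => -[k k0 bE]; last exact: eq_line k0 bE.
    by move/eqP: bb; case; rewrite bE null_scale aa' mulr0.
- by case: (degenerate1_neq_degenerate2 bb an' aa' ab' bb' e).
- by case: (nondegenerate_no_null hh); rewrite -e; exact: degenerate2_has_null.
- by case: (degenerate1_neq_degenerate2 bb' an aa ab bb (esym e)).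
- have [|k k0 aE] := degenerate2_axis an' aa' ab' bb' an; last by congr Degenerate2; exact: eq_line k0 aE.
  by rewrite -e memv_span // !inE eqxx ?orbT.
Qed.

Notation sx_image U0 := (linfun (@sextic_row C) @: U0)%VS.

Lemma icosahedral_harmonic X (U0 : {vspace cubic C}) : icosahedral X U0 -> (U0 <= harmonic C)%VS.
Proof.
case=> [g gg|a b an aa ab bb|a b an aa ab bb]; apply/span_subvP => f.
- by move=> /mapP[a _ ->]; exact: harmonic_fcub.
- rewrite !inE => /or3P[] /eqP ->; [exact: harmonic_fcub|exact: harmonic_lin3..].
- by rewrite !inE => /or3P[] /eqP ->; [exact: harmonic_degenerate2|exact: harmonic_lin3..].
Qed.

Lemma sx_image3 (f g h : cubic C) : sx_image <<[:: f; g; h]>>%VS = <<[:: sextic_row f; sextic_row g; sextic_row h]>>%VS.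
Proof. by rewrite limg_span /= !lfunE. Qed.

Lemma icosahedral_icoX X (U0 : {vspace cubic C}) : icosahedral X U0 -> icoX X (sx_image U0).
Proof.
case=> [g [gg _]|a b an aa ab bb|a b an aa ab bb].
- rewrite limg_span -map_comp; rewrite (eq_map (g := fun a => cube (a *m g))); last first.
    by move=> a; rewrite /= lfunE /= sextic_row_fcub.
  exact: icoX_nondegenerate.
- by rewrite sx_image3 sextic_row_fcub !sextic_row_lin3; exact: icoX_degenerate1.
- by rewrite sx_image3 linearB linearZ /= sextic_row_linn scaler0 subr0 !sextic_row_lin3; exact: icoX_degenerate2.
Qed.

Lemma icoX_icosahedral X U : icoX X U -> exists2 U0, icosahedral X U0 & U = sx_image U0.
Proof.
have SO3_case (g : 'M[C]_3) : SO3 g -> exists2 U0,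
    icosahedral (Nondegenerate [fset <[a *m g]>%VS | a in axes C]%fset) U0 &
    <<[seq cube (a *m g) | a <- axes C]>>%VS = sx_image U0.
  move=> gSO; have i0 := IcoNondegenerate gSO; eexists; first exact: i0.
  by apply: icoX_fun (icosahedral_icoX i0); apply: icoX_nondegenerate; case: gSO.
case=> [g gg|a b an aa ab bb|a b an aa ab bb]; last 2 first.
- have i0 := IcoDegenerate1 an aa ab bb; eexists; first exact: i0.
  exact: icoX_fun (icoX_degenerate1 an aa ab bb) (icosahedral_icoX i0).
- have i0 := IcoDegenerate2 an aa ab bb; eexists; first exact: i0.
  exact: icoX_fun (icoX_degenerate2 an aa ab bb) (icosahedral_icoX i0).
have : (\det g) ^+ 2 == 1.
  by rewrite expr2 -{2}det_tr -det_mulmx gg det1.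
rewrite sqrf_eq1 => /orP[/eqP d1|/eqP d1]; first by apply: SO3_case; split.
have gSO : SO3 (- g).
  split; first by rewrite linearN /= mulNmx mulmxN opprK.
  by rewrite -scaleN1r detZ d1 -signr_odd /= expr1 mulrNN mulr1.
have [U0 i0 e0] := SO3_case _ gSO.
have nE a : a *m - g = (- 1) *: (a *m g) by rewrite mulmxN scaleN1r.
have m1 : (-1 : C) != 0 by rewrite oppr_eq0 oner_neq0.
have lines : [fset <[a *m - g]>%VS | a in axes C]%fset = [fset <[a *m g]>%VS | a in axes C]%fset.
  by apply: eq_imfset => // a; apply: (eq_line m1); exact: nE.
rewrite -lines; exists U0 => //; apply: icoX_fun (icosahedral_icoX i0).
by rewrite lines; apply: icoX_nondegenerate.
Qed.

Lemma contains_icoX f X : f \in harmonic C ->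
  contains f X <-> exists2 U, apolar_isotropics (sextic_row f) U & icoX X U.
Proof.
move=> fH; split=> [[U0 i0 o0]|[U [isoU oU]]].
  exists (sx_image U0); last exact: icosahedral_icoX.
  split; first exact/ico_iso/icoX_ico/icosahedral_icoX/i0.
  move=> _ /memv_imgP[h hU ->]; rewrite lfunE /= apolar_sextic_row //; last exact: (subvP (icosahedral_harmonic i0)).
  by rewrite o0 // mulr0.
move=> /icoX_icosahedral[U0 i0 UE]; exists U0 => // h hU.
apply: (@mulfI0 C 479); apply: (lincomb (k := -1) (oU (sextic_row h) _)).
  by rewrite UE; apply/memv_imgP; exists h => //; rewrite lfunE.
rewrite apolar_sextic_row //; last exact: (subvP (icosahedral_harmonic i0)).
by ring.
Qed.

Section Transfer.
Variable f : cubic C.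
Hypothesis fH : f \in harmonic C.

Let QS X : icosahedral_sets_in f X -> exists2 U, apolar_isotropics (sextic_row f) U & icoX X U.
Proof. by move/(contains_icoX _ fH). Qed.
Let QS' U : apolar_isotropics (sextic_row f) U -> exists2 X, icosahedral_sets_in f X & icoX X U.
Proof.
move=> ZU; have [isoU _] := ZU; have [X hX] := ico_icoX (iso_ico isoU).
by exists X => //; apply/(contains_icoX _ fH); exists U.
Qed.

Lemma sextic_row_neq0 : f != 0 -> sextic_row f != 0.
Proof. by apply: contraNneq => s0; apply/eqP/sextic_row_inj; rewrite ?mem0v // s0 linear0. Qed.

Lemma exactly_two_icosahedral_sets : f != 0 -> J (sextic_row f) != 0 ->
  exactly_two (icosahedral_sets_in f).
Proof.
move=> /sextic_row_neq0/dichotomy_nonzero[h _] /h.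
exact: (exactly_two_bij QS QS' icoX_fun icoX_inj).
Qed.

Lemma one_or_infinite_icosahedral_sets : f != 0 -> J (sextic_row f) = 0 ->
  one_or_infinite (icosahedral_sets_in f).
Proof.
move=> /sextic_row_neq0/dichotomy_nonzero[_ h] /h.
exact: (one_or_infinite_bij QS QS' icoX_fun icoX_inj).
Qed.
End Transfer.

End Correspondence.

(** * Genericity and the final equivalence *)

Lemma dhomogXn n (K : comNzRingType) (p : {mpoly K[n]}) d k : p \is d.-homog -> p ^+ k \is (d * k).-homog.
Proof.
move=> hp; elim: k => [|k IH]; first by rewrite muln0 expr0 dhomog1.
by rewrite exprS mulnS dhomogM.
Qed.

Lemma dhomog_comp n m (K : comNzRingType) (p : {mpoly K[n]}) (lq : n.-tuple {mpoly K[m]}) d :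
  p \is d.-homog -> (forall i, tnth lq i \is 1.-homog) -> p \mPo lq \is d.-homog.
Proof.
move=> /dhomogP hp hq; rewrite comp_mpolyE big_seq rpred_sum // => s sp; rewrite rpredZ //.
have <- : mdeg s = d by exact: hp.
rewrite mdegE; elim/big_rec2: _ => [|i e q _ he]; first exact: dhomog1.
by apply: dhomogM => //; rewrite -[X in X.-homog]mul1n dhomogXn.
Qed.

Lemma J6_homog (C : numClosedFieldType) : J6 C \is 6.-homog.
Proof.
have [hA hB hC] := inv_homog C; rewrite /J6 rpredB ?rpredD ?rpredZ //.
- exact: (dhomogXn 3 hA).
- exact: (dhomogM hA hB).
Qed.

(** The invariant is pulled back to the coordinates of V by substituting the linear forms [L k] for
    the coefficients of the sextic, which keeps it homogeneous. The sextic z_1^3 z_2^3 shows that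
    the open set is nonempty. *)
Lemma generic_J6 (C : numClosedFieldType) :
  for_generic_point (harmonic C) (fun f => J (sextic_row f) != 0).
Proof.
pose V := harmonic C; pose b i := (vbasis V)`_i.
pose L k := \sum_(i < \dim V) sextic_row (b i) 0 k *: 'X_i : {mpoly C[\dim V]}.
pose F := J6 C \mPo [tuple L k | k < 7].
have FE f : f \in V -> F.@[coords V f] = J (sextic_row f).
  move=> fV; rewrite /F /J comp_mpoly_meval; apply: meval_eq => k.
  rewrite tnth_mktuple /L raddf_sum /= [in RHS](coord_vbasis fV) linear_sum /= summxE.
  by apply: eq_bigr => i _; rewrite mevalZ mevalXU linearZ /= !mxE mulrC.
eexists; split.
- exists [set F]%classic; split; last by [].
  move=> _ ->; exists 6%N; apply: dhomog_comp (J6_homog C) _ => k.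
  rewrite tnth_mktuple rpred_sum // => i _; by rewrite rpredZ // dhomogX /= mdeg1.
- have [f fH fE] := sextic_row_surj (v7 0 0 0 1 0 0 0 : 'rV[C]_7).
  have Jf : J (sextic_row f) != 0 by rewrite fE J_two_triple_roots.
  exists <[f]>%VS, f; split=> //.
    apply: contraNneq Jf => ->; rewrite linear0 -(scale0r 0) J_scale expr0n /= mul0r; exact: eqxx.
  by exists F; rewrite ?FE.
(* The open set only provides some representative g of the point [f]; with f = k g the value of J is
   multiplied by k^6. *)
- move=> f fH f0 [g [gH g0 e [_ -> ]]]; rewrite FE // => Jg.
  have /vlineP[k fE] : f \in <[g]>%VS by rewrite -e memv_line.
  rewrite fE linearZ /= J_scale mulf_neq0 // expf_neq0 //.
  by apply: contraNneq f0 => k0; rewrite fE k0 scale0r.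
Qed.

Theorem theorem5 (R : realType) :
  for_generic_point (harmonic R[i]) (fun f =>
    exists X Y, X <> Y /\ icosahedral_sets_in f = [set X; Y]%classic) /\
  forall f : cubic R[i], f \in harmonic R[i] -> f != 0 ->
    ((exists X, icosahedral_sets_in f = [set X]%classic) \/
      infinite_set (icosahedral_sets_in f)) <->
    (J6 R[i]).@[sextic f] = 0.
Proof.
have JE (f : cubic R[i]) : J (sextic_row f) = (J6 R[i]).@[sextic f].
  by apply: meval_eq => k; rewrite mxE.
split.
  have [W [Wo W0 WP]] := generic_J6 R[i]; exists W; split=> // f fH f0 Wf.
  exact: exactly_two_icosahedral_sets fH f0 (WP f fH f0 Wf).
move=> f fH f0; rewrite -JE; split=> [h|]; last exact: one_or_infinite_icosahedral_sets.
apply/eqP/negPn/negP => J0; apply: (one_or_infinite_not_two _ h).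
exact: exactly_two_icosahedral_sets.
Qed.
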